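(* Let $m_0\in\mathcal{M}(\mathbb{R})$ have compact support. Then there exists a global weak solution $u$ to the mCH equation with initial datum $m_0$ satisfying $$u\in C([0,+\infty);H^1(\mathbb{R}))\cap L^\infty(0,+\infty;W^{1,\infty}(\mathbb{R})),$$ and $$m=u-u_{xx}\in\mathcal{M}(\mathbb{R}\times[0,T))\quad\text{for any }T>0.$$
   Context: $\mathcal{M}(\cdot)$ denotes the space of (signed) Radon measures. The mCH equation is $m_t+[(u^2-u_x^2)m]_x=0$, $m=u-u_{xx}$, $x\in\mathbb{R}$, $t>0$, with $m(\cdot,0)=m_0$. Weak solution: for $\phi\in C_c^\infty(\mathbb{R}\times[0,T))$ set $$\mathcal{L}(u,\phi):=\int_0^T\!\!\int_{\mathbb{R}}u[\phi_t-\phi_{txx}]dxdt-\frac13\int_0^T\!\!\int_{\mathbb{R}}u_x^3\phi_{xx}dxdt-\frac13\int_0^T\!\!\int_{\mathbb{R}}u^3\phi_{xxx}dxdt+\int_0^T\!\!\int_{\mathbb{R}}(u^3+uu_x^2)\phi_xdxdt .$$ A function $u\in C([0,T);H^1(\mathbb{R}))\cap L^\infty(0,T;W^{1,\infty}(\mathbb{R}))$ is a weak solution of the mCH equation with initial datum $m_0\in\mathcal{M}(\mathbb{R})$ if $\mathcal{L}(u,\phi)=-\int_{\mathbb{R}}\phi(x,0)\,dm_0(x)$ for all $\phi\in C_c^\infty(\mathbb{R}\times[0,T))$. If $T=+\infty$, $u$ is called a global weak solution. *)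

(* Defs.v *)
From HB Require Import structures.
From mathcomp Require Import all_boot all_order all_algebra.
From mathcomp Require Import all_classical all_reals all_analysis.
Set Implicit Arguments.
Unset Strict Implicit.
Unset Printing Implicit Defensive.
Import Order.TTheory GRing.Theory Num.Theory.
Import numFieldNormedType.Exports.
Local Open Scope classical_set_scope.
Local Open Scope ring_scope.

Section test_functions.
Context {R : realType}.

Definition test_function (phi : R -> R) :=
  (forall n x, derivable (derive1n n phi) x 1) /\
  compact (closure [set x | phi x != 0]).

(* Points of the space-time plane R * R are pairs (x, t). *)
Definition dx (phi : R * R -> R) : R * R -> R := 'D_(1, 0) phi.
Definition dt (phi : R * R -> R) : R * R -> R := 'D_(0, 1) phi.

Definition partial (w : seq bool) (phi : R * R -> R) : R * R -> R :=
  foldr (fun b f => if b then dt f else dx f) phi w.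

Definition smooth2 (phi : R * R -> R) := forall w : seq bool,
  continuous (partial w phi) /\
  forall p, derivable (partial w phi) p (1, 0) /\
            derivable (partial w phi) p (0, 1).

(* C_c^oo(R x [0, T[), 0 < T <= +oo: these are the restrictions to t >= 0 of the
   smooth functions on the plane with compact support inside R x ]-oo, T[, so
   that a test function need not vanish at t = 0. *)
Definition spacetime_test_function (T : \bar R) (phi : R * R -> R) :=
  [/\ smooth2 phi, compact (closure [set p | phi p != 0]) &
      closure [set p | phi p != 0] `<=` [set p | (p.2%:E < T)%E]].

End test_functions.

Section charges.
Context d (X : measurableType d) {R : realType}.

Definition hahn_sets (nu : {charge set X -> \bar R}) :
    {PN : set X * set X | hahn_decomposition nu PN.1 PN.2} :=
  let: exist P exN := cid (Hahn_decomposition nu) in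
  let: exist N nuPN := cid exN in
  exist _ (P, N) nuPN.

(* Integral with respect to a signed measure; it does not depend on the choice
   of the Hahn decomposition. *)
Definition charge_integral (nu : {charge set X -> \bar R}) (D : set X)
    (f : X -> R) : R :=
  \int[jordan_pos (svalP (hahn_sets nu))]_(x in D) f x -
  \int[jordan_neg (svalP (hahn_sets nu))]_(x in D) f x.

End charges.

Section mCH.
Context {R : realType}.
Notation mu := (@lebesgue_measure R).

(* Finite signed Borel measures on R and on R^2 are automatically Radon; they
   are represented by charges, which are finite by definition. *)
Definition charge_support (nu : {charge set (measurableTypeR R) -> \bar R}) :
    set R :=
  ~` \bigcup_(U in [set U : set R | open U /\
        forall A : set R, measurable A -> A `<=` U -> nu A = 0%E]) U.

Definition weak_derivative (f g : R -> R) :=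
  [/\ locally_integrable setT f, locally_integrable setT g &
      forall phi, test_function phi ->
        \int[mu]_x (f x * derive1 phi x) = - \int[mu]_x (g x * phi x)].

(* f belongs to W^{1,p}(R) and has weak derivative g; H^1 is the case p = 2. *)
Definition sobolev1 (p : \bar R) (f g : R -> R) :=
  [/\ f \in Lfun mu p, g \in Lfun mu p & weak_derivative f g].

Definition H1_norm (f g : R -> R) : \bar R :=
  (('N[mu]_2%:E[EFin \o f] ^+ 2 + 'N[mu]_2%:E[EFin \o g] ^+ 2) `^ 2^-1)%E.

Definition W1oo_norm (f g : R -> R) : \bar R :=
  ('N[mu]_+oo[EFin \o f] + 'N[mu]_+oo[EFin \o g])%E.

Definition time_domain (T : \bar R) : set R :=
  [set t | 0 <= t /\ (t%:E < T)%E].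

(* Below, u t x and ux t x stand for u(x, t) and u_x(x, t). *)

(* u \in C([0, T[; H^1(R)), with u_x = ux *)
Definition C_H1 (T : \bar R) (u ux : R -> R -> R) :=
  (forall t, time_domain T t -> sobolev1 2%:E (u t) (ux t)) /\
  (forall s, time_domain T s ->
     H1_norm (u t \- u s) (ux t \- ux s)
       @[t --> within (time_domain T) (nbhs s)] --> 0%E).

(* u \in L^oo(0, T; W^{1,oo}(R)), with u_x = ux *)
Definition Loo_W1oo (T : \bar R) (u ux : R -> R -> R) :=
  exists C : R, {ae mu, forall t, time_domain T t ->
    sobolev1 +oo%E (u t) (ux t) /\ (W1oo_norm (u t) (ux t) <= C%:E)%E}.

Definition mCH_form (T : \bar R) (u ux : R -> R -> R) (phi : R * R -> R) : R :=
  \int[mu]_(t in time_domain T) \int[mu]_x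
     (u t x * (dt phi (x, t) - dt (dx (dx phi)) (x, t)))
  - 3^-1 * \int[mu]_(t in time_domain T) \int[mu]_x
     (ux t x ^+ 3 * dx (dx phi) (x, t))
  - 3^-1 * \int[mu]_(t in time_domain T) \int[mu]_x
     (u t x ^+ 3 * dx (dx (dx phi)) (x, t))
  + \int[mu]_(t in time_domain T) \int[mu]_x
     ((u t x ^+ 3 + u t x * ux t x ^+ 2) * dx phi (x, t)).

Definition mCH_weak_solution (T : \bar R)
    (m0 : {charge set (measurableTypeR R) -> \bar R}) (u ux : R -> R -> R) :=
  [/\ C_H1 T u ux, Loo_W1oo T u ux &
      forall phi, spacetime_test_function T phi ->
        mCH_form T u ux phi = - charge_integral m0 setT (fun x => phi (x, 0))].

(* The distribution u - u_xx on R x [0, T[ is represented by the restriction of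
   m to R x [0, T[. *)
Definition momentum_measure (T : \bar R) (u : R -> R -> R)
    (m : {charge set (measurableTypeR R * measurableTypeR R)%type -> \bar R}) :=
  forall phi, spacetime_test_function T phi ->
    \int[mu]_(t in time_domain T) \int[mu]_x
       (u t x * (phi (x, t) - dx (dx phi) (x, t))) =
    charge_integral m [set p | time_domain T p.2] phi.

End mCH.

(* Main.v *)
(** Write [m0] as a sign [sg] times its total variation [mu], and look for
    [u(x, t) = \int sg(a) G(x - Y(a, t)) dmu(a)] with [G(x) = exp(-|x|)/2], the Green
    function of [1 - d_x^2], where the flow [Y] transports the labels [a]. For such [u]
    the cubic part of the weak formulation is
    [1/6 \int\int\int sg sg sg exp(min - max) phi_x(median) dmu^3], where min, max and median
    are those of the three positions [Y(a, t), Y(b, t), Y(c, t)]: in this form the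
    nonlinearity is continuous in the positions, even when labels collide. The velocity
    field giving this trilinear form is discontinuous where positions coincide, so the
    indicator of the median is smoothed at scale [e]. This makes the velocity Lipschitz,
    and Euler steps that are small compared with [e] keep the labels ordered and move them
    at a speed bounded by [mu(R)^2 / 2]. By Helly's selection theorem a subsequence of
    the Euler flows converges outside a [mu]-null set of labels at each time, to a flow
    that is monotone in the label and Lipschitz in time, and dominated convergence passes
    to the limit in the trilinear form. Continuity in [H^1] follows from the estimate
    [\int |k(x - a) - k(x - b)| dx = O(|a - b|)] for [k = G, G'], and [u - u_xx] is the
    image of [m0 \x dt] under [(a, t) |-> (Y(a, t), t)]. *)

(* Labels keep their sign for all time: labels of opposite signs that meet are neither merged nor
   cancelled, so [mu] and [sg] stay fixed and only positions evolve. The trilinear form arises by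
   polarising the cubic terms: between consecutive positions the product of three kernels is a
   multiple of [exp(k x)] with k among 3, 1, -1, -3, the integrand is an exact derivative there, and
   all boundary terms cancel except those at the median. Its coefficient 1/6 is the 1/2 of the
   velocity times the 1/3 of an average over rotations of a triple; a lone atom of mass p thus moves
   at speed p^2/6. The Lipschitz constant of the smoothed velocity grows like 1/e, but the speed
   bound does not depend on e, and only the latter survives in the limit. The limit flow has to be
   monotone and Lipschitz for every label, while convergence of a sequence holds only off a null
   set. Hence limits are first taken along an ultrafilter, for all labels and times at once, and a
   sequence is extracted afterwards, because dominated convergence requires one. *)
Require Import Defs.
From HB Require Import structures.
From mathcomp Require Import all_boot all_order all_algebra.
From mathcomp Require Import all_classical all_reals all_analysis.
From mathcomp Require Import measurable_realfun ess_sup_inf ring lra.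
Set Implicit Arguments.
Unset Strict Implicit.
Unset Printing Implicit Defensive.
Import Order.TTheory GRing.Theory Num.Theory.
Import numFieldNormedType.Exports.
Local Open Scope classical_set_scope.
Local Open Scope ring_scope.

(** * Bounded measurable functions *)

Section bounded_measurable.
Context {R : realType}.

(** Nearly every integrand below is bounded and lives on a set of finite measure, so this single
    predicate discharges integrability, Fubini and linearity. *)
Definition bmeas d (T : measurableType d) (f : T -> R) :=
  measurable_fun setT f /\ exists C, forall x, `|f x| <= C.

Section closure.
Context d (T : measurableType d).
Implicit Types f g : T -> R.

Lemma bmeas_cst (c : R) : bmeas (fun _ : T => c).
Proof. by split; [exact: measurable_cst|exists `|c|]. Qed.

Lemma bmeasD f g : bmeas f -> bmeas g -> bmeas (fun x => f x + g x).
Proof.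
move=> [mf [C fC]] [mg [D gD]]; split; first exact: measurable_funD.
by exists (C + D) => x; rewrite (le_trans (ler_normD _ _))// lerD.
Qed.

Lemma bmeasM f g : bmeas f -> bmeas g -> bmeas (fun x => f x * g x).
Proof.
move=> [mf [C fC]] [mg [D gD]]; split; first exact: measurable_funM.
by exists (C * D) => x; rewrite normrM ler_pM.
Qed.

Lemma bmeasN f : bmeas f -> bmeas (fun x => - f x).
Proof.
move=> [mf [C fC]]; split; first exact: measurableT_comp.
by exists C => x; rewrite normrN.
Qed.

Lemma bmeasB f g : bmeas f -> bmeas g -> bmeas (fun x => f x - g x).
Proof. by move=> bf bg; apply: bmeasD => //; exact: bmeasN. Qed.

Lemma bmeasX f n : bmeas f -> bmeas (fun x => f x ^+ n).
Proof.
move=> bf; elim: n => [|n IH]; first exact: bmeas_cst.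
by under eq_fun do rewrite exprS; exact: bmeasM.
Qed.

Lemma bmeas_indic (A : set T) : measurable A -> bmeas (\1_A : T -> R).
Proof.
move=> mA; split; first exact: measurable_indic.
by exists 1 => x; rewrite indicE ger0_norm// lern1; case: (_ \in _).
Qed.

Lemma bmeas_patch (A : set T) f : measurable A -> bmeas f -> bmeas (f \_ A).
Proof.
move=> mA bf.
have -> : f \_ A = (fun x => f x * \1_A x).
  by apply/funext => x; rewrite patchE indicE; case: ifP; rewrite ?mulr1 ?mulr0.
by apply: bmeasM => //; exact: bmeas_indic.
Qed.

End closure.

Lemma bmeas_comp d d' (T : measurableType d) (T' : measurableType d')
    (f : T' -> R) (g : T -> T') :
  bmeas f -> measurable_fun setT g -> bmeas (fun x => f (g x)).
Proof.
by move=> [mf [C fC]] mg; split; [exact: measurableT_comp|exists C].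
Qed.

Section integral.
Context d (T : measurableType d) (mu : {measure set T -> \bar R}) (D : set T).
Hypotheses (mD : measurable D) (muD : (mu D < +oo)%E).
Implicit Types f g : T -> R.

Lemma bmeas_integrable f : bmeas f -> mu.-integrable D (EFin \o f).
Proof.
move=> [mf [C fC]]; apply: measurable_bounded_integrable => //.
  exact: measurable_funTS.
exists C; split; rewrite ?num_real// => x Cx y _ /=.
exact: le_trans (fC y) (ltW Cx).
Qed.

Lemma bmeas_integralD f g : bmeas f -> bmeas g ->
  \int[mu]_(x in D) (f x + g x) = \int[mu]_(x in D) f x + \int[mu]_(x in D) g x.
Proof. by move=> bf bg; rewrite RintegralD//; exact: bmeas_integrable. Qed.

Lemma bmeas_integralZ f c : bmeas f ->
  \int[mu]_(x in D) (c * f x) = c * \int[mu]_(x in D) f x.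
Proof. by move=> bf; rewrite RintegralZl//; exact: bmeas_integrable. Qed.

Lemma bmeas_integralB f g : bmeas f -> bmeas g ->
  \int[mu]_(x in D) (f x - g x) = \int[mu]_(x in D) f x - \int[mu]_(x in D) g x.
Proof. by move=> bf bg; rewrite RintegralB//; exact: bmeas_integrable. Qed.

Lemma bmeas_integral_sum (f_ : nat -> T -> R) n : (forall k, bmeas (f_ k)) ->
  \int[mu]_(x in D) (\sum_(k < n) f_ k x) =
  \sum_(k < n) \int[mu]_(x in D) f_ k x.
Proof.
move=> bf; elim: n => [|n IH].
  rewrite big_ord0; under eq_Rintegral do rewrite big_ord0.
  by rewrite Rintegral_cst// mul0r.
rewrite big_ord_recr/= -IH.
under eq_Rintegral do rewrite big_ord_recr/=.
rewrite bmeas_integralD//; elim: n {IH} => [|n IH].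
  by under eq_fun do rewrite big_ord0; exact: bmeas_cst.
by under eq_fun do rewrite big_ord_recr/=; exact: bmeasD.
Qed.

Lemma bmeas_integral_le f C : measurable_fun setT f ->
  (forall x, D x -> `|f x| <= C) ->
  `|\int[mu]_(x in D) f x| <= C * fine (mu D).
Proof.
move=> mf fC.
have ife : mu.-integrable D (EFin \o f).
  apply: measurable_bounded_integrable => //; first exact: measurable_funTS.
  exists C; split; rewrite ?num_real// => x Cx y Dy /=.
  exact: le_trans (fC y Dy) (ltW Cx).
rewrite (le_trans (le_normr_Rintegral _ _))// -Rintegral_cst//.
apply: le_Rintegral => //.
  by have := integrable_norm ife.
by apply: bmeas_integrable => //; exact: bmeas_cst.
Qed.

Lemma bmeas_cvg_integral (f_ : nat -> T -> R) (f : T -> R) (N : set T) C :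
  (forall n, measurable_fun setT (f_ n)) -> measurable_fun setT f ->
  (forall n x, `|f_ n x| <= C) -> mu.-negligible N ->
  (forall x, D x -> ~ N x -> f_ n x @[n --> \oo] --> f x) ->
  \int[mu]_(x in D) f_ n x @[n --> \oo] --> \int[mu]_(x in D) f x.
Proof.
move=> mf_ mf f_C N0 f_f.
have H1 n : measurable_fun D (EFin \o f_ n).
  by apply/measurable_EFinP; exact: measurable_funTS.
have H2 : measurable_fun D (EFin \o f).
  by apply/measurable_EFinP; exact: measurable_funTS.
have H3 : {ae mu, forall x, D x -> (EFin \o f_ n) x @[n --> \oo] --> (EFin \o f) x}.
  apply: negligibleS N0 => x /= /not_implyP[Dx nf]; apply: contrapT => Nx.
  by apply: nf; apply: cvg_EFin; [exact: nearW|exact: f_f].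
have H4 : mu.-integrable D (EFin \o cst C).
  by apply: bmeas_integrable; exact: bmeas_cst.
have H5 : {ae mu, forall x n, D x -> (`|(EFin \o f_ n) x| <= (EFin \o cst C) x)%E}.
  by apply: aeW => x n _; rewrite /= lee_fin.
have [ifE _ cv] := dominated_convergence mD H1 H2 H3 H4 H5.
by apply: fine_cvg; rewrite fineK//; exact: integrable_fin_num.
Qed.

End integral.

(** * Fubini for bounded functions on sets of finite measure *)

Section fubini.
Context d1 d2 (T1 : measurableType d1) (T2 : measurableType d2).
Variables (m1 : {sigma_finite_measure set T1 -> \bar R})
          (m2 : {sigma_finite_measure set T2 -> \bar R}).
Variables (D1 : set T1) (D2 : set T2).
Hypotheses (mD1 : measurable D1) (mD2 : measurable D2).
Hypotheses (fD1 : (m1 D1 < +oo)%E) (fD2 : (m2 D2 < +oo)%E).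
Implicit Types f : T1 * T2 -> R.

Let prodX_fin : ((m1 \x m2) (D1 `*` D2) < +oo)%E.
Proof. by rewrite product_measure1E// lte_mul_pinfty// ge0_fin_numE. Qed.

Let patch_integrable f : bmeas f ->
  (m1 \x m2)%E.-integrable setT (EFin \o (f \_ (D1 `*` D2))).
Proof.
move=> bf; rewrite -restrict_EFin; apply/integrable_restrict => //=.
  exact: measurableX.
rewrite setTI; apply: bmeas_integrable => //; exact: measurableX.
Qed.

Lemma bmeas_int2 f : bmeas f ->
  bmeas (fun x => \int[m2]_(y in D2) f (x, y)).
Proof.
move=> bf.
have [mf [C fC]] := bf.
have m2f x : measurable_fun setT (fun y => f (x, y)).
  by apply: measurableT_comp => //; exact: pair1_measurable.
split; last first.
  by exists (C * fine (m2 D2)) => x; apply: bmeas_integral_le.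
(* Adding the bound [C] makes the integrand nonnegative, so that Tonelli's measurability result
   applies; the constant is subtracted again afterwards. *)
pose g (z : T1 * T2) := f z * \1_D2 z.2 + C * \1_D2 z.2.
have mg : measurable_fun setT g.
  apply: measurable_funD; apply: measurable_funM => //;
  apply: measurableT_comp => //; exact: measurable_indic.
have g0 z : (0 <= (EFin \o g) z)%E.
  rewrite /g /= lee_fin -mulrDl mulr_ge0// -lerBlDr sub0r.
  by move: (fC z); rewrite ler_norml => /andP[].
have mG : measurable_fun setT (fun x => \int[m2]_y (g (x, y))%:E)%E.
  by apply: (measurable_fun_fubini_tonelli_F (EFin \o g)) => //; exact/measurable_EFinP.
have -> : (fun x => \int[m2]_(y in D2) f (x, y)) =
    (fun x => fine (\int[m2]_y (g (x, y))%:E)%E - C * fine (m2 D2)).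
  apply/funext => x.
  have bx : bmeas (fun y => f (x, y)) by split => //; exists C.
  have -> : (\int[m2]_y (g (x, y))%:E = \int[m2]_(y in D2) (f (x, y) + C)%:E)%E.
    rewrite [RHS]integral_mkcond; apply: eq_integral => y _.
    rewrite /g /= patchE indicE; case: ifP => /=; rewrite ?mulr1 ?mulr0 ?addr0//.
  have -> : fine (\int[m2]_(y in D2) (f (x, y) + C)%:E)%E =
      \int[m2]_(y in D2) (f (x, y) + C) by [].
  rewrite bmeas_integralD//; last exact: bmeas_cst.
  by rewrite Rintegral_cst// addrK.
apply: measurable_funB => //.
exact: measurableT_comp mG.
Qed.

Let sec2 f x : bmeas f -> (\int[m2]_y ((f \_ (D1 `*` D2)) (x, y))%:E =
  (((fun x => (\int[m2]_(y in D2) f (x, y))%R) \_ D1) x)%:E)%E.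
Proof.
move=> bf; rewrite patchE; case: ifPn => xD1.
  rewrite fineK; last first.
    apply: integrable_fin_num => //.
    have [mf [C fC]] := bf.
    apply: (@bmeas_integrable _ _ m2 D2 mD2 fD2 (fun y => f (x, y))).
    by apply: (bmeas_comp bf); exact: pair1_measurable.
  rewrite [RHS]integral_mkcond; apply: eq_integral => y _.
  by rewrite !patchE in_setX /= xD1 /=; case: ifP.
rewrite integral0_eq// => y _.
by rewrite patchE in_setX /= (negbTE xD1).
Qed.

Lemma bmeas_prod_int f : bmeas f ->
  \int[(m1 \x m2)%E]_(z in D1 `*` D2) f z =
  \int[m1]_(x in D1) \int[m2]_(y in D2) f (x, y).
Proof.
move=> bf; rewrite Rintegral_mkcond [RHS]Rintegral_mkcond.
rewrite {1}/Rintegral -(integral12_prod_meas1 (patch_integrable bf)).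
congr fine; apply: eq_integral => x _; exact: sec2.
Qed.

End fubini.

Section fubini_swap.
Context d1 d2 (T1 : measurableType d1) (T2 : measurableType d2).
Variables (m1 : {sigma_finite_measure set T1 -> \bar R})
          (m2 : {sigma_finite_measure set T2 -> \bar R}).
Variables (D1 : set T1) (D2 : set T2).
Hypotheses (mD1 : measurable D1) (mD2 : measurable D2).
Hypotheses (fD1 : (m1 D1 < +oo)%E) (fD2 : (m2 D2 < +oo)%E).
Implicit Types f : T1 * T2 -> R.

Lemma bmeas_fubini f : bmeas f ->
  \int[m1]_(x in D1) \int[m2]_(y in D2) f (x, y) =
  \int[m2]_(y in D2) \int[m1]_(x in D1) f (x, y).
Proof.
move=> bf.
have prodX_fin : ((m1 \x m2)%E (D1 `*` D2) < +oo)%E.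
  by rewrite product_measure1E// lte_mul_pinfty// ge0_fin_numE.
have ip : (m1 \x m2)%E.-integrable setT (EFin \o (f \_ (D1 `*` D2))).
  rewrite -restrict_EFin; apply/integrable_restrict => //=.
    exact: measurableX.
  rewrite setTI; apply: bmeas_integrable => //; exact: measurableX.
rewrite -bmeas_prod_int// Rintegral_mkcond [RHS]Rintegral_mkcond.
rewrite {1}/Rintegral -(integral21_prod_meas1 ip).
congr fine; apply: eq_integral => y _.
rewrite patchE; case: ifPn => yD2.
  rewrite fineK; last first.
    apply: integrable_fin_num => //.
    apply: (@bmeas_integrable _ _ m1 D1 mD1 fD1 (fun x => f (x, y))).
    by apply: (bmeas_comp bf); exact: pair2_measurable.
  rewrite [RHS]integral_mkcond; apply: eq_integral => x _.
  by rewrite /= !patchE in_setX /= yD2 andbT; case: ifP.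
rewrite /fubini_G integral0_eq// => x _.
by rewrite /= patchE in_setX /= (negbTE yD2) andbF.
Qed.

End fubini_swap.

(* The library's canonical structures on [\x] do not let a product of finite
   measures be recognised as finite, hence this alias. *)
Section finite_product.
Context d1 d2 (T1 : measurableType d1) (T2 : measurableType d2).
Variables (m1 : {finite_measure set T1 -> \bar R})
          (m2 : {finite_measure set T2 -> \bar R}).

Definition fprod := (m1 \x m2)%E.

HB.instance Definition _ := Measure.on fprod.

Lemma fprodE (A : set T1) (B : set T2) : measurable A -> measurable B ->
  fprod (A `*` B) = (m1 A * m2 B)%E.
Proof. exact: product_measure1E. Qed.

Let fprod_fin : fin_num_fun fprod.
Proof.
move=> A mA; rewrite ge0_fin_numE//.
apply: (@le_lt_trans _ _ (fprod setT)); first by apply: le_measure; rewrite ?inE.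
by rewrite -setXTT fprodE// lte_mul_pinfty// ?fin_num_measure// ltey_eq fin_num_measure.
Qed.

HB.instance Definition _ := Measure_isFinite.Build _ _ _ fprod fprod_fin.

Lemma finite_measureT d (T : measurableType d)
  (m : {finite_measure set T -> \bar R}) : (m setT < +oo)%E.
Proof. by rewrite ltey_eq fin_num_measure. Qed.

Lemma bmeas_fprod (f : T1 * T2 -> R) : bmeas f ->
  \int[fprod]_z f z = \int[m1]_x \int[m2]_y f (x, y).
Proof.
move=> bf; have := bmeas_prod_int measurableT measurableT
  (finite_measureT m1) (finite_measureT m2) bf.
by rewrite setXTT.
Qed.

Lemma bmeas_fprod_swap (f : T1 * T2 -> R) : bmeas f ->
  \int[fprod]_z f z = \int[m2]_y \int[m1]_x f (x, y).
Proof.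
move=> bf; rewrite bmeas_fprod//.
exact: (bmeas_fubini measurableT measurableT
  (finite_measureT m1) (finite_measureT m2)).
Qed.

End finite_product.

End bounded_measurable.

#[global] Hint Extern 0 (is_true (_ < +oo)%E) =>
  solve [apply: finite_measureT] : core.

(** * The kernel exp(-|x|)/2 *)

Section line_integrals.
Context {R : realType}.
Notation mu := (@lebesgue_measure R).

Lemma lebesgue_itv_fin (a b : R) : (mu `[a, b] < +oo)%E.
Proof.
by rewrite lebesgue_measure_itv/=; case: ifP => _; rewrite ?ltry// -EFinB ltry.
Qed.

Lemma itvcc_integrable (f : R -> R) (a b : R) : @bmeas R _ (measurableTypeR R) f ->
  mu.-integrable `[a, b] (EFin \o f).
Proof. by apply: bmeas_integrable => //; exact: lebesgue_itv_fin. Qed.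

Lemma Rintegral_itvD (f : R -> R) (a b c : R) :
  @bmeas R _ (measurableTypeR R) f -> a <= c -> c <= b ->
  \int[mu]_(x in `[a, b]) f x =
  \int[mu]_(x in `[a, c]) f x + \int[mu]_(x in `[c, b]) f x.
Proof.
move=> bf ac cb; apply/eqP; rewrite addrC -subr_eq; apply/eqP.
rewrite Rintegral_itvB ?bnd_simp//; last exact: itvcc_integrable.
rewrite Rintegral_itv_obnd_cbnd//.
apply: integrableS (@itvcc_integrable f c b bf) => //.
exact: subset_itv_oc_cc.
Qed.

(** The derivative of the kernel jumps at its peak, so closed formulas for the integrands hold only
    strictly between peaks; the two endpoints carry no mass. *)
Lemma eq_Rintegral_itvoo (f g : R -> R) (a b : R) :
  @bmeas R _ (measurableTypeR R) f -> measurable_fun setT g ->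
  mu.-integrable `[a, b] (EFin \o g) ->
  {in `]a, b[, f =1 g} ->
  \int[mu]_(x in `[a, b]) f x = \int[mu]_(x in `[a, b]) g x.
Proof.
move=> bf mg ig fg.
have sub : `]a, b[ `<=` `[a, b] by exact: subset_itv_oo_cc.
have sub' : `]a, b] `<=` `[a, b] by exact: subset_itv_oc_cc.
rewrite -!Rintegral_itv_obnd_cbnd; last 2 first.
- exact: integrableS ig.
- by apply: integrableS (@itvcc_integrable f a b bf).
rewrite -!Rintegral_itv_bndo_bndc; last 2 first.
- exact: integrableS ig.
- by apply: integrableS (@itvcc_integrable f a b bf).
by apply: eq_Rintegral => x; rewrite inE/=; exact: fg.
Qed.

Lemma Rintegral_supp (f : R -> R) (L : R) :
  (forall x, L < `|x| -> f x = 0) ->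
  \int[mu]_x f x = \int[mu]_(x in `[- L, L]) f x.
Proof.
move=> f0; rewrite [RHS]Rintegral_mkcond; apply: eq_Rintegral => x _.
rewrite patchE; case: ifPn => // xL; apply: f0; rewrite ltNge ler_norml.
by apply: contra xL; rewrite inE/= in_itv.
Qed.

Lemma FTC_derive (F f : R -> R) (a b : R) : a <= b ->
  (forall x : R, is_derive x (1 : R) F (f x)) -> continuous f ->
  \int[mu]_(x in `[a, b]) f x = F b - F a.
Proof.
rewrite le_eqVlt => /predU1P[<- _ _|ab dF cf].
  by rewrite subrr set_itv1 Rintegral_set1.
have cF : continuous F.
  move=> x; apply: differentiable_continuous; apply/derivable1_diffP.
  by have [] := dF x.
rewrite /Rintegral (@continuous_FTC2 _ f F)//.
- by apply: continuous_subspaceT.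
- split => //.
  + by apply: cvg_at_right_filter; exact: cF.
  + by apply: cvg_at_left_filter; exact: cF.
- by move=> x _; rewrite derive1E; have [] := dF x.
Qed.

(** The formula imposed on [f] is the derivative of [c * expR (k * x) * (al * g1 x + be * g x)].
    Between consecutive peaks each integrand below has this form, so an integral identity amounts to
    a choice of [c], [k], [al] and [be]. *)
Lemma expR_parts (f g g1 g2 : R -> R) (c k al be a b : R) : a <= b ->
  (forall x : R, is_derive x (1 : R) g (g1 x)) -> (forall x : R, is_derive x (1 : R) g1 (g2 x)) ->
  continuous g2 -> @bmeas R _ (measurableTypeR R) f ->
  {in `]a, b[, forall x, f x =
    c * expR (k * x) * (al * g2 x + (k * al + be) * g1 x + k * be * g x)} ->
  \int[mu]_(x in `[a, b]) f x = c * expR (k * b) * (al * g1 b + be * g b) -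
    c * expR (k * a) * (al * g1 a + be * g a).
Proof.
move=> ab dg dg1 cg2 bf fE.
pose F x := c * expR (k * x) * (al * g1 x + be * g x).
pose h x := c * expR (k * x) * (al * g2 x + (k * al + be) * g1 x + k * be * g x).
have cder (u v : R -> R) : (forall x : R, is_derive x (1 : R) u (v x)) -> continuous u.
  move=> du x; apply: differentiable_continuous; apply/derivable1_diffP.
  by have [] := du x.
have dexp (x : R) : is_derive x (1 : R) (fun y => expR (k * y)) (k * expR (k * x)).
  have -> : (fun y => expR (k * y)) = expR \o ( *%R k) by [].
  rewrite mulrC; apply: is_derive1_comp.
  have : is_derive x (1 : R) (k \*: (@id R)) (k *: 1) by exact: is_deriveZ.
  by rewrite /GRing.scale/= mulr1.
have cexp := cder _ _ dexp.
have dF (x : R) : is_derive x (1 : R) F (h x).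
  have d1 : is_derive x (1 : R) (fun x => c * expR (k * x)) (c * (k * expR (k * x))).
    exact: (@is_deriveZ _ _ _ (fun y => expR (k * y)) c).
  have d2 : is_derive x (1 : R) (fun x => al * g1 x + be * g x) (al * g2 x + be * g1 x).
    by apply: (@is_deriveD _ _ _ (fun x => al * g1 x) (fun x => be * g x)).
  have := is_deriveM d1 d2.
  set D := (X in is_derive _ _ _ X -> _).
  suff -> : D = h x by [].
  rewrite /D /h /GRing.scale/=; ring.
have ch : continuous h.
  move=> x; rewrite /h; apply: (@continuousM _ _ (fun x => c * expR (k * x))).
    by apply: continuousM; [exact: cst_continuous|exact: cexp].
  apply: (@continuousD _ _ _ (fun x => al * g2 x + (k * al + be) * g1 x)).
    apply: (@continuousD _ _ _ (fun x => al * g2 x)).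
      by apply: continuousM; [exact: cst_continuous|exact: cg2].
    by apply: continuousM; [exact: cst_continuous|exact: (cder _ _ dg1)].
  by apply: continuousM; [exact: cst_continuous|exact: (cder _ _ dg)].
rewrite -/(F b) -/(F a) -(FTC_derive ab dF ch).
apply: eq_Rintegral_itvoo => //.
- exact: continuous_measurable_fun.
- apply: continuous_compact_integrable; first exact: segment_compact.
  exact: continuous_subspaceT.
Qed.

Lemma continuous_supp_bmeas (g : R -> R) (K : R) : continuous g ->
  (forall x, K < `|x| -> g x = 0) -> @bmeas R _ (measurableTypeR R) g.
Proof.
move=> cg g0; split; first exact: continuous_measurable_fun.
have : compact (g @` `[- K, K]).
  apply: continuous_compact; first exact: continuous_subspaceT.
  exact: segment_compact.
move=> /compact_bounded[M [_ gM]].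
exists (`|M| + 1) => x; have [xK|xK] := leP `|x| K.
  apply: (gM (`|M| + 1)); first by rewrite ltr_pwDr// ler_norm.
  by exists x => //; rewrite /= in_itv/= -ler_norml.
by rewrite g0// normr0 addr_ge0.
Qed.

Definition peakon (x : R) := 2^-1 * expR (- `|x|).
Definition dpeakon (x : R) := - Num.sg x * peakon x.

Lemma peakon_ge0 x : 0 <= peakon x.
Proof. by rewrite mulr_ge0// expR_ge0. Qed.

Lemma peakon_le x : peakon x <= 2^-1.
Proof. by rewrite ler_piMr// expR_le1 oppr_le0. Qed.

Lemma normr_dpeakon_le x : `|dpeakon x| <= peakon x.
Proof.
rewrite normrM normrN normr_sg (ger0_norm (peakon_ge0 x)).
by case: (x != 0); rewrite ?mul1r ?mul0r ?peakon_ge0.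
Qed.

Lemma continuous_peakon : continuous peakon.
Proof.
move=> x; apply: (@continuousM _ _ (fun=> 2^-1) (fun x => expR (- `|x|))).
  exact: cst_continuous.
apply: (@continuous_comp _ _ _ (fun x : R => - `|x|) expR).
  by apply: (@continuousN _ _ _ (fun x : R => `|x|)); exact: norm_continuous.
exact: continuous_expR.
Qed.

Lemma bmeas_peakon : @bmeas R _ (measurableTypeR R) peakon.
Proof.
split; first exact: continuous_measurable_fun continuous_peakon.
by exists 2^-1 => x; rewrite ger0_norm ?peakon_ge0// peakon_le.
Qed.

Lemma bmeas_dpeakon : @bmeas R _ (measurableTypeR R) dpeakon.
Proof.
have [mp _] := bmeas_peakon; split; last first.
  by exists 2^-1 => x; rewrite (le_trans (normr_dpeakon_le x))// peakon_le.
apply: measurable_funM => //; apply: measurableT_comp => //.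
apply: nondecreasing_measurable => // x y xy.
by case: (sgrP x) => x0; case: (sgrP y) => y0; lra.
Qed.

(** The factors [1 * x] here and [-1 * x] in the next lemma match the shape [expR (k * x)] of
    [expR_parts]. *)
Lemma peakonE_lt x y : x < y -> peakon (x - y) = 2^-1 * expR (- y) * expR (1 * x) /\
  dpeakon (x - y) = 2^-1 * expR (- y) * expR (1 * x).
Proof.
move=> xy; have xy0 : x - y < 0 by rewrite subr_lt0.
rewrite /dpeakon /peakon ltr0_norm// ltr0_sg// opprK mul1r opprK mul1r.
by rewrite -mulrA -expRD [- y + x]addrC.
Qed.

Lemma peakonE_gt x y : y < x -> peakon (x - y) = 2^-1 * expR y * expR (-1 * x) /\
  dpeakon (x - y) = - (2^-1 * expR y * expR (-1 * x)).
Proof.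
move=> xy; have xy0 : 0 < x - y by rewrite subr_gt0.
rewrite /dpeakon /peakon gtr0_norm// gtr0_sg// mulN1r -mulrA -expRD.
by rewrite mulN1r opprB.
Qed.

(** * Exact integrals of the kernels against a compactly supported function *)

Section kernel_identities.
Variables (g g1 g2 : R -> R) (K : R).
Hypotheses (dg : forall x : R, is_derive x (1 : R) g (g1 x))
  (dg1 : forall x : R, is_derive x (1 : R) g1 (g2 x)) (cg2 : continuous g2).
Hypothesis g0 : forall x, K < `|x| -> [/\ g x = 0, g1 x = 0 & g2 x = 0].

Let cder (u v : R -> R) : (forall x : R, is_derive x (1 : R) u (v x)) -> continuous u.
Proof.
move=> du x; apply: differentiable_continuous; apply/derivable1_diffP.
by have [] := du x.
Qed.

Let bg : @bmeas R _ (measurableTypeR R) g.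
Proof. by apply: (continuous_supp_bmeas (cder dg)) => x /g0[]. Qed.
Let bg1 : @bmeas R _ (measurableTypeR R) g1.
Proof. by apply: (continuous_supp_bmeas (cder dg1)) => x /g0[]. Qed.
Let bg2 : @bmeas R _ (measurableTypeR R) g2.
Proof. by apply: (continuous_supp_bmeas cg2) => x /g0[]. Qed.

Let bpk y : @bmeas R _ (measurableTypeR R) (fun x => peakon (x - y)).
Proof.
apply: (bmeas_comp bmeas_peakon).
by apply: measurable_funB => //; exact: measurable_cst.
Qed.

Let bdpk y : @bmeas R _ (measurableTypeR R) (fun x => dpeakon (x - y)).
Proof.
apply: (bmeas_comp bmeas_dpeakon).
by apply: measurable_funB => //; exact: measurable_cst.
Qed.

Let expRK (x : R) : expR (- x) * expR x = 1.
Proof. by rewrite -expRD addNr expR0. Qed.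

(** The kernel is the Green function of [1 - d_x^2]: on either side of [y] the integrand is exact,
    and at [y] the [g1] terms cancel while each side contributes half of [g y]. *)
Lemma integral_peakon_helmholtz y :
  \int[mu]_x (peakon (x - y) * (g x - g2 x)) = g y.
Proof.
(* The summand [|y|] puts [y] inside the segment, and the 1 makes [L] exceed [K] strictly, so that
   all boundary terms at [L] and [- L] vanish. *)
pose L := 1 + `|K| + `|y|.
have [K1 K2] := (ler_norm K, ler_norm (- K)); rewrite normrN in K2.
have [y1 y2] := (ler_norm y, ler_norm (- y)); rewrite normrN in y2.
have K0 := normr_ge0 K; have y0 := normr_ge0 y.
have gL x : L <= `|x| -> [/\ g x = 0, g1 x = 0 & g2 x = 0].
  by move=> xL; apply: g0; rewrite /L in xL; lra.
have LL : `|L| = L by rewrite ger0_norm// /L; lra.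
have [gL1 g1L1 _] : [/\ g L = 0, g1 L = 0 & g2 L = 0] by apply: gL; rewrite LL.
have [gL2 g1L2 _] : [/\ g (- L) = 0, g1 (- L) = 0 & g2 (- L) = 0].
  by apply: gL; rewrite normrN LL.
rewrite (@Rintegral_supp _ L); last first.
  by move=> x /ltW /gL[-> _ ->]; rewrite subrr mulr0.
have bf : @bmeas R _ (measurableTypeR R) (fun x => peakon (x - y) * (g x - g2 x)).
  by apply: bmeasM => //; exact: bmeasB.
rewrite (@Rintegral_itvD _ _ _ y)//; [|rewrite /L; lra|rewrite /L; lra].
rewrite (@expR_parts _ g g1 g2 (2^-1 * expR (- y)) 1 (-1) 1)//; last 2 first.
- by rewrite /L; lra.
- by move=> x; rewrite in_itv/= => /andP[_ /peakonE_lt[-> _]]; ring.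
rewrite (@expR_parts _ g g1 g2 (2^-1 * expR y) (-1) (-1) (-1))//; last 2 first.
- by rewrite /L; lra.
- by move=> x; rewrite in_itv/= => /andP[/peakonE_gt[-> _] _]; ring.
rewrite gL1 gL2 g1L1 g1L2 !mul1r !mulN1r.
transitivity (expR (- y) * expR y * g y); first by field.
by rewrite expRK mul1r.
Qed.

Lemma integral_dpeakon y :
  \int[mu]_x (peakon (x - y) * g1 x) = - \int[mu]_x (dpeakon (x - y) * g x).
Proof.
pose L := 1 + `|K| + `|y|.
have [K1 K2] := (ler_norm K, ler_norm (- K)); rewrite normrN in K2.
have [y1 y2] := (ler_norm y, ler_norm (- y)); rewrite normrN in y2.
have K0 := normr_ge0 K; have y0 := normr_ge0 y.
have gL x : L <= `|x| -> [/\ g x = 0, g1 x = 0 & g2 x = 0].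
  by move=> xL; apply: g0; rewrite /L in xL; lra.
have LL : `|L| = L by rewrite ger0_norm// /L; lra.
have [gL1 g1L1 _] : [/\ g L = 0, g1 L = 0 & g2 L = 0] by apply: gL; rewrite LL.
have [gL2 g1L2 _] : [/\ g (- L) = 0, g1 (- L) = 0 & g2 (- L) = 0].
  by apply: gL; rewrite normrN LL.
rewrite (@Rintegral_supp _ L); last by move=> x /ltW /gL[_ -> _]; rewrite mulr0.
rewrite (@Rintegral_supp (fun x => dpeakon (x - y) * g x) L); last first.
  by move=> x /ltW /gL[-> _ _]; rewrite mulr0.
apply/eqP; rewrite -addr_eq0; apply/eqP.
have bf : @bmeas R _ (measurableTypeR R)
    (fun x => peakon (x - y) * g1 x + dpeakon (x - y) * g x).
  by apply: bmeasD; exact: bmeasM.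
rewrite -bmeas_integralD//; [|exact: lebesgue_itv_fin|exact: bmeasM|exact: bmeasM].
rewrite (@Rintegral_itvD _ _ _ y)//; [|rewrite /L; lra|rewrite /L; lra].
rewrite (@expR_parts _ g g1 g2 (2^-1 * expR (- y)) 1 0 1)//; last 2 first.
- by rewrite /L; lra.
- by move=> x; rewrite in_itv/= => /andP[_ /peakonE_lt[-> ->]]; ring.
rewrite (@expR_parts _ g g1 g2 (2^-1 * expR y) (-1) 0 1)//; last 2 first.
- by rewrite /L; lra.
- by move=> x; rewrite in_itv/= => /andP[/peakonE_gt[-> ->] _]; ring.
rewrite gL1 gL2 g1L1 g1L2 !mul1r !mulN1r.
ring.
Qed.

(** The cubic integrand of [mCH_form], with [g] in the role of [phi_x], polarised into a symmetric
    trilinear form in three point masses: [u * ux ^+ 2] becomes the mean of its three placements. *)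
Definition mch_integrand (y1 y2 y3 x : R) :=
  - (3^-1 * (dpeakon (x - y1) * dpeakon (x - y2) * dpeakon (x - y3)) * g1 x)
  - 3^-1 * (peakon (x - y1) * peakon (x - y2) * peakon (x - y3)) * g2 x
  + (peakon (x - y1) * peakon (x - y2) * peakon (x - y3) +
     3^-1 * (peakon (x - y1) * dpeakon (x - y2) * dpeakon (x - y3) +
             dpeakon (x - y1) * peakon (x - y2) * dpeakon (x - y3) +
             dpeakon (x - y1) * dpeakon (x - y2) * peakon (x - y3))) * g x.

Lemma bmeas_mch_integrand y1 y2 y3 :
  @bmeas R _ (measurableTypeR R) (mch_integrand y1 y2 y3).
Proof.
apply: bmeasD; [apply: bmeasB|].
- by apply: bmeasN; do ?apply: bmeasM => //; exact: bmeas_cst.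
- by do ?apply: bmeasM => //; exact: bmeas_cst.
- apply: bmeasM => //; apply: bmeasD; first by do 2 apply: bmeasM => //.
  apply: bmeasM; first exact: bmeas_cst.
  by apply: bmeasD; [apply: bmeasD|]; do 2 apply: bmeasM => //.
Qed.

(** On the four intervals the exponents are 3, 1, -1, -3, always with [al = - 3^-1], and [be] is
    [2 / 3] left of [y2] and [- (2 / 3)] right of it. Boundary terms cancel at [y1] and [y3]; at
    [y2] the jump of [be] leaves 1/8 times 4/3, which is the coefficient 1/6. *)
Lemma integral_mch_sorted y1 y2 y3 : y1 <= y2 -> y2 <= y3 ->
  \int[mu]_x mch_integrand y1 y2 y3 x = 6^-1 * (expR (y1 - y3) * g y2).
Proof.
move=> y12 y23.
pose L := 1 + `|K| + `|y1| + `|y3|.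
have [K1 K2] := (ler_norm K, ler_norm (- K)); rewrite normrN in K2.
have [l1 l2] := (ler_norm y1, ler_norm (- y1)); rewrite normrN in l2.
have [l3 l4] := (ler_norm y3, ler_norm (- y3)); rewrite normrN in l4.
have K0 := normr_ge0 K; have y10 := normr_ge0 y1; have y30 := normr_ge0 y3.
have gL x : L <= `|x| -> [/\ g x = 0, g1 x = 0 & g2 x = 0].
  by move=> xL; apply: g0; rewrite /L in xL; lra.
have LL : `|L| = L by rewrite ger0_norm// /L; lra.
have [gL1 g1L1 _] : [/\ g L = 0, g1 L = 0 & g2 L = 0] by apply: gL; rewrite LL.
have [gL2 g1L2 _] : [/\ g (- L) = 0, g1 (- L) = 0 & g2 (- L) = 0].
  by apply: gL; rewrite normrN LL.
rewrite (@Rintegral_supp _ L); last first.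
  by move=> x /ltW /gL[h h1 h2]; rewrite /mch_integrand h h1 h2; ring.
have bf := bmeas_mch_integrand y1 y2 y3.
have L1 : - L <= y1 by rewrite /L; lra.
have L3 : y3 <= L by rewrite /L; lra.
rewrite (@Rintegral_itvD _ _ _ y2)//; [|lra|lra].
rewrite (@Rintegral_itvD _ (- L) y2 y1)// (@Rintegral_itvD _ y2 L y3)//.
have exp3 (x : R) : expR (3 * x) = expR (1 * x) ^+ 3.
  by rewrite mul1r -expRM_natl.
have expN3 (x : R) : expR (- 3 * x) = expR (-1 * x) ^+ 3.
  by rewrite mulN1r -expRM_natl mulrN mulNr.
have expN1 (x : R) : expR (-1 * x) = (expR x)^-1 by rewrite mulN1r expRN.
rewrite (@expR_parts _ g g1 g2 (8^-1 * (expR (- y1) * expR (- y2) * expR (- y3)))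
  3 (- 3^-1) (2 / 3))//; last first.
  move=> x; rewrite /mch_integrand in_itv/= => /andP[_ xy1].
  have [-> ->] := peakonE_lt xy1.
  have [-> ->] := peakonE_lt (lt_le_trans xy1 y12).
  have [-> ->] := peakonE_lt (lt_le_trans xy1 (le_trans y12 y23)).
  by rewrite exp3; field.
rewrite (@expR_parts _ g g1 g2 (8^-1 * (expR y1 * expR (- y2) * expR (- y3)))
  1 (- 3^-1) (2 / 3))//; last first.
  move=> x; rewrite /mch_integrand in_itv/= => /andP[xy1 xy2].
  have [-> ->] := peakonE_gt xy1.
  have [-> ->] := peakonE_lt xy2.
  have [-> ->] := peakonE_lt (lt_le_trans xy2 y23).
  by rewrite expN1 mul1r; field; rewrite lt0r_neq0// expR_gt0.
rewrite (@expR_parts _ g g1 g2 (8^-1 * (expR y1 * expR y2 * expR (- y3)))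
  (-1) (- 3^-1) (- (2 / 3)))//; last first.
  move=> x; rewrite /mch_integrand in_itv/= => /andP[xy2 xy3].
  have [-> ->] := peakonE_gt (le_lt_trans y12 xy2).
  have [-> ->] := peakonE_gt xy2.
  have [-> ->] := peakonE_lt xy3.
  by rewrite expN1 mul1r; field; rewrite lt0r_neq0// expR_gt0.
rewrite (@expR_parts _ g g1 g2 (8^-1 * (expR y1 * expR y2 * expR y3))
  (- 3) (- 3^-1) (- (2 / 3)))//; last first.
  move=> x; rewrite /mch_integrand in_itv/= => /andP[xy3 _].
  have [-> ->] := peakonE_gt (le_lt_trans (le_trans y12 y23) xy3).
  have [-> ->] := peakonE_gt (le_lt_trans y23 xy3).
  have [-> ->] := peakonE_gt xy3.
  by rewrite expN3; field.
rewrite gL1 gL2 g1L1 g1L2 !exp3 !expN3 !expN1 !mul1r !expRN expRD expRN.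
by field; rewrite !lt0r_neq0// expR_gt0.
Qed.

End kernel_identities.

Definition med (a b c : R) := Num.max (Num.min a b) (Num.min (Num.max a b) c).
Definition spread (a b c : R) :=
  Num.max a (Num.max b c) - Num.min a (Num.min b c).

Lemma integral_mch_integrand g g1 g2 K :
  (forall x : R, is_derive x (1 : R) g (g1 x)) ->
  (forall x : R, is_derive x (1 : R) g1 (g2 x)) -> continuous g2 ->
  (forall x, K < `|x| -> [/\ g x = 0, g1 x = 0 & g2 x = 0]) ->
  forall y1 y2 y3, \int[mu]_x mch_integrand g g1 g2 y1 y2 y3 x =
    6^-1 * (expR (- spread y1 y2 y3) * g (med y1 y2 y3)).
Proof.
move=> dg dg1 cg2 g0 y1 y2 y3; rewrite /spread /med opprB.
have sorted := integral_mch_sorted dg dg1 cg2 g0.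
have perm a b c : (forall x, mch_integrand g g1 g2 y1 y2 y3 x =
    mch_integrand g g1 g2 a b c x) -> \int[mu]_x mch_integrand g g1 g2 y1 y2 y3 x =
    \int[mu]_x mch_integrand g g1 g2 a b c x.
  by move=> e; apply: eq_Rintegral => x _; exact: e.
(* The integrand is symmetric in the positions, so in each order of the three it is matched with its
   sorted arrangement. *)
have [] := leP y1 y2; have [] := leP y2 y3; have [] := leP y1 y3 => h13 h23 h12;
  rewrite /Num.min /Num.max; repeat case: ifPn; rewrite -?leNgt => *; try lra.
all: try first [by rewrite sorted//; lra
  | by rewrite (perm y1 y3 y2) ?sorted//; first [lra|move=> x; rewrite /mch_integrand; ring]
  | by rewrite (perm y2 y1 y3) ?sorted//; first [lra|move=> x; rewrite /mch_integrand; ring]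
  | by rewrite (perm y2 y3 y1) ?sorted//; first [lra|move=> x; rewrite /mch_integrand; ring]
  | by rewrite (perm y3 y1 y2) ?sorted//; first [lra|move=> x; rewrite /mch_integrand; ring]
  | by rewrite (perm y3 y2 y1) ?sorted//; first [lra|move=> x; rewrite /mch_integrand; ring]].
(* What remains are ties, where [min] or [max] may select a position that is equal to the expected
   one but written differently; the equality is substituted first. *)
all: try ((have e : y2 = y1 by (apply/le_anti/andP; split; lra)); move: perm; rewrite ?e => perm).
all: try ((have e : y3 = y1 by (apply/le_anti/andP; split; lra)); move: perm; rewrite ?e => perm).
all: try ((have e : y3 = y2 by (apply/le_anti/andP; split; lra)); move: perm; rewrite ?e => perm).
all: first [by rewrite sorted//; lra
  | by rewrite (perm y1 y3 y1) ?sorted//; first [lra|move=> x; rewrite /mch_integrand; ring]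
  | by rewrite (perm y3 y1 y1) ?sorted//; first [lra|move=> x; rewrite /mch_integrand; ring]
  | by rewrite (perm y1 y1 y3) ?sorted//; first [lra|move=> x; rewrite /mch_integrand; ring]
  | by rewrite (perm y1 y2 y1) ?sorted//; first [lra|move=> x; rewrite /mch_integrand; ring]
  | by rewrite (perm y2 y1 y1) ?sorted//; first [lra|move=> x; rewrite /mch_integrand; ring]
  | by rewrite (perm y1 y1 y2) ?sorted//; first [lra|move=> x; rewrite /mch_integrand; ring]
  | by rewrite (perm y1 y2 y2) ?sorted//; first [lra|move=> x; rewrite /mch_integrand; ring]
  | by rewrite (perm y2 y1 y2) ?sorted//; first [lra|move=> x; rewrite /mch_integrand; ring]
  | by rewrite (perm y2 y2 y1) ?sorted//; first [lra|move=> x; rewrite /mch_integrand; ring]].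
Qed.
End line_integrals.

(** * Potentials of a signed measure *)

Section signed_integrals.
Context {R : realType} d (T : measurableType d).
Notation RT := (measurableTypeR R).
Notation leb := (@lebesgue_measure R).
Variables (mu : {finite_measure set T -> \bar R}) (sg : T -> R).
Hypothesis bsg : bmeas sg.

(** Integration against the signed measure [sg * mu], and for [I3] against its third tensor power.
    With the sign inside the integrand, only finite positive measures occur. *)
Definition I1 (f : T -> R) : R := \int[mu]_a (sg a * f a).

Definition I3 (f : T -> T -> T -> R) : R :=
  \int[(fprod (fprod mu mu) mu)]_z
    (sg z.1.1 * sg z.1.2 * sg z.2 * f z.1.1 z.1.2 z.2).

Definition bmeas3 (f : T -> T -> T -> R) :=
  @bmeas R _ (T * T * T)%type (fun z => f z.1.1 z.1.2 z.2).

Let muT := finite_measureT mu.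
Let mu3T := finite_measureT (fprod (fprod mu mu) mu).

Let m11 : measurable_fun setT (fun z : T * T * T => z.1.1).
Proof. by apply: measurableT_comp. Qed.
Let m12 : measurable_fun setT (fun z : T * T * T => z.1.2).
Proof. by apply: measurableT_comp. Qed.

Let sgsg : @bmeas R _ (T * T * T)%type (fun z => sg z.1.1 * sg z.1.2 * sg z.2).
Proof.
by apply: bmeasM; [apply: bmeasM|]; apply: (bmeas_comp bsg).
Qed.

Lemma I1D f g : bmeas f -> bmeas g -> I1 (fun a => f a + g a) = I1 f + I1 g.
Proof.
move=> bf bg; rewrite /I1 -bmeas_integralD//; [|exact: bmeasM|exact: bmeasM].
by apply: eq_Rintegral => a _; rewrite mulrDr.
Qed.

Lemma I1Z c f : bmeas f -> I1 (fun a => c * f a) = c * I1 f.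
Proof.
move=> bf; rewrite /I1 -bmeas_integralZ//; last exact: bmeasM.
by apply: eq_Rintegral => a _; rewrite mulrCA.
Qed.

Lemma eq_I1 f g : f =1 g -> I1 f = I1 g.
Proof. by move=> fg; congr I1; apply/funext. Qed.

Lemma I3D f g : bmeas3 f -> bmeas3 g ->
  I3 (fun a b c => f a b c + g a b c) = I3 f + I3 g.
Proof.
move=> bf bg; rewrite /I3 -bmeas_integralD//; [|exact: bmeasM|exact: bmeasM].
by apply: eq_Rintegral => a _; rewrite mulrDr.
Qed.

Lemma I3Z k f : bmeas3 f -> I3 (fun a b c => k * f a b c) = k * I3 f.
Proof.
move=> bf; rewrite /I3 -bmeas_integralZ//; last exact: bmeasM.
by apply: eq_Rintegral => a _; rewrite mulrCA.
Qed.

Lemma eq_I3 f g : (forall a b c, f a b c = g a b c) -> I3 f = I3 g.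
Proof. by move=> fg; congr I3; do 3 apply/funext => ?; exact: fg. Qed.

(* Fubini reduces [I3] to nested integrals, whose order may be rotated. *)
Lemma I3_rot f : bmeas3 f -> I3 f = I3 (fun a b c => f b c a).
Proof.
move=> bf; rewrite /I3.
pose F (z : T * T * T) := sg z.1.1 * sg z.1.2 * sg z.2 * f z.1.1 z.1.2 z.2.
have bF : bmeas F by exact: bmeasM.
transitivity (\int[mu]_c \int[(fprod mu mu)]_z F (z, c)).
  exact: (bmeas_fprod_swap _ _ bF).
have bG : @bmeas R _ (T * T * T)%type (fun z => F (z.1.2, z.2, z.1.1)).
  apply: (bmeas_comp bF).
  by apply: measurable_fun_pair => //; apply: measurable_fun_pair.
transitivity (\int[mu]_a \int[mu]_b \int[mu]_c F (b, c, a)).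
  apply: eq_Rintegral => a _.
  apply: (bmeas_fprod mu mu (f := fun z => F (z, a))).
  apply: (bmeas_comp bF); exact: pair2_measurable.
have bH : @bmeas R _ (T * T)%type (fun z => \int[mu]_c F (z.2, c, z.1)).
  exact: (bmeas_int2 measurableT muT bG).
transitivity (\int[(fprod mu mu)]_z \int[mu]_c F (z.2, c, z.1)).
  exact/esym/(bmeas_fprod _ _ bH).
transitivity (\int[(fprod (fprod mu mu) mu)]_z F (z.1.2, z.2, z.1.1)).
  exact/esym/(bmeas_fprod _ _ bG).
apply: eq_Rintegral => z _; rewrite /F/=; ring.
Qed.

Lemma I3_mul (f g h : T -> R) : bmeas f -> bmeas g -> bmeas h ->
  I3 (fun a b c => f a * g b * h c) = I1 f * I1 g * I1 h.
Proof.
move=> bf bg bh; rewrite /I3.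
have sf : bmeas (fun a => sg a * f a) by exact: bmeasM.
have sgg : bmeas (fun a => sg a * g a) by exact: bmeasM.
have sh : bmeas (fun a => sg a * h a) by exact: bmeasM.
have b2 : @bmeas R _ (T * T)%type (fun z => (sg z.1 * f z.1) * (sg z.2 * g z.2)).
  by apply: bmeasM; [apply: (bmeas_comp sf)|apply: (bmeas_comp sgg)].
have b3 : @bmeas R _ (T * T * T)%type
    (fun z => (sg z.1.1 * f z.1.1) * (sg z.1.2 * g z.1.2) * (sg z.2 * h z.2)).
  apply: bmeasM; [apply: bmeasM|].
  - exact: (bmeas_comp sf).
  - exact: (bmeas_comp sgg).
  - exact: (bmeas_comp sh).
transitivity (\int[(fprod (fprod mu mu) mu)]_z
    ((sg z.1.1 * f z.1.1) * (sg z.1.2 * g z.1.2) * (sg z.2 * h z.2))).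
  by apply: eq_Rintegral => z _; ring.
rewrite (bmeas_fprod _ _ b3)/=.
under eq_Rintegral do rewrite bmeas_integralZ//.
rewrite -/(I1 h).
under eq_Rintegral do rewrite mulrC.
rewrite bmeas_integralZ// mulrC; congr (_ * _).
rewrite (bmeas_fprod _ _ b2)/=.
under eq_Rintegral do rewrite bmeas_integralZ//.
rewrite -/(I1 g).
under eq_Rintegral do rewrite mulrC.
by rewrite bmeas_integralZ// mulrC.
Qed.

Hypothesis sg1 : forall a, `|sg a| <= 1.
Notation M := (fine (mu setT)).

Lemma I1_le (f : T -> R) C : measurable_fun setT f -> (forall a, `|f a| <= C) ->
  `|I1 f| <= C * M.
Proof.
move=> mf fC; apply: bmeas_integral_le => //; first exact: measurable_funM bsg.1 _.
move=> a _; rewrite normrM -[leRHS]mul1r ler_pM//.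
Qed.

Lemma I3_le f C : bmeas3 f -> (forall a b c, `|f a b c| <= C) ->
  `|I3 f| <= C * M ^+ 3.
Proof.
move=> bf fC.
have -> : M ^+ 3 = fine ((fprod (fprod mu mu) mu) setT).
  have -> : [set: T * T * T] = (setT `*` setT) `*` setT by rewrite !setXTT.
  have -> : (fprod (fprod mu mu) mu ((setT `*` setT) `*` setT) =
      mu setT * mu setT * mu setT)%E.
    rewrite fprodE//; last exact: measurableX.
    by congr (_ * _)%E; exact: fprodE.
  by rewrite !fineM ?fin_num_measure// ?fin_numM ?fin_num_measure// !exprS expr0 mulr1 mulrA.
apply: bmeas_integral_le => //; first exact: measurable_funM sgsg.1 bf.1.
move=> a _; rewrite normrM -[leRHS]mul1r ler_pM// !normrM.
rewrite mulr_ile1 ?mulr_ge0// mulr_ile1//.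
Qed.

Lemma I1_cvg (f_ : nat -> T -> R) (f : T -> R) N C : (forall n, measurable_fun setT (f_ n)) ->
  measurable_fun setT f -> (forall n a, `|f_ n a| <= C) -> mu.-negligible N ->
  (forall a, ~ N a -> f_ n a @[n --> \oo] --> f a) ->
  I1 (f_ n) @[n --> \oo] --> I1 f.
Proof.
move=> mf_ mf fC N0 ff.
apply: (@bmeas_cvg_integral _ _ _ _ _ _ _ _ _ N C) => //.
- by move=> n; exact: measurable_funM bsg.1 _.
- exact: measurable_funM bsg.1 _.
- by move=> n a; rewrite normrM -[leRHS]mul1r ler_pM.
- by move=> a _ Na; apply: cvgM; [exact: cvg_cst|exact: ff].
Qed.

Lemma I3_cvg (f_ : nat -> T -> T -> T -> R) f N C : (forall n, bmeas3 (f_ n)) ->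
  bmeas3 f -> (forall n a b c, `|f_ n a b c| <= C) -> mu.-negligible N ->
  (forall a b c, ~ N a -> ~ N b -> ~ N c -> f_ n a b c @[n --> \oo] --> f a b c) ->
  I3 (f_ n) @[n --> \oo] --> I3 f.
Proof.
move=> bf_ bf fC [A [mA A0 NA]] ff.
(* Convergence of the triple may fail as soon as one label is exceptional; each of the three
   resulting slabs has a null factor and is null for the product. *)
pose N3 := (fun z : T * T * T => [\/ A z.1.1, A z.1.2 | A z.2]).
have mu20 : (fprod mu mu) (A `*` setT) = 0%E.
  by rewrite fprodE// A0 mul0e.
have mu20' : (fprod mu mu) (setT `*` A) = 0%E.
  by rewrite fprodE// A0 mule0.
have N30 : (fprod (fprod mu mu) mu).-negligible N3.
  have m1 : measurable ((A `*` setT) `*` setT : set (T * T * T)).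
    by apply: measurableX => //; exact: measurableX.
  have m2 : measurable ((setT `*` A) `*` setT : set (T * T * T)).
    by apply: measurableX => //; exact: measurableX.
  have m3 : measurable (setT `*` A : set (T * T * T)) by exact: measurableX.
  have z1 : (fprod (fprod mu mu) mu ((A `*` setT) `*` setT) = 0)%E.
    by rewrite fprodE//=; [rewrite mu20 mul0e|exact: measurableX].
  have z2 : (fprod (fprod mu mu) mu ((setT `*` A) `*` setT) = 0)%E.
    by rewrite fprodE//=; [rewrite mu20' mul0e|exact: measurableX].
  have z3 : (fprod (fprod mu mu) mu (setT `*` A) = 0)%E.
    by rewrite fprodE// A0 mule0.
  have n1 : (fprod (fprod mu mu) mu).-negligible ((A `*` setT) `*` setT).
    by exists ((A `*` setT) `*` setT); split.
  have n2 : (fprod (fprod mu mu) mu).-negligible ((setT `*` A) `*` setT).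
    by exists ((setT `*` A) `*` setT); split.
  have n3 : (fprod (fprod mu mu) mu).-negligible (setT `*` A).
    by exists (setT `*` A); split.
  have := negligibleU n1 (negligibleU n2 n3).
  by apply: negligibleS => -[[a b] c] [] /= h; [left|right; left|right; right].
apply: (@bmeas_cvg_integral _ _ _ _ _ _ _ _ _ N3 C) => //.
- by move=> n; exact: measurable_funM sgsg.1 (bf_ n).1.
- exact: measurable_funM sgsg.1 bf.1.
- move=> n z; rewrite normrM -[leRHS]mul1r ler_pM// !normrM.
  by rewrite mulr_ile1 ?mulr_ge0// mulr_ile1.
- move=> [[a b] c] _ /= nN; apply: cvgM; first exact: cvg_cst.
  by apply: ff => /NA ?; apply: nN; [exact: Or31|exact: Or32|exact: Or33].
Qed.

Section positions.
Variable Y : T -> RT.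
Hypothesis mY : measurable_fun setT Y.

Definition upot (x : R) := I1 (fun a => peakon (x - Y a)).
Definition uxpot (x : R) := I1 (fun a => dpeakon (x - Y a)).

Let mxY : measurable_fun setT (fun z : RT * T => z.1 - Y z.2).
Proof. by apply: measurable_funB => //; exact: measurableT_comp. Qed.

Lemma bmeas3_kernel (g : R -> R) : @bmeas R _ RT g ->
  bmeas3 (fun a b c => expR (- spread (Y a) (Y b) (Y c)) * g (med (Y a) (Y b) (Y c))).
Proof.
move=> bg.
have mY1 : measurable_fun setT (fun z : T * T * T => Y z.1.1).
  exact: measurableT_comp mY m11.
have mY2 : measurable_fun setT (fun z : T * T * T => Y z.1.2).
  exact: measurableT_comp mY m12.
have mY3 : measurable_fun setT (fun z : T * T * T => Y z.2).
  exact: measurableT_comp mY measurable_snd.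
apply: bmeasM.
  split.
    apply: (measurableT_comp (f := expR)) => //; apply: measurableT_comp => //.
    apply: measurable_funB.
      by apply: measurable_maxr => //; exact: measurable_maxr.
    by apply: measurable_minr => //; exact: measurable_minr.
  exists 1 => z; rewrite ger0_norm ?expR_ge0// expR_le1 oppr_le0 subr_ge0.
  by rewrite ge_min le_max lexx.
apply: (bmeas_comp bg); apply: measurable_maxr; first exact: measurable_minr.
by apply: measurable_minr => //; exact: measurable_maxr.
Qed.

Lemma bmeas_I1_conv (h : RT -> R) : bmeas h ->
  @bmeas R _ RT (fun x => I1 (fun a => h (x - Y a))).
Proof.
move=> bh.
apply: (bmeas_int2 measurableT muT (f := fun z : RT * T => sg z.2 * h (z.1 - Y z.2))).
apply: bmeasM; first exact: (bmeas_comp bsg).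
exact: (bmeas_comp bh).
Qed.

Lemma bmeas_upot : @bmeas R _ RT upot.
Proof. exact: bmeas_I1_conv bmeas_peakon. Qed.

Lemma bmeas_uxpot : @bmeas R _ RT uxpot.
Proof. exact: bmeas_I1_conv bmeas_dpeakon. Qed.

Lemma integral_I1_conv (h b : R -> R) K : bmeas (h : RT -> R) -> @bmeas R _ RT b ->
  (forall x, K < `|x| -> b x = 0) ->
  \int[leb]_x (I1 (fun a => h (x - Y a)) * b x) =
  I1 (fun a => \int[leb]_x (h (x - Y a) * b x)).
Proof.
move=> bh bb b0.
(* The line has infinite measure; cutting it at the support of [b] is what makes the Fubini lemma
   for bounded functions applicable. *)
rewrite (@Rintegral_supp _ _ K); last by move=> x /b0 ->; rewrite mulr0.
pose f (z : RT * T) := sg z.2 * (h (z.1 - Y z.2) * b z.1).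
have bf : bmeas f.
  apply: bmeasM; first exact: (bmeas_comp bsg).
  by apply: bmeasM; [exact: (bmeas_comp bh)|exact: (bmeas_comp bb)].
have bhx x : bmeas (fun a => h (x - Y a)).
  by apply: (bmeas_comp bh); apply: measurable_funB => //; exact: measurable_cst.
have bhY a : @bmeas R _ RT (fun x => h (x - Y a)).
  by apply: (bmeas_comp bh); apply: measurable_funB => //; exact: measurable_cst.
transitivity (\int[leb]_(x in `[- K, K]) \int[mu]_a f (x, a)).
  apply: eq_Rintegral => x _; rewrite mulrC -I1Z//.
  by apply: eq_Rintegral => a _; rewrite /f/= [b x * _]mulrC.
rewrite (bmeas_fubini _ measurableT (lebesgue_itv_fin _ _) muT bf)//.
apply: eq_Rintegral => a _.
rewrite /f/= bmeas_integralZ//; [|exact: lebesgue_itv_fin|exact: bmeasM].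
congr (_ * _); rewrite (@Rintegral_supp _ _ K)//.
by move=> x /b0 ->; rewrite mulr0.
Qed.

Lemma bmeas_conv_int (h b : R -> R) K : bmeas (h : RT -> R) -> @bmeas R _ RT b ->
  (forall x, K < `|x| -> b x = 0) ->
  bmeas (fun a => \int[leb]_x (h (x - Y a) * b x)).
Proof.
move=> bh bb b0.
have -> : (fun a => \int[leb]_x (h (x - Y a) * b x)) =
    (fun a => \int[leb]_(x in `[- K, K]) (h (x - Y a) * b x)).
  apply/funext => a; rewrite (@Rintegral_supp _ _ K)//.
  by move=> x /b0 ->; rewrite mulr0.
apply: (bmeas_int2 _ _ (f := fun z : T * RT => h (z.2 - Y z.1) * b z.2)) => //.
  exact: lebesgue_itv_fin.
apply: bmeasM; last exact: (bmeas_comp bb).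
apply: (bmeas_comp bh); apply: measurable_funB => //.
exact: measurableT_comp.
Qed.

Section test.
Variables (g g1 g2 : R -> R) (K : R).
Hypotheses (dg : forall x : R, is_derive x (1 : R) g (g1 x))
  (dg1 : forall x : R, is_derive x (1 : R) g1 (g2 x)) (cg2 : continuous g2).
Hypothesis g0 : forall x, K < `|x| -> [/\ g x = 0, g1 x = 0 & g2 x = 0].

Let cder (u v : R -> R) : (forall x : R, is_derive x (1 : R) u (v x)) -> continuous u.
Proof.
move=> du x; apply: differentiable_continuous; apply/derivable1_diffP.
by have [] := du x.
Qed.

Let bg : @bmeas R _ RT g.
Proof. by apply: (continuous_supp_bmeas (cder dg)) => x /g0[]. Qed.
Let bg1 : @bmeas R _ RT g1.
Proof. by apply: (continuous_supp_bmeas (cder dg1)) => x /g0[]. Qed.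
Let bg2 : @bmeas R _ RT g2.
Proof. by apply: (continuous_supp_bmeas cg2) => x /g0[]. Qed.

Lemma integral_upot_helmholtz :
  \int[leb]_x (upot x * (g x - g2 x)) = I1 (fun a => g (Y a)).
Proof.
rewrite (@integral_I1_conv _ _ K); [|exact: bmeas_peakon|exact: bmeasB|].
  by apply: eq_I1 => a; exact: integral_peakon_helmholtz dg dg1 cg2 g0 _.
by move=> x /g0[-> _ ->]; rewrite subrr.
Qed.

Lemma integral_uxpot :
  \int[leb]_x (upot x * g1 x) = - \int[leb]_x (uxpot x * g x).
Proof.
rewrite (@integral_I1_conv _ _ K); [|exact: bmeas_peakon|exact: bg1|].
  rewrite (@integral_I1_conv _ _ K); [|exact: bmeas_dpeakon|exact: bg|].
    rewrite -mulN1r -I1Z; last first.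
      by apply: (@bmeas_conv_int _ _ K); [exact: bmeas_dpeakon|exact: bg|move=> x /g0[]].
    apply: eq_I1 => a; rewrite mulN1r.
    exact: integral_dpeakon dg dg1 cg2 g0 _.
  by move=> x /g0[].
by move=> x /g0[].
Qed.

(** By [I3_mul] the cubic products of potentials are triple label integrals of [mch_integrand];
    Fubini moves the [x] integral inside, where [integral_mch_integrand] evaluates it. *)
Lemma integral_mch_pot :
  \int[leb]_x (- (3^-1 * uxpot x ^+ 3 * g1 x) - 3^-1 * upot x ^+ 3 * g2 x
     + (upot x ^+ 3 + upot x * uxpot x ^+ 2) * g x) =
  6^-1 * I3 (fun a b c => expR (- spread (Y a) (Y b) (Y c)) *
                          g (med (Y a) (Y b) (Y c))).
Proof.
rewrite (@Rintegral_supp _ _ K); last first.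
  by move=> x /g0[-> -> ->]; ring.
pose F (z : RT * (T * T * T)) :=
  sg z.2.1.1 * sg z.2.1.2 * sg z.2.2 *
  mch_integrand g g1 g2 (Y z.2.1.1) (Y z.2.1.2) (Y z.2.2) z.1.
have bp (h : R -> R) i : @bmeas R _ RT h -> measurable_fun setT i ->
    @bmeas R _ (RT * (T * T * T))%type (fun z => h (z.1 - Y (i z.2))).
  move=> bh mi; apply: (bmeas_comp bh); apply: measurable_funB => //.
  by apply: measurableT_comp => //; exact: measurableT_comp.
have bg' (h : R -> R) : @bmeas R _ RT h ->
    @bmeas R _ (RT * (T * T * T))%type (fun z => h z.1).
  by move=> bh; exact: (bmeas_comp bh).
have bpk i := bp _ i bmeas_peakon; have bdpk i := bp _ i bmeas_dpeakon.
have m2 : measurable_fun setT (snd : T * T * T -> T) by [].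
have bF : bmeas F.
  apply: bmeasM; first exact: (bmeas_comp sgsg).
  apply: bmeasD; [apply: bmeasB|].
  - apply: bmeasN; apply: bmeasM; last exact: bg' bg1.
    apply: bmeasM; first exact: bmeas_cst.
    by apply: bmeasM; [apply: bmeasM|]; [exact: (bdpk _ m11)|exact: (bdpk _ m12)|exact: (bdpk _ m2)].
  - apply: bmeasM; last exact: bg' bg2.
    apply: bmeasM; first exact: bmeas_cst.
    by apply: bmeasM; [apply: bmeasM|]; [exact: (bpk _ m11)|exact: (bpk _ m12)|exact: (bpk _ m2)].
  - apply: bmeasM; last exact: bg' bg.
    apply: bmeasD.
      by apply: bmeasM; [apply: bmeasM|]; [exact: (bpk _ m11)|exact: (bpk _ m12)|exact: (bpk _ m2)].
    apply: bmeasM; first exact: bmeas_cst.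
    apply: bmeasD; [apply: bmeasD|].
    + by apply: bmeasM; [apply: bmeasM|]; [exact: (bpk _ m11)|exact: (bdpk _ m12)|exact: (bdpk _ m2)].
    + by apply: bmeasM; [apply: bmeasM|]; [exact: (bdpk _ m11)|exact: (bpk _ m12)|exact: (bdpk _ m2)].
    + by apply: bmeasM; [apply: bmeasM|]; [exact: (bdpk _ m11)|exact: (bdpk _ m12)|exact: (bpk _ m2)].
transitivity (\int[leb]_(x in `[- K, K]) \int[(fprod (fprod mu mu) mu)]_z F (x, z)).
  apply: eq_Rintegral => x _.
  rewrite -/(I3 (fun a b c => mch_integrand g g1 g2 (Y a) (Y b) (Y c) x)).
  have bxY (h : R -> R) : @bmeas R _ RT h -> bmeas (fun a => h (x - Y a)).
    move=> bh; apply: (bmeas_comp bh).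
    by apply: measurable_funB => //; exact: measurable_cst.
  have bP := bxY _ bmeas_peakon; have bD := bxY _ bmeas_dpeakon.
  have b3 (p q r : T -> R) : bmeas p -> bmeas q -> bmeas r ->
      bmeas3 (fun a b c => p a * q b * r c).
    move=> bp' bq br; apply: bmeasM; [apply: bmeasM|].
    - exact: (bmeas_comp bp').
    - exact: (bmeas_comp bq).
    - exact: (bmeas_comp br).
  pose P a := peakon (x - Y a); pose D a := dpeakon (x - Y a).
  have -> : I3 (fun a b c => mch_integrand g g1 g2 (Y a) (Y b) (Y c) x) =
    I3 (fun a b c => (- 3^-1 * g1 x) * (D a * D b * D c) +
      ((g x - 3^-1 * g2 x) * (P a * P b * P c) +
       (3^-1 * g x) * (P a * D b * D c + (D a * P b * D c + D a * D b * P c)))).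
    by apply: eq_I3 => a b c; rewrite /mch_integrand /P /D; ring.
  have bZ k f : bmeas3 f -> bmeas3 (fun a b c => k * f a b c).
    by move=> bf; apply: bmeasM => //; exact: bmeas_cst.
  have bDD f h : bmeas3 f -> bmeas3 h -> bmeas3 (fun a b c => f a b c + h a b c).
    exact: bmeasD.
  have b1 := b3 D D D bD bD bD; have b2 := b3 P P P bP bP bP.
  have c1 := b3 P D D bP bD bD; have c2 := b3 D P D bD bP bD.
  have c3 := b3 D D P bD bD bP.
  have c23 := bDD _ _ c2 c3; have c123 := bDD _ _ c1 c23.
  rewrite (I3D (bZ _ _ b1) (bDD _ _ (bZ _ _ b2) (bZ _ _ c123))).
  rewrite (I3D (bZ _ _ b2) (bZ _ _ c123)) (I3Z _ b1) (I3Z _ b2) (I3Z _ c123).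
  rewrite (I3D c1 c23) (I3D c2 c3) !I3_mul//.
  by rewrite -[I1 P]/(upot x) -[I1 D]/(uxpot x); field.
rewrite (bmeas_fubini _ measurableT (lebesgue_itv_fin _ _) mu3T bF)//.
have bmch a b c : @bmeas R _ RT (mch_integrand g g1 g2 (Y a) (Y b) (Y c)).
  exact: bmeas_mch_integrand dg dg1 cg2 g0 _ _ _.
transitivity (I3 (fun a b c => \int[leb]_(x in `[- K, K])
    mch_integrand g g1 g2 (Y a) (Y b) (Y c) x)).
  apply: eq_Rintegral => z _; rewrite /F/= bmeas_integralZ//.
  exact: lebesgue_itv_fin.
rewrite -I3Z; last exact: bmeas3_kernel.
apply: eq_I3 => a b c.
rewrite -(integral_mch_integrand dg dg1 cg2 g0) [RHS](@Rintegral_supp _ _ K)//.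
by move=> x /g0[h h1 h2]; rewrite /mch_integrand h h1 h2; ring.
Qed.

End test.
End positions.
End signed_integrals.

(** * The smoothed median *)

Section smoothed_median.
Context {R : realType}.
Implicit Types a b c e : R.

Lemma lipschitz_maxr a b c : `|Num.max a b - Num.max a c| <= `|b - c|.
Proof.
rewrite /Num.max; case: ifPn => ab; case: ifPn => ac; rewrite ?lexx//;
  move: ab ac; rewrite -?leNgt => ab ac; rewrite ?subrr ?normr0//;
  case: (ger0P (b - c)) => ?; rewrite ler_norml; apply/andP; split; lra.
Qed.

Lemma lipschitz_minr a b c : `|Num.min a b - Num.min a c| <= `|b - c|.
Proof.
rewrite /Num.min; case: ifPn => ab; case: ifPn => ac; rewrite ?lexx//;
  move: ab ac; rewrite -?leNgt => ab ac; rewrite ?subrr ?normr0//;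
  case: (ger0P (b - c)) => ?; rewrite ler_norml; apply/andP; split; lra.
Qed.

Lemma lipschitz_med a b c c' : `|med a b c - med a b c'| <= `|c - c'|.
Proof. exact: le_trans (lipschitz_maxr _ _ _) (lipschitz_minr _ _ _). Qed.

Lemma lipschitz_spread a b c c' :
  `|spread a b c - spread a b c'| <= 2 * `|c - c'|.
Proof.
rewrite /spread.
have h1 := le_trans (lipschitz_maxr a _ _) (lipschitz_maxr b c c').
have h2 := le_trans (lipschitz_minr a _ _) (lipschitz_minr b c c').
rewrite ler_distl in h1; rewrite ler_distl in h2; rewrite ler_distl.
by move/andP : h1 => [? ?]; move/andP : h2 => [? ?]; apply/andP; split; lra.
Qed.

Lemma spread_ge0 a b c : 0 <= spread a b c.
Proof. by rewrite subr_ge0 ge_min le_max lexx. Qed.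

Lemma lipschitz_expRN (x y : R) : 0 <= x -> 0 <= y ->
  `|expR (- x) - expR (- y)| <= `|x - y|.
Proof.
wlog xy : x y / x <= y.
  move=> h x0 y0; have [xy|/ltW yx] := leP x y; first exact: h.
  by rewrite distrC [leRHS]distrC; exact: h.
move=> x0 y0; rewrite ger0_norm ?subr_ge0 ?ler_expR ?lerN2// distrC.
rewrite ger0_norm ?subr_ge0//.
have -> : expR (- y) = expR (- x) * expR (x - y) by rewrite -expRD; congr expR; ring.
have e1 : expR (- x) <= 1 by rewrite expR_le1 oppr_le0.
have e2 := expR_ge1Dx (x - y); have e0 := expR_ge0 (- x).
have e3 : expR (x - y) <= 1 by rewrite expR_le1 subr_le0.
nra.
Qed.

Definition tent (e x : R) : R := Num.max 0 (1 - `|x| / e).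

Definition tent_sum (e a b c : R) : R :=
  tent e (a - med a b c) + tent e (b - med a b c) + tent e (c - med a b c).

(* Smooths out, at scale [e], the indicator of [c] being the median of the
   three points; the three weights of a triple add up to 1. *)
Definition med_weight (e a b c : R) : R := tent e (c - med a b c) / tent_sum e a b c.

Lemma tent_ge0 e x : 0 <= tent e x. Proof. by rewrite le_max lexx. Qed.

Lemma tent0 e x : 0 < e -> e <= `|x| -> tent e x = 0.
Proof.
by move=> e0 ex; apply/max_idPl; rewrite subr_le0 ler_pdivlMr// mul1r.
Qed.

Lemma lipschitz_tent e x y : 0 < e -> `|tent e x - tent e y| <= `|x - y| / e.
Proof.
move=> e0; rewrite (le_trans (lipschitz_maxr _ _ _))//.
have -> : 1 - `|x| / e - (1 - `|y| / e) = (`|y| - `|x|) / e by ring.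
rewrite normrM [`|e^-1|]gtr0_norm ?invr_gt0// ler_wpM2r//.
  by rewrite invr_ge0 ltW.
by rewrite [leRHS]distrC; exact: ler_dist_dist.
Qed.

Lemma medE a b c : [\/ med a b c = a, med a b c = b | med a b c = c].
Proof.
rewrite /med /Num.max /Num.min.
by repeat case: ifP => _;
  first [by apply: Or31|by apply: Or32|by apply: Or33].
Qed.

(** The median is one of the three points and contributes [tent e 0 = 1]. This keeps the denominator
    of [med_weight] away from 0, even when the points are far apart. *)
Lemma tent_sum_ge1 e a b c : 0 < e -> 1 <= tent_sum e a b c.
Proof.
move=> e0; have t0 x := tent_ge0 e x.
have t1 : tent e 0 = 1 by rewrite /tent normr0 mul0r subr0; apply/max_idPr.
rewrite /tent_sum; have [->|->|->] := medE a b c; rewrite subrr t1.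
- by rewrite -addrA lerDl addr_ge0.
- by rewrite addrAC lerDr addr_ge0.
- by rewrite lerDr addr_ge0.
Qed.

Lemma med_rot a b c : med b c a = med a b c.
Proof.
by rewrite /med /Num.max /Num.min; repeat case: ifPn; rewrite -?leNgt => *;
  lra.
Qed.

Lemma spread_rot a b c : spread b c a = spread a b c.
Proof. by rewrite /spread maxA maxC minA minC. Qed.

Lemma tent_sum_rot e a b c : tent_sum e b c a = tent_sum e a b c.
Proof. by rewrite /tent_sum (med_rot a b c); ring. Qed.

Lemma med_weight_ge0 e a b c : 0 < e -> 0 <= med_weight e a b c.
Proof.
move=> e0; rewrite divr_ge0 ?tent_ge0//.
exact: le_trans ler01 (tent_sum_ge1 _ _ _ e0).
Qed.

Lemma med_weight_sum e a b c : 0 < e ->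
  med_weight e b c a + med_weight e c a b + med_weight e a b c = 1.
Proof.
move=> e0; have h := tent_sum_ge1 a b c e0.
have r2 : med c a b = med a b c by rewrite (med_rot b c a) med_rot.
have t2 : tent_sum e c a b = tent_sum e a b c by rewrite (tent_sum_rot e b c a) tent_sum_rot.
rewrite /med_weight t2 r2 (tent_sum_rot e a b c) (med_rot a b c) -!mulrDl divff//.
by rewrite gt_eqF// (lt_le_trans ltr01).
Qed.

Lemma med_weight_le1 e a b c : 0 < e -> med_weight e a b c <= 1.
Proof.
move=> e0; rewrite -(med_weight_sum a b c e0) lerDr addr_ge0//;
  exact: med_weight_ge0.
Qed.

Lemma med_weight0 e a b c : 0 < e -> e <= `|c - med a b c| ->
  med_weight e a b c = 0.
Proof. by move=> e0 h; rewrite /med_weight tent0// mul0r. Qed.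

(** The weights form a convex combination, and only points within [e] of the median have a nonzero
    weight. *)
Lemma med_weight_average e a b c (g : R -> R) L : 0 < e ->
  (forall x y, `|g x - g y| <= L * `|x - y|) ->
  `|med_weight e b c a * g a + med_weight e c a b * g b + med_weight e a b c * g c
    - g (med a b c)| <= L * e.
Proof.
move=> e0 gL.
have L0 : 0 <= L by have := gL 1 0; rewrite subr0 normr1 mulr1; exact: le_trans.
have key x y z : med x y z = med a b c ->
    `|med_weight e x y z * (g z - g (med a b c))| <= med_weight e x y z * (L * e).
  move=> m; rewrite normrM ger0_norm ?med_weight_ge0//.
  have [h|h] := leP e `|z - med x y z|; first by rewrite med_weight0// !mul0r.
  rewrite ler_wpM2l ?med_weight_ge0// (le_trans (gL _ _))// ler_wpM2l// -m.
  exact: ltW.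
have -> : med_weight e b c a * g a + med_weight e c a b * g b +
    med_weight e a b c * g c - g (med a b c) =
    med_weight e b c a * (g a - g (med a b c)) +
    med_weight e c a b * (g b - g (med a b c)) +
    med_weight e a b c * (g c - g (med a b c)).
  rewrite !mulrBr -[X in _ - X]mul1r -{1}(med_weight_sum a b c e0); ring.
rewrite (le_trans (ler_normD _ _))// -[leRHS]mul1r -(med_weight_sum a b c e0) mulrDl lerD//.
  rewrite (le_trans (ler_normD _ _))// mulrDl lerD//; apply: key.
    by rewrite (med_rot a b c).
  by rewrite (med_rot b c a) med_rot.
exact: key.
Qed.

Definition med_kernel (e a b c : R) : R :=
  expR (- spread a b c) * med_weight e a b c.

Lemma med_kernel_ge0 e a b c : 0 < e -> 0 <= med_kernel e a b c.
Proof. by move=> e0; rewrite mulr_ge0 ?expR_ge0 ?med_weight_ge0. Qed.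

Lemma med_kernel_le1 e a b c : 0 < e -> med_kernel e a b c <= 1.
Proof.
move=> e0; rewrite mulr_ile1 ?expR_ge0 ?med_weight_ge0 ?med_weight_le1//.
by rewrite expR_le1 oppr_le0 spread_ge0.
Qed.

(** The 6 is 2 + 4: the numerator varies at rate [2 / e], since both [c] and the median move, and
    the sum of tents at rate [(1 + 1 + 2) / e]. *)
Lemma lipschitz_med_weight e a b c c' : 0 < e ->
  `|med_weight e a b c - med_weight e a b c'| <= 6 / e * `|c - c'|.
Proof.
move=> e0; have hm := lipschitz_med a b c c'.
set d := `|c - c'| in hm *.
have ta x : `|tent e (x - med a b c) - tent e (x - med a b c')| <= d / e.
  rewrite (le_trans (lipschitz_tent _ _ e0))// ler_pM2r ?invr_gt0//.
  have -> : x - med a b c - (x - med a b c') = - (med a b c - med a b c') by ring.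
  by rewrite normrN.
have tc : `|tent e (c - med a b c) - tent e (c' - med a b c')| <= 2 * d / e.
  rewrite (le_trans (lipschitz_tent _ _ e0))// ler_pM2r ?invr_gt0//.
  have -> : c - med a b c - (c' - med a b c') = (c - c') - (med a b c - med a b c').
    by ring.
  by rewrite (le_trans (ler_normB _ _))// mulr_natl mulr2n lerD.
have h := tent_sum_ge1 a b c e0; have h' := tent_sum_ge1 a b c' e0.
have w1 := med_weight_le1 a b c' e0; have w0 := med_weight_ge0 a b c' e0.
have ts : `|tent_sum e a b c - tent_sum e a b c'| <= 4 * d / e.
  have -> : tent_sum e a b c - tent_sum e a b c' =
     (tent e (a - med a b c) - tent e (a - med a b c')) +
     (tent e (b - med a b c) - tent e (b - med a b c')) +
     (tent e (c - med a b c) - tent e (c' - med a b c')) by rewrite /tent_sum; ring.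
  have -> : 4 * d / e = d / e + d / e + 2 * d / e by ring.
  by rewrite (le_trans (ler_normD _ _))// lerD// (le_trans (ler_normD _ _))// lerD.
(* The difference of quotients is arranged so that the only denominator left is at least 1 and the
   change of [tent_sum] is multiplied by a weight at most 1. *)
have -> : med_weight e a b c - med_weight e a b c' =
   ((tent e (c - med a b c) - tent e (c' - med a b c'))
    - med_weight e a b c' * (tent_sum e a b c - tent_sum e a b c'))
   / tent_sum e a b c.
  by rewrite /med_weight; field; rewrite !gt_eqF ?(lt_le_trans ltr01).
rewrite normrM [`|(tent_sum _ _ _ _)^-1|]gtr0_norm ?invr_gt0 ?(lt_le_trans ltr01)//.
rewrite ler_pdivrMr ?(lt_le_trans ltr01)//.
rewrite (@le_trans _ _ (6 / e * d))//; last first.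
  rewrite ler_peMr//; apply: mulr_ge0; last exact: normr_ge0.
  by apply: divr_ge0 => //; exact: ltW.
rewrite (le_trans (ler_normB _ _))//.
have -> : 6 / e * d = 2 * d / e + 4 * d / e by ring.
rewrite lerD// normrM [`|med_weight _ _ _ _|]ger0_norm//.
by rewrite -[leRHS]mul1r ler_pM.
Qed.

Lemma lipschitz_med_kernel e a b c c' : 0 < e ->
  `|med_kernel e a b c - med_kernel e a b c'| <= (2 + 6 / e) * `|c - c'|.
Proof.
move=> e0; rewrite /med_kernel.
have h1 := le_trans (lipschitz_expRN (spread_ge0 a b c) (spread_ge0 a b c'))
  (lipschitz_spread a b c c').
have h2 := lipschitz_med_weight a b c c' e0.
set E := expR (- spread a b c) in h1 *; set E' := expR (- spread a b c') in h1 *.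
set w := med_weight e a b c in h2 *; set w' := med_weight e a b c' in h2 *.
have -> : E * w - E' * w' = (E - E') * w + E' * (w - w') by ring.
rewrite (le_trans (ler_normD _ _))// [leRHS]mulrDl lerD// normrM.
  rewrite -[leRHS]mulr1 ler_pM// ger0_norm ?med_weight_ge0 ?med_weight_le1//.
rewrite -[leRHS]mul1r ler_pM// ger0_norm ?expR_ge0//.
by rewrite expR_le1 oppr_le0 spread_ge0.
Qed.

End smoothed_median.

(** * The Euler scheme *)

Section euler_scheme.
Context {R : realType} d (T : measurableType d).
Notation RT := (measurableTypeR R).
Variables (mu : {finite_measure set T -> \bar R}) (sg : T -> R).
Hypothesis bsg : bmeas sg.
Hypothesis sg1 : forall a, `|sg a| <= 1.
Notation M := (fine (mu setT)).
Notation I1 := (I1 mu sg).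
Notation I3 := (I3 mu sg).

Let M0 : 0 <= M. Proof. by rewrite fine_ge0. Qed.

Let sgsg2 : @bmeas R _ (T * T)%type (fun z => sg z.1 * sg z.2).
Proof. by apply: bmeasM; apply: (bmeas_comp bsg). Qed.

Let mu2M : fine (fprod mu mu setT) = M ^+ 2.
Proof.
have -> : [set: T * T] = setT `*` setT by rewrite setXTT.
by rewrite fprodE// fineM ?fin_num_measure.
Qed.

(** The 1/2 becomes 1/6 once a triple is averaged over its three rotations. The argument [y] is a
    point of the line rather than a label, so one velocity field moves all labels; this is what lets
    a step preserve their order. *)
Definition velocity (e : R) (Y : T -> R) (y : R) : R :=
  2^-1 * \int[fprod mu mu]_z (sg z.1 * sg z.2 * med_kernel e (Y z.1) (Y z.2) y).

Lemma bmeas_med_kernel d' (T' : measurableType d') (f g h : T' -> RT) e : 0 < e ->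
  measurable_fun setT f -> measurable_fun setT g -> measurable_fun setT h ->
  @bmeas R _ T' (fun z => med_kernel e (f z) (g z) (h z)).
Proof.
move=> e0 mf mg mh; split; last first.
  by exists 1 => z; rewrite ger0_norm ?med_kernel_ge0 ?med_kernel_le1.
have mmed : measurable_fun setT (fun z => med (f z) (g z) (h z) : RT).
  apply: measurable_maxr; first exact: measurable_minr.
  by apply: measurable_minr => //; exact: measurable_maxr.
have mtent (u : T' -> RT) : measurable_fun setT u ->
    measurable_fun setT (fun z => tent e (u z - med (f z) (g z) (h z)) : RT).
  move=> mu'; apply: measurable_maxr => //; apply: measurable_funB => //.
  apply: measurable_funM => //; apply: measurableT_comp => //.
  exact: measurable_funB.
apply: measurable_funM.
  apply: (measurableT_comp (f := expR)) => //; apply: measurableT_comp => //.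
  apply: measurable_funB.
    by apply: measurable_maxr => //; exact: measurable_maxr.
  by apply: measurable_minr => //; exact: measurable_minr.
apply: measurable_funM; first exact: mtent.
(* The denominator is at least 1, so inserting [Num.max 1] changes nothing and turns the inverse
   into a function continuous on the whole line. *)
have -> : (fun z => (tent_sum e (f z) (g z) (h z))^-1) =
    (fun x : R => (Num.max 1 x)^-1) \o (fun z => tent_sum e (f z) (g z) (h z)).
  by apply/funext => z /=; rewrite (max_idPr (tent_sum_ge1 _ _ _ e0)).
apply: measurableT_comp; last first.
  by apply: measurable_funD; [apply: measurable_funD|]; exact: mtent.
apply: continuous_measurable_fun => x.
apply: (@continuousV _ _ (fun x : R => Num.max 1 x)).
  by rewrite gt_eqF// lt_max ltr01.
apply: (@continuous_max _ _ (fun=> 1) id); [exact: cst_continuous|by move=> ?; exact: cvg_id].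
Qed.

Section fixed_scale.
Variables (e : R) (Y : T -> RT).
Hypotheses (e0 : 0 < e) (mY : measurable_fun setT Y).

Let bK y : @bmeas R _ (T * T)%type
  (fun z => sg z.1 * sg z.2 * med_kernel e (Y z.1) (Y z.2) y).
Proof.
apply: bmeasM => //; apply: bmeas_med_kernel => //; exact: measurableT_comp.
Qed.

Lemma velocity_le y : `|velocity e Y y| <= 2^-1 * M ^+ 2.
Proof.
rewrite /velocity normrM ger0_norm// ler_wpM2l// -mu2M -[leRHS]mul1r.
apply: bmeas_integral_le => //; first exact: (bK y).1.
move=> z _; rewrite normrM; apply: mulr_ile1 => //.
  by rewrite normrM; exact: mulr_ile1.
by rewrite ger0_norm ?med_kernel_ge0 ?med_kernel_le1.
Qed.

Lemma lipschitz_velocity y y' :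
  `|velocity e Y y - velocity e Y y'| <= (2^-1 * M ^+ 2) * (2 + 6 / e) * `|y - y'|.
Proof.
rewrite /velocity -mulrBr normrM ger0_norm//.
rewrite -bmeas_integralB// -mu2M.
set m := fine _; set D := `|y - y'|.
have -> : 2^-1 * m * (2 + 6 / e) * D = 2^-1 * ((2 + 6 / e) * D * m) by ring.
rewrite ler_wpM2l// {}/m {}/D.
apply: bmeas_integral_le => //; first exact: (bmeasB (bK y) (bK y')).1.
move=> z _; rewrite -mulrBr normrM -[leRHS]mul1r ler_pM//.
  by rewrite normrM mulr_ile1.
exact: lipschitz_med_kernel.
Qed.

Lemma bmeas_velocity : @bmeas R _ RT (velocity e Y).
Proof.
have m1 : measurable_fun setT (fun p : RT * (T * T) => Y p.2.1).
  by apply: measurableT_comp => //; exact: measurableT_comp.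
have m2 : measurable_fun setT (fun p : RT * (T * T) => Y p.2.2).
  by apply: measurableT_comp => //; exact: measurableT_comp.
have bF : @bmeas R _ (RT * (T * T))%type (fun p => sg p.2.1 * sg p.2.2 *
    med_kernel e (Y p.2.1) (Y p.2.2) p.1).
  by apply: bmeasM; [exact: (bmeas_comp sgsg2)|exact: bmeas_med_kernel].
apply: bmeasM; first exact: bmeas_cst.
exact: (bmeas_int2 measurableT (finite_measureT (fprod mu mu)) bF).
Qed.

(* Symmetrising the triple integral over rotations turns the weights of the
   smoothed median into an average of [g] over points close to the median. *)
Lemma velocity_weak (g : R -> R) L : @bmeas R _ RT g ->
  (forall x y, `|g x - g y| <= L * `|x - y|) ->
  `|I1 (fun a => velocity e Y (Y a) * g (Y a)) -
    6^-1 * I3 (fun a b c => expR (- spread (Y a) (Y b) (Y c)) *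
                            g (med (Y a) (Y b) (Y c)))| <= 6^-1 * (L * e * M ^+ 3).
Proof.
move=> bg gL.
pose W a b c := med_kernel e (Y a) (Y b) (Y c) * g (Y c).
have mYm (i : T * T * T -> T) : measurable_fun setT i ->
  measurable_fun setT (fun z => Y (i z)) by exact: measurableT_comp.
have m1 := mYm _ (measurableT_comp measurable_fst measurable_fst).
have m2 := mYm _ (measurableT_comp measurable_snd measurable_fst).
have m3 := mYm _ measurable_snd.
have bW : bmeas3 W.
  apply: bmeasM; first exact: (bmeas_med_kernel e0 m1 m2 m3).
  exact: (bmeas_comp bg).
have bW1 : bmeas3 (fun a b c => W b c a).
  apply: bmeasM; first exact: (bmeas_med_kernel e0 m2 m3 m1).
  exact: (bmeas_comp bg).
have bW2 : bmeas3 (fun a b c => W c a b).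
  apply: bmeasM; first exact: (bmeas_med_kernel e0 m3 m1 m2).
  exact: (bmeas_comp bg).
have bE := bmeas3_kernel mY bg.
have -> : I1 (fun a => velocity e Y (Y a) * g (Y a)) = 2^-1 * I3 W.
  rewrite /I3.
  have bF : @bmeas R _ (T * T * T)%type
     (fun z => sg z.1.1 * sg z.1.2 * sg z.2 * W z.1.1 z.1.2 z.2).
    apply: bmeasM => //; apply: bmeasM; last exact: (bmeas_comp bsg).
    exact: (bmeas_comp sgsg2).
  have bF' : @bmeas R _ (T * (T * T))%type
     (fun p => sg p.2.1 * sg p.2.2 * sg p.1 * W p.2.1 p.2.2 p.1).
    apply: (bmeas_comp bF (g := fun p : T * (T * T) => (p.2, p.1))).
    exact: measurable_fun_pair.
  have bG := bmeas_int2 measurableT (finite_measureT (fprod mu mu)) bF'.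
  rewrite (bmeas_fprod_swap _ _ bF) -bmeas_integralZ//.
  apply: eq_Rintegral => c _ /=; rewrite /velocity.
  have -> : \int[fprod mu mu]_z (sg z.1 * sg z.2 * sg c * W z.1 z.2 c) =
      (sg c * g (Y c)) *
      \int[fprod mu mu]_z (sg z.1 * sg z.2 * med_kernel e (Y z.1) (Y z.2) (Y c)).
    by rewrite -bmeas_integralZ//; apply: eq_Rintegral => z _; rewrite /W; ring.
  by ring.
rewrite (_ : I3 W = 3^-1 * I3 (fun a b c => W b c a + (W c a b + W a b c))); last first.
  rewrite I3D//; last exact: bmeasD.
  rewrite I3D// -(I3_rot mu bsg bW) -(I3_rot mu bsg bW1) -(I3_rot mu bsg bW).
  by field.
rewrite mulrA (_ : 2^-1 * 3^-1 = 6^-1 :> R); last by field.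
rewrite -mulrBr normrM ger0_norm// ler_wpM2l// -mulN1r -I3Z// -I3D//; last 2 first.
- by apply: bmeasD => //; exact: bmeasD.
- by apply: bmeasM => //; exact: bmeas_cst.
apply: I3_le => //.
  apply: bmeasD; first by apply: bmeasD => //; exact: bmeasD.
  by apply: bmeasM => //; exact: bmeas_cst.
move=> a b c.
have -> : W b c a + (W c a b + W a b c) +
    -1 * (expR (- spread (Y a) (Y b) (Y c)) * g (med (Y a) (Y b) (Y c))) =
  expR (- spread (Y a) (Y b) (Y c)) * (med_weight e (Y b) (Y c) (Y a) * g (Y a) +
    med_weight e (Y c) (Y a) (Y b) * g (Y b) + med_weight e (Y a) (Y b) (Y c) * g (Y c)
    - g (med (Y a) (Y b) (Y c))).
  rewrite /W /med_kernel (spread_rot (Y a) (Y b) (Y c)).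
  rewrite -(spread_rot (Y c) (Y a) (Y b)); ring.
rewrite normrM -[leRHS]mul1r ler_pM//.
  by rewrite ger0_norm ?expR_ge0// expR_le1 oppr_le0 spread_ge0.
exact: med_weight_average.
Qed.

End fixed_scale.

(** * Discrete trajectories and their weak form *)

Fixpoint euler (e h : R) (X0 : T -> R) (k : nat) : T -> R :=
  if k is k'.+1 then
    fun a => euler e h X0 k' a +
      h * velocity e (euler e h X0 k') (euler e h X0 k' a)
  else X0.

Section euler_properties.
Variables (e h : R) (X0 : T -> RT).
Hypotheses (e0 : 0 < e) (h0 : 0 <= h) (mX0 : measurable_fun setT X0).
Notation X := (euler e h X0).
Notation c := (2^-1 * M ^+ 2).

Lemma measurable_euler k : measurable_fun setT (X k : T -> RT).
Proof.
elim: k => //= k IH; apply: measurable_funD => //; apply: measurable_funM => //.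
by apply: (measurableT_comp (f := velocity e (X k))) => //; exact: (bmeas_velocity e0 IH).1.
Qed.

Lemma euler_step k a : `|X k.+1 a - X k a| <= h * c.
Proof.
rewrite /= addrAC subrr add0r normrM ger0_norm// ler_wpM2l//.
exact: velocity_le (measurable_euler k) _.
Qed.

Lemma euler_dist k n a : `|X (k + n) a - X k a| <= h * c * n%:R.
Proof.
elim: n => [|n IH]; first by rewrite addn0 subrr normr0 mulr0.
have := euler_step (k + n) a; rewrite addnS.
move: (X (k + n).+1 a) (X (k + n) a) IH => x y IH st.
have -> : x - X k a = (x - y) + (y - X k a) by ring.
rewrite (le_trans (ler_normD _ _))//.
have -> : n.+1%:R = n%:R + 1 :> R by rewrite natr1.
by rewrite [leRHS]mulrDr mulr1 addrC lerD.
Qed.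

(** A step applies the map [y + h * velocity e (X k) y] to every label; it is nondecreasing because
    [h] times the Lipschitz constant of the velocity is at most 1. *)
Lemma euler_mono k a b : h * (c * (2 + 6 / e)) <= 1 -> X0 a <= X0 b ->
  X k a <= X k b.
Proof.
move=> hL ab; elim: k => //= k IH.
have mX := measurable_euler k.
have := lipschitz_velocity e0 mX (X k b) (X k a).
rewrite [`|X k b - X k a|]ger0_norm ?subr_ge0// ler_norml => /andP[lip _].
move: (velocity e _ (X k a)) (velocity e _ (X k b)) lip => u v.
move: (X k a) (X k b) (c * (2 + 6 / e)) hL IH => x y K hK xy lip.
have A := ler_wpM2l h0 lip.
have B : h * K * (y - x) <= 1 * (y - x) by rewrite ler_wpM2r// subr_ge0.
nra.
Qed.

Section weak_form.
Variables (phi phix phit : R -> R -> R) (C L : R).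
Hypotheses (bphi : forall t, @bmeas R _ RT (phi ^~ t))
  (bphix : forall t, @bmeas R _ RT (phix ^~ t))
  (bphit : forall t, @bmeas R _ RT (phit ^~ t)).
Hypothesis taylor : forall x t x' t',
  `|phi x' t' - phi x t - (phit x t * (t' - t) + phix x t * (x' - x))| <=
  C * (`|x' - x| + `|t' - t|) ^+ 2.
Hypothesis phixL : forall t x y, `|phix x t - phix y t| <= L * `|x - y|.

Definition euler_rate k : R :=
  I1 (fun a => phit (X k a) (k%:R * h)) +
  6^-1 * I3 (fun a b c => expR (- spread (X k a) (X k b) (X k c)) *
                          phix (med (X k a) (X k b) (X k c)) (k%:R * h)).

(** The error per unit of time: a quadratic Taylor remainder for an increment of size at most
    [h * (c + 1)], divided by [h], and the cost of the smoothed median from [velocity_weak]. *)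
Definition euler_error : R :=
  h * (C * (c + 1) ^+ 2 * M) + 6^-1 * (L * e * M ^+ 3).

Lemma euler_weak_step k :
  `|I1 (fun a => phi (X k.+1 a) (k.+1%:R * h)) - I1 (fun a => phi (X k a) (k%:R * h))
    - h * euler_rate k| <= h * euler_error.
Proof.
have mX := measurable_euler.
have C0 : 0 <= C.
  have := le_trans (normr_ge0 _) (taylor 0 0 1 0).
  by rewrite !subr0 normr1 normr0 addr0 expr1n mulr1.
pose V a := velocity e (X k) (X k a).
have bV : bmeas V by exact: (bmeas_comp (bmeas_velocity e0 (mX k)) (mX k)).
have bX (g : R -> R) n : @bmeas R _ RT g -> bmeas (fun a => g (X n a)).
  by move=> bg; exact: (bmeas_comp bg (mX n)).
(* [D a] is the Taylor remainder of [phi] along one step of the label [a]; what is left of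
   [euler_rate] is the discrepancy bounded by [velocity_weak]. *)
pose D a := phi (X k.+1 a) (k.+1%:R * h) +
  ((-1) * phi (X k a) (k%:R * h) + (- h) * (phit (X k a) (k%:R * h) + V a * phix (X k a) (k%:R * h))).
have b1 := bX _ k.+1 (bphi (k.+1%:R * h)).
have b2 := bX _ k (bphi (k%:R * h)).
have b3 := bX _ k (bphit (k%:R * h)).
have b4 := bmeasM bV (bX _ k (bphix (k%:R * h))).
have b34 := bmeasD b3 b4.
have bZ r f : bmeas f -> @bmeas R _ T (fun a => r * f a).
  by move=> bf; apply: bmeasM => //; exact: bmeas_cst.
have -> : I1 (fun a => phi (X k.+1 a) (k.+1%:R * h)) -
    I1 (fun a => phi (X k a) (k%:R * h)) - h * euler_rate k =
  I1 D + h * (I1 (fun a => V a * phix (X k a) (k%:R * h)) -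
    6^-1 * I3 (fun a b c => expR (- spread (X k a) (X k b) (X k c)) *
                          phix (med (X k a) (X k b) (X k c)) (k%:R * h))).
  rewrite /D (I1D mu bsg b1 (bmeasD (bZ _ _ b2) (bZ _ _ b34))).
  rewrite (I1D mu bsg (bZ _ _ b2) (bZ _ _ b34)) (I1Z mu bsg _ b2) (I1Z mu bsg _ b34) (I1D mu bsg b3 b4).
  by rewrite /euler_rate; ring.
rewrite (le_trans (ler_normD _ _))// /euler_error [leRHS]mulrDr lerD//; last first.
  rewrite normrM ger0_norm// ler_wpM2l//.
  exact: (velocity_weak e0 (mX k) (bphix _) (phixL _)).
have -> : h * (h * (C * (c + 1) ^+ 2 * M)) = (C * (h * c + h) ^+ 2) * M by ring.
apply: I1_le => //; first exact: (bmeasD b1 (bmeasD (bZ _ _ b2) (bZ _ _ b34))).1.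
move=> a; have := taylor (X k a) (k%:R * h) (X k.+1 a) (k.+1%:R * h).
have e1 : X k.+1 a - X k a = h * V a by rewrite /= addrAC subrr add0r.
have e2 : k.+1%:R * h - k%:R * h = h by rewrite -mulrBl -natr1 addrAC subrr add0r mul1r.
rewrite e1 e2 => ht.
have -> : D a = phi (X k.+1 a) (k.+1%:R * h) - phi (X k a) (k%:R * h) -
  (phit (X k a) (k%:R * h) * h + phix (X k a) (k%:R * h) * (h * V a)).
  by rewrite /D; ring.
rewrite (le_trans ht)// ler_wpM2l// lerXn2r ?nnegrE ?addr_ge0 ?mulr_ge0 ?exprn_ge0//.
rewrite [`|h|]ger0_norm// lerD2r -e1; exact: euler_step.
Qed.

Lemma euler_weak_sum K :
  `|I1 (fun a => phi (X K a) (K%:R * h)) - I1 (fun a => phi (X0 a) 0)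
    - \sum_(k < K) h * euler_rate k| <= K%:R * h * euler_error.
Proof.
elim: K => [|K IH].
  by rewrite big_ord0 /= !mul0r subrr subr0 normr0.
rewrite big_ord_recr/=.
set S := \sum_(_ < _) _ in IH *.
set A := I1 _ in IH *; set B := I1 _ in IH *; set A' := I1 _.
have := euler_weak_step K; rewrite -/A -/A' => st.
have -> : A' - B - (S + h * euler_rate K) = (A - B - S) + (A' - A - h * euler_rate K) by ring.
rewrite (le_trans (ler_normD _ _))//.
have -> : K.+1%:R = K%:R + 1 :> R by rewrite natr1.
by rewrite !mulrDl mul1r lerD.
Qed.

End weak_form.
End euler_properties.
End euler_scheme.

(** * Compactness of monotone flows *)

Section monotone_compactness.
Context {R : realType}.
Notation RT := (measurableTypeR R).

(** Every jump of a monotone [f] has such a rational in its gap, and a rational serves one point at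
    most, so jumps are countable. A point where [f] strictly crosses the value [r] without jumping
    is counted too, which is harmless for countability. *)
Definition jump_at (f : R -> R) (r : rat) : set R :=
  [set a | (forall b, b < a -> f b < ratr r) /\ (forall b, a < b -> ratr r < f b)].

Lemma jump_at_inj f r a b : jump_at f r a -> jump_at f r b -> a = b.
Proof.
wlog ab : a b / a <= b.
  move=> h fa fb; have [ab|/ltW ba] := leP a b; first exact: h.
  by apply/esym; exact: h.
move=> [_ fa] [fb _]; apply/eqP; rewrite eq_le ab /= leNgt; apply/negP => ltab.
have m1 : a < (a + b) / 2 by rewrite ltr_pdivlMr//; lra.
have m2 : (a + b) / 2 < b by rewrite ltr_pdivrMr//; lra.
by have := lt_trans (fa _ m1) (fb _ m2); rewrite ltxx.
Qed.

Lemma rat_between (x y : R) : x < y -> exists r : rat, x < ratr r < y.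
Proof.
by move=> /rat_in_itvoo[r]; rewrite in_itv/= => ?; exists r.
Qed.

(** If [f] stayed below [f a - e] on the left, or above [f a + e] on the right, a rational in the
    gap would witness a jump at [a]. *)
Lemma no_jump f a : (forall x y, x <= y -> f x <= f y) ->
  (forall r, ~ jump_at f r a) -> forall e, 0 < e ->
  exists b b', [/\ b < a, a < b', f a - e < f b & f b' < f a + e].
Proof.
move=> ndf nj e e0.
have [b [ba fb]] : exists b, b < a /\ f a - e < f b.
  apply: contrapT => nb; have [r /andP[r1 r2]] : exists r, f a - e < ratr r < f a.
    by apply: rat_between; lra.
  apply: (nj r); split => b ab.
    apply: le_lt_trans r1; rewrite leNgt; apply/negP => h; apply: nb; by exists b.
  exact: lt_le_trans r2 (ndf _ _ (ltW ab)).
have [b' [ba' fb']] : exists b', a < b' /\ f b' < f a + e.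
  apply: contrapT => nb; have [r /andP[r1 r2]] : exists r, f a < ratr r < f a + e.
    by apply: rat_between; lra.
  apply: (nj r); split => b' ab.
    exact: le_lt_trans (ndf _ _ (ltW ab)) r1.
  apply: lt_le_trans r2 _; rewrite leNgt; apply/negP => h; apply: nb; by exists b'.
by exists b, b'; split.
Qed.

Variable mu : {finite_measure set RT -> \bar R}.

Let cdf (a : R) : R := fine (mu [set x | x <= a]).

Let mle (a : R) : measurable ([set x | x <= a] : set RT).
Proof.
have -> : [set x : R | x <= a] = [set` `]-oo, a]] by apply/seteqP; split => x /=; rewrite in_itv.
exact: measurable_itv.
Qed.

Let mlt (a : R) : measurable ([set x | x < a] : set RT).
Proof.
have -> : [set x : R | x < a] = [set` `]-oo, a[] by apply/seteqP; split => x /=; rewrite in_itv.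
exact: measurable_itv.
Qed.

Let fle (A B : set RT) : measurable A -> measurable B -> A `<=` B ->
  fine (mu A) <= fine (mu B).
Proof.
by move=> mA mB AB; rewrite fine_le ?fin_num_measure// le_measure ?inE.
Qed.

(** The distribution function of [mu] rises at an atom by its mass, so rationals enumerate the
    atoms. *)
Lemma atom_jump (a : R) : (mu [set a] != 0)%E -> exists r, jump_at cdf r a.
Proof.
move=> ma.
have cdfE : cdf a = fine (mu [set x | x < a]) + fine (mu [set a]).
  rewrite /cdf -fineD ?fin_num_measure// -measureU//; last first.
    by apply/seteqP; split => x //= [/[swap] ->]; rewrite ltxx.
  congr (fine (mu _)); apply/seteqP; split => x /=.
    by rewrite le_eqVlt => /orP[/eqP|]; [right|left].
  by case=> [/ltW//|->].
have ap : 0 < fine (mu [set a]).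
  by rewrite lt0r fine_ge0// andbT fine_eq0// fin_num_measure.
have [r /andP[r1 r2]] : exists r, fine (mu [set x | x < a]) < ratr r < cdf a.
  by apply: rat_between; rewrite cdfE; lra.
exists r; split => b ab.
  by apply: le_lt_trans r1; apply: fle => // x /= xb; exact: le_lt_trans xb ab.
by apply: lt_le_trans r2 _; apply: fle => // x /= xb; exact: le_trans xb (ltW ab).
Qed.

(* Rationals together with all the atoms of [mu]. *)
Definition label (i : rat + rat) : R :=
  match i with inl q => ratr q | inr r => xget 0 (jump_at cdf r) end.

Lemma atom_label (a : R) : (mu [set a] != 0)%E -> exists i, label i = a.
Proof.
move=> /atom_jump[r ja]; exists (inr r) => /=.
by case: xgetP => [b _ jb|/(_ a)//]; exact: jump_at_inj jb ja.
Qed.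

(** For each rational the set contains at most one point, of mass zero, and the rationals are
    countable. *)
Lemma nonatom_jumps_negligible (f : R -> R) :
  mu.-negligible [set a | (mu [set a] == 0)%E /\ exists r, jump_at f r a].
Proof.
have n0 : mu.-negligible (set0 : set RT) by exact: negligible_set0.
apply: (@negligibleS _ _ _ mu (\bigcup_k [set a : RT | (mu [set a] == 0)%E /\
    (exists2 r, unpickle k = Some r & jump_at f r a)])).
  by move=> a [a0 [r ja]]; exists (pickle r) => //; split => //; exists r; rewrite ?pickleK.
apply: negligible_bigcup => k.
have [[a [a0 [r kr ja]]]|] := pselect (exists a : R, (mu [set a] == 0)%E /\
    (exists2 r, unpickle k = Some r & jump_at f r a)).
  exists [set a]; split => //; first exact/eqP.
  by move=> b [b0 [r' kr' jb]]; move: kr'; rewrite kr => -[rr']; move: jb; rewrite -rr' => jb; exact: jump_at_inj jb ja.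
move=> h; apply: negligibleS n0 => a ha; apply: h; by exists a.
Qed.

(** A bounded sequence clusters in a compact segment, and an ultrafilter converges to any of its
    cluster points. One ultrafilter thus provides limits for all labels and times simultaneously. *)
Lemma ultra_limit (U : set_system nat) (u : nat -> R) (b : R) :
  UltraFilter U -> (forall n, `|u n| <= b) ->
  exists l : R, u @ U --> l.
Proof.
move=> FU ub.
have PU : ProperFilter U by exact: ultra_proper.
have PF : ProperFilter (u @ U) by exact: fmap_proper_filter.
have Ub : (u @ U) [set` `[- b, b]].
  apply: (@filterS _ U _ _ _ _ (@filterT _ U _)) => n _ /=.
  rewrite in_itv/= -ler_norml; exact: ub.
have [l [_ cl]] := @segment_compact R (- b) b (u @ U) PF Ub.
exists l => V Vl; have [//|nV] := in_ultra_setVsetC (u @^-1` V) FU.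
have UV : U (u @^-1` (u @` (~` (u @^-1` V)))).
  by apply: filterS nV => n Vn /=; exists n.
by have [x [[n nVn <-] Vx]] := cl _ _ UV Vl.
Qed.

Section helly.
Variables (X : nat -> R -> R -> R) (c : R) (eta : nat -> R).
Hypothesis ndX : forall n t a b, a <= b -> X n a t <= X n b t.
Hypothesis lipX : forall n a s t, `|X n a t - X n a s| <= c * `|t - s| + eta n.
Hypothesis X0 : forall n a, X n a 0 = a.
Hypothesis eta1 : forall n, eta n <= 1.
Hypothesis eta0 : eta n @[n --> \oo] --> 0.

Theorem helly_selection : exists (nn : nat -> nat) (Y : R -> R -> R),
  [/\ (forall j, (j <= nn j)%N), (forall t a b, a <= b -> Y a t <= Y b t),
     (forall a s t, `|Y a t - Y a s| <= c * `|t - s|), (forall a, Y a 0 = a) &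
     forall t, exists2 N, mu.-negligible N &
       forall a, ~ N a -> X (nn j) a t @[j --> \oo] --> Y a t].
Proof.
(* [U] refines convergence at infinity, so that inequalities valid for every [n] and the limit of
   [eta] pass to [U]. *)
have [U [FU ooU]] := ultraFilterLemma eventually_filter.
have PU : ProperFilter U by exact: ultra_proper.
have limX a t : exists l : R, X n a t @[n --> U] --> l.
  apply: (@ultra_limit U (fun n => X n a t) (`|a| + (c * `|t - 0| + 1))) => n.
  rewrite -[X n a t](subrK (X n a 0)) addrC X0 (le_trans (ler_normD _ _))// lerD2l.
  by rewrite -{2}(X0 n a) (le_trans (lipX _ _ _ _))// lerD2l.
pose Y a t := projT1 (cid (limX a t)).
have YE a t : X n a t @[n --> U] --> Y a t by exact: projT2 (cid (limX a t)).
have ndY t a b : a <= b -> Y a t <= Y b t.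
  by move=> ab; apply: ler_cvg_to (YE a t) (YE b t) _; apply: nearW => n; exact: ndX.
have etaU : eta n @[n --> U] --> 0 by apply: cvg_trans eta0; exact: cvg_fmap2.
have lipY a s t : `|Y a t - Y a s| <= c * `|t - s|.
  have h : `|X n a t - X n a s| @[n --> U] --> `|Y a t - Y a s|.
    by apply: cvg_norm; exact: cvgB.
  apply: (ler_cvg_to h (g := fun n => c * `|t - s| + eta n)); last first.
    by apply: nearW => n; exact: lipX.
  by rewrite -[X in _ --> X]addr0; apply: cvgD => //; exact: cvg_cst.
have Y0 a : Y a 0 = a.
  apply/eqP; rewrite -subr_eq0 -normr_le0; apply/ler_addgt0Pr => e e0; rewrite add0r.
  have /cvgrPdist_le/(_ _ e0) := YE a 0.
  by move=> /filter_ex[n]; rewrite X0.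
(* An enumeration of the pairs of a countable label and a rational time; codes that decode to
   nothing go to the harmless point [(0, 0)]. *)
pose pt (k : nat) : R * R :=
  if @unpickle ((rat + rat) * rat)%type k is Some i then (label i.1, ratr i.2) else (0, 0).
pose del (j : nat) : R := j.+1%:R^-1.
pose close (j n k : nat) := `|X n (pt k).1 (pt k).2 - Y (pt k).1 (pt k).2| <= del j.
(* Diagonal extraction: finitely many closeness conditions and a lower bound on the index all belong
   to [U], so some index meets them together. *)
have sel j : exists n : nat, (j <= n)%N /\ (forall k, (k <= j)%N -> close j n k).
  have Uj : U [set n | (j <= n)%N] by apply: ooU; exists j.
  have Uk m : U [set n | forall k, (k < m)%N -> close j n k].
    elim: m => [|m IH]; first by apply: filterS filterT.
    have /cvgrPdist_le/(_ (del j)) := YE (pt m).1 (pt m).2.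
    move=> /(_ _)/wrap[|Um]; first by rewrite /del invr_gt0.
    apply: filterS2 IH Um => n h1 h2 k; rewrite ltnS leq_eqVlt => /predU1P[->|/h1//].
    by rewrite /close distrC.
  have [n [h1 h2]] := filter_ex (filterI Uj (Uk j.+1)).
  by exists n; split => // k kj; exact: h2.
have [nn nnP] := choice sel.
have nn_oo : nn j @[j --> \oo] --> \oo.
  move=> A [m _ mA]; exists m => // j /= mj; apply: mA => /=.
  exact: leq_trans mj (nnP j).1.
have cvD i s : X (nn j) (label i) (ratr s) @[j --> \oo] --> Y (label i) (ratr s).
  apply/cvgrPdist_le => e e0.
  near=> j; rewrite distrC.
  have := (nnP j).2 (pickle (i, s)); rewrite /close /pt pickleK /= => h.
  rewrite (le_trans (h _))//.
    by near: j; exists (pickle (i, s)).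
  by apply: ltW; near: j; exact: near_infty_natSinv_lt (PosNum e0).
(* Real times are reached from rational ones through the Lipschitz bounds in time, up to the
   vanishing [eta]. *)
have cvL i t : X (nn j) (label i) t @[j --> \oo] --> Y (label i) t.
  apply/cvgrPdist_le => e e0.
  have c0 : 0 <= c.
    by have := le_trans (normr_ge0 _) (lipY 0 0 1); rewrite subr0 normr1 mulr1.
  (* The distance is chosen so that [c] times it is at most [e / 4]; [c + 1] replaces [c], which may
     be 0. *)
  have [s /andP[s1 s2]] : exists s : rat, t < ratr s < t + e / (4 * (c + 1)).
    by apply: rat_between; rewrite ltrDl divr_gt0// mulr_gt0//; lra.
  have cs : c * `|t - ratr s| <= e / 4.
    rewrite distrC ger0_norm ?subr_ge0 ?ltW//.
    have : ratr s - t <= e / (4 * (c + 1)) by lra.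
    rewrite ler_pdivlMr; last by lra.
    have d0 : 0 <= ratr s - t by lra.
    move: d0; set d := ratr s - t => d0 hd; nra.
  near=> j.
  have h1 : `|Y (label i) (ratr s) - X (nn j) (label i) (ratr s)| <= e / 4.
    near: j; have /cvgrPdist_le := cvD i s; apply; lra.
  have h2 : eta (nn j) <= e / 4.
    near: j; have /cvgrPdist_le : eta (nn j) @[j --> \oo] --> 0.
      exact: cvg_comp nn_oo eta0.
    move=> /(_ (e / 4)) /(_ _)/wrap[|]; first lra.
    by apply: filterS => j; rewrite sub0r normrN; exact: le_trans (ler_norm _).
  have h3 := lipY (label i) (ratr s) t.
  have h4 := lipX (nn j) (label i) (ratr s) t.
  rewrite !ler_norml in h1 h3 h4 *; lra.
exists nn, Y; split => //.
- by move=> j; exact: (nnP j).1.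
(* Atoms are labels, where convergence is already known. The exceptional set therefore only has to
   contain the points without mass at which the limit may jump. *)
- move=> t; exists [set a | (mu [set a] == 0)%E /\ exists r, jump_at (Y ^~ t) r a].
    exact: nonatom_jumps_negligible.
  move=> a /= Na.
  have [/eqP ma|ma] := eqVneq (mu [set a]) 0%E; last first.
    by have [i <-] := atom_label ma; exact: cvL.
  have nj r : ~ jump_at (Y ^~ t) r a.
    by move=> ja; apply: Na; split => //; exists r.
  apply/cvgrPdist_le => e e0.
  have e2 : 0 < e / 2 by lra.
  (* Away from jumps, [a] is squeezed between two rational labels whose limit positions are within
     [e / 2] of [Y a t]; monotonicity in the label transfers their convergence. *)
  have [b [b' [ba ab' fb fb']]] := no_jump (ndY t) nj e2.
  have [q /andP[q1 q2]] := rat_between ba.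
  have [q' /andP[q1' q2']] := rat_between ab'.
  near=> j.
  have h1 : `|Y (ratr q) t - X (nn j) (ratr q) t| <= e / 2.
    by near: j; have /cvgrPdist_le := cvL (inl q) t; apply.
  have h2 : `|Y (ratr q') t - X (nn j) (ratr q') t| <= e / 2.
    by near: j; have /cvgrPdist_le := cvL (inl q') t; apply.
  have h3 := ndX (nn j) t (ltW q2); have h4 := ndX (nn j) t (ltW q1').
  have h5 := ndY t _ _ (ltW q1); have h6 := ndY t _ _ (ltW q2').
  have h7 := ndY t _ _ (ltW q2); have h8 := ndY t _ _ (ltW q1').
  rewrite !ler_norml in h1 h2 *; lra.
Unshelve. all: by end_near. Qed.

End helly.
End monotone_compactness.

(** * Test functions *)

Section calculus.
Context {R : realType}.

Lemma is_derive_continuous (u v : R -> R) :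
  (forall x : R, is_derive x (1 : R) u (v x)) -> continuous u.
Proof.
move=> du x; apply: differentiable_continuous; apply/derivable1_diffP.
by have [] := du x.
Qed.

Lemma mean_value (f f' : R -> R) (x y : R) :
  (forall x : R, is_derive x (1 : R) f (f' x)) ->
  exists z, `|z - x| <= `|y - x| /\ f y - f x = f' z * (y - x).
Proof.
move=> df; have cf := is_derive_continuous df.
have [xy|/ltW yx] := leP x y.
  have [z] := MVT_segment xy (fun z _ => df z) (continuous_subspaceT cf).
  rewrite in_itv/= => /andP[z1 z2] e; exists z; split => //.
  by rewrite !ger0_norm ?subr_ge0// lerD2r.
have [z] := MVT_segment yx (fun z _ => df z) (continuous_subspaceT cf).
rewrite in_itv/= => /andP[z1 z2] e; exists z; split; last first.
  by rewrite -opprB e -mulrN opprB.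
by rewrite distrC [leRHS]distrC !ger0_norm ?subr_ge0// lerD2l lerN2.
Qed.

Lemma bounded_derivative_lipschitz (f f' : R -> R) B :
  (forall x : R, is_derive x (1 : R) f (f' x)) -> (forall x, `|f' x| <= B) ->
  forall x y, `|f x - f y| <= B * `|x - y|.
Proof.
move=> df fB x y; have [z [_ ->]] := mean_value y x df.
by rewrite normrM ler_wpM2r.
Qed.

Lemma derive_outside_support (V : normedModType R) (f : V -> R) (v p : V) :
  ~ closure [set q | f q != 0] p -> 'D_v f p = 0.
Proof.
move=> np; have [v0|v0] := eqVneq v 0.
  rewrite v0 /derive; apply: cvg_lim => //.
  rewrite (_ : (fun h : R => _) = fun=> 0); first exact: cvg_cst.
  by apply/funext => h; rewrite /= scaler0 add0r subrr scaler0.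
rewrite (@near_eq_derive _ _ _ f (cst 0))//; first exact: derive_cst.
have : nbhs p (~` closure [set q | f q != 0]).
  by apply: open_nbhs_nbhs; split => //; rewrite openC; exact: closed_closure.
apply: filterS => q nq /=; apply: contrapT => /eqP fq; apply: nq.
exact: subset_closure.
Qed.

Section smooth.
Variable phi : R * R -> R.
Hypothesis sphi : smooth2 phi.

Lemma smooth2_partial w : smooth2 (partial w phi).
Proof. by move=> w'; rewrite /partial -foldr_cat; exact: sphi. Qed.

Lemma smooth2_dx (x t : R) :
  is_derive x (1 : R) (fun x => phi (x, t)) (dx phi (x, t)).
Proof.
have [_ /(_ (x, t))[dphi _]] := sphi [::].
have e : (fun h : R => h^-1 *: (((fun x => phi (x, t)) \o shift x) (h *: (1 : R)) - phi (x, t)))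
   = (fun h : R => h^-1 *: ((phi \o shift (x, t)) (h *: (1, 0)) - phi (x, t))).
  apply/funext => h /=; congr (_ *: (phi _ - _)).
  by apply/pair_equal_spec; split => //=; rewrite scaler0 add0r.
split; first by rewrite /derivable e.
by rewrite /derive e.
Qed.

Lemma smooth2_dt (x t : R) :
  is_derive t (1 : R) (fun t => phi (x, t)) (dt phi (x, t)).
Proof.
have [_ /(_ (x, t))[_ dphi]] := sphi [::].
have e : (fun h : R => h^-1 *: (((fun t => phi (x, t)) \o shift t) (h *: (1 : R)) - phi (x, t)))
   = (fun h : R => h^-1 *: ((phi \o shift (x, t)) (h *: (0, 1)) - phi (x, t))).
  apply/funext => h /=; congr (_ *: (phi _ - _)).
  by apply/pair_equal_spec; split => //=; rewrite scaler0 add0r.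
split; first by rewrite /derivable e.
by rewrite /derive e.
Qed.

Lemma smooth2_continuous : continuous phi.
Proof. by have [] := sphi [::]. Qed.

End smooth.

(** Applying the mean value theorem in the two variables, in either order, equates the second
    difference over a square of side [h] with [h * h] times each mixed derivative at some point of
    that square; continuity then compares both at [(x, t)]. *)
Lemma smooth2_schwarz (phi : R * R -> R) : smooth2 phi ->
  dt (dx phi) = dx (dt phi).
Proof.
move=> sphi; apply/funext => -[x t].
have sdx : smooth2 (dx phi) by exact: (@smooth2_partial phi sphi [:: false]).
have sdt : smooth2 (dt phi) by exact: (@smooth2_partial phi sphi [:: true]).
have sdtx : smooth2 (dt (dx phi)).
  exact: (@smooth2_partial phi sphi [:: true; false]).
have sdxt : smooth2 (dx (dt phi)).
  exact: (@smooth2_partial phi sphi [:: false; true]).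
apply/eqP; rewrite -subr_eq0 -normr_le0; apply/ler_addgt0Pr => e e0; rewrite add0r.
have e2 : 0 < e / 2 by lra.
have /cvgrPdist_le/(_ _ e2) c1 := @smooth2_continuous _ sdtx (x, t).
have /cvgrPdist_le/(_ _ e2) c2 := @smooth2_continuous _ sdxt (x, t).
(* The balls are open, so half the radius keeps the closed square of side [h] inside. *)
have [r /= r0 rP] := (nbhs_ballP _ _).1 (filterI c1 c2).
pose h := r / 2; have h0 : 0 < h by rewrite /h; lra.
have close y s : `|y - x| <= h -> `|s - t| <= h ->
   `|dt (dx phi) (x, t) - dt (dx phi) (y, s)| <= e / 2 /\
   `|dx (dt phi) (x, t) - dx (dt phi) (y, s)| <= e / 2.
  move=> yh sh; apply: rP; split; rewrite /ball /= distrC; rewrite /h in yh sh; lra.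
pose D := phi (x + h, t + h) - phi (x + h, t) - (phi (x, t + h) - phi (x, t)).
have hh : x + h - x = h /\ t + h - t = h by split; ring.
have [y [yh ye]] : exists y, `|y - x| <= h /\
    D = (dx phi (y, t + h) - dx phi (y, t)) * h.
  have du (z : R) : is_derive z (1 : R) (fun z => phi (z, t + h) - phi (z, t))
      (dx phi (z, t + h) - dx phi (z, t)).
    by apply: is_deriveB; exact: smooth2_dx.
  have [y [y1 y2]] := mean_value x (x + h) du.
  move: y1 y2; rewrite hh.1 (gtr0_norm h0) => y1 y2; exists y; split => //.
have [s [sh se]] := mean_value t (t + h) (smooth2_dt sdx y).
have [s' [sh' se']] : exists s, `|s - t| <= h /\
    D = (dt phi (x + h, s) - dt phi (x, s)) * h.
  have du (z : R) : is_derive z (1 : R) (fun z => phi (x + h, z) - phi (x, z))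
      (dt phi (x + h, z) - dt phi (x, z)).
    by apply: is_deriveB; exact: smooth2_dt.
  have [y' [y1 y2]] := mean_value t (t + h) du.
  move: y1 y2; rewrite hh.2 (gtr0_norm h0) => y1 y2; exists y'; split => //.
  by rewrite -y2 /D; ring.
have [y' [yh' ye']] := mean_value x (x + h) (fun z => smooth2_dx sdt z s').
rewrite hh.2 (gtr0_norm h0) in sh se; rewrite hh.1 (gtr0_norm h0) in yh' ye'.
have [k1 _] := close y s yh sh; have [_ k2] := close y' s' yh' sh'.
rewrite se in ye; rewrite ye' in se'.
have E : dt (dx phi) (y, s) = dx (dt phi) (y', s').
  move: ye se'; move: (dt (dx phi) (y, s)) (dx (dt phi) (y', s')) => a b -> ab.
  by apply: (mulIf (lt0r_neq0 h0)); apply: (mulIf (lt0r_neq0 h0)).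
move: k1 k2; rewrite E => {E}.
move: (dt (dx phi) (x, t)) (dx (dt phi) (x, t)) (dx (dt phi) (y', s')).
move=> a b c k1 k2; rewrite (le_trans (ler_distD c _ _))// [`|c - b|]distrC; lra.
Qed.

Section spacetime_test_functions.
Variables (T : \bar R) (phi : R * R -> R).
Hypothesis tphi : spacetime_test_function T phi.

Let sphi : smooth2 phi. Proof. by case: tphi. Qed.

Lemma test_outside w p : ~ closure [set q | phi q != 0] p -> partial w phi p = 0.
Proof.
have sub : [set q | partial w phi q != 0] `<=` closure [set q | phi q != 0].
  elim: w => [|b w IH] q /= fq; first exact: subset_closure.
  apply: contrapT => nq; have {IH nq} : ~ closure [set q | partial w phi q != 0] q.
    by move=> /(closureS IH); rewrite -(closure_id _).1//; exact: closed_closure.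
  by move=> /derive_outside_support h; move: fq; case: b; rewrite [_ q]h eqxx.
by move=> np; apply: contrapT => /eqP h; apply: np; exact: sub.
Qed.

Lemma test_support : exists2 K, 0 <= K & forall w x t,
  K < `|x| \/ K < `|t| -> partial w phi (x, t) = 0.
Proof.
case: tphi => _ /compact_bounded[M [_ hM]] _.
exists (`|M| + 1); first by rewrite addr_ge0.
move=> w x t h; apply: test_outside => c.
have := hM (`|M| + 1) _ (x, t) c; rewrite ltr_pwDr ?ler_norm//.
rewrite /Num.norm /= => /(_ isT).
by rewrite ge_max => /andP[h1 h2]; move: h; rewrite !ltNge h1 h2 => -[].
Qed.

Lemma test_bounded w : exists B, forall p, `|partial w phi p| <= B.
Proof.
case: tphi => _ cs _.
have cp : compact (partial w phi @` closure [set q | phi q != 0]).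
  apply: continuous_compact => //; apply: continuous_subspaceT.
  exact: (sphi w).1.
have [M [_ hM]] := compact_bounded cp.
exists (`|M| + 1) => p; have [pc|npc] := pselect (closure [set q | phi q != 0] p).
  by apply: hM; [rewrite ltr_pwDr ?ler_norm|exists p].
by rewrite test_outside// normr0 addr_ge0.
Qed.

Lemma test_dx w x t : is_derive x (1 : R) (fun x => partial w phi (x, t))
  (partial (false :: w) phi (x, t)).
Proof. exact: (smooth2_dx (@smooth2_partial phi sphi w)). Qed.

Lemma test_dt w x t : is_derive t (1 : R) (fun t => partial w phi (x, t))
  (partial (true :: w) phi (x, t)).
Proof. exact: (smooth2_dt (@smooth2_partial phi sphi w)). Qed.

Lemma test_lipschitz_x w : exists L, forall t x y,
  `|partial w phi (x, t) - partial w phi (y, t)| <= L * `|x - y|.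
Proof.
have [B hB] := test_bounded (false :: w); exists B => t.
apply: (@bounded_derivative_lipschitz (fun x => partial w phi (x, t))
  (fun x => partial (false :: w) phi (x, t))) => [x|x]; first exact: test_dx.
exact: hB.
Qed.

Lemma test_lipschitz_t w : exists L, forall x t s,
  `|partial w phi (x, t) - partial w phi (x, s)| <= L * `|t - s|.
Proof.
have [B hB] := test_bounded (true :: w); exists B => x.
apply: (@bounded_derivative_lipschitz (fun t => partial w phi (x, t))
  (fun t => partial (true :: w) phi (x, t))) => [t|t]; first exact: test_dt.
exact: hB.
Qed.

Lemma test_bmeas w t : @bmeas R _ (measurableTypeR R) (fun x => partial w phi (x, t)).
Proof.
split.
  apply: continuous_measurable_fun.
  exact: (is_derive_continuous (fun x => test_dx w x t)).
by have [B hB] := test_bounded w; exists B => x; exact: hB.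
Qed.

(** The increment is split along the path from [(x, t)] through [(x, t')] to [(x', t')]; Lipschitz
    bounds on the first derivatives give the quadratic remainder. *)
Lemma test_taylor : exists C, forall x t x' t',
  `|phi (x', t') - phi (x, t) - (dt phi (x, t) * (t' - t) + dx phi (x, t) * (x' - x))|
  <= C * (`|x' - x| + `|t' - t|) ^+ 2.
Proof.
have [A hA] := test_lipschitz_x [:: false].
have [B hB] := test_lipschitz_t [:: false].
have [C hC] := test_lipschitz_t [:: true].
exists (`|A| + `|B| + `|C|) => x t x' t'.
have [z [z1 z2]] := mean_value x x' (fun z => test_dx [::] z t').
have [s [s1 s2]] := mean_value t t' (fun s => test_dt [::] x s).
have {}hA := hA t' z x; have {}hB := hB x t' t; have {}hC := hC x s t.
move: z1 z2 s1 s2 hA hB hC => /=.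
move: (phi (x', t')) (phi (x, t')) (phi (x, t)) (dx phi (z, t')) (dx phi (x, t'))
  (dx phi (x, t)) (dt phi (x, s)) (dt phi (x, t)) => p1 p2 p3 a1 a2 a3 b1 b2.
move=> z1 z2 s1 s2 hA hB hC.
have -> : p1 - p3 - (b2 * (t' - t) + a3 * (x' - x)) =
  (a1 - a2) * (x' - x) + ((a2 - a3) * (x' - x) + (b1 - b2) * (t' - t)).
  rewrite (_ : p1 - p3 = (p1 - p2) + (p2 - p3)); last by ring.
  by rewrite z2 s2; ring.
have nA := ler_norm A; have nB := ler_norm B; have nC := ler_norm C.
have A0 := normr_ge0 A; have B0 := normr_ge0 B; have C0 := normr_ge0 C.
rewrite (le_trans (ler_normD _ _))//.
rewrite (le_trans (lerD (lexx _) (ler_normD _ _)))// !normrM.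
have d0 := normr_ge0 (x' - x); have e0 := normr_ge0 (t' - t).
have f0 := normr_ge0 (z - x); have g0 := normr_ge0 (s - t).
have k1 := normr_ge0 (a1 - a2); have k2 := normr_ge0 (a2 - a3).
have k3 := normr_ge0 (b1 - b2).
move: (`|x' - x|) (`|t' - t|) (`|z - x|) (`|s - t|) (`|a1 - a2|) (`|a2 - a3|)
  (`|b1 - b2|) d0 e0 f0 g0 k1 k2 k3 z1 s1 hA hB hC.
move=> d e f g u v r d0 e0 f0 g0 u0 v0 r0 fd ge hA hB hC.
have u1 : u * d <= `|A| * d ^+ 2.
  rewrite expr2 mulrA ler_wpM2r// (le_trans hA)// (le_trans (ler_wpM2r f0 nA))//.
  exact: ler_wpM2l.
have v1 : v * d <= `|B| * (e * d).
  by rewrite mulrA ler_wpM2r// (le_trans hB)// ler_wpM2r.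
have r1 : r * e <= `|C| * e ^+ 2.
  rewrite expr2 mulrA ler_wpM2r// (le_trans hC)// (le_trans (ler_wpM2r g0 nC))//.
  exact: ler_wpM2l.
have de : 0 <= d * e by exact: mulr_ge0.
have w1 : d ^+ 2 <= (d + e) ^+ 2 by rewrite lerXn2r ?nnegrE ?addr_ge0 ?lerDl.
have w2 : e * d <= (d + e) ^+ 2 by rewrite sqrrD; nra.
have w3 : e ^+ 2 <= (d + e) ^+ 2 by rewrite lerXn2r ?nnegrE ?addr_ge0 ?lerDr.
rewrite !mulrDl addrA !lerD//.
- exact: le_trans u1 (ler_wpM2l _ _).
- exact: le_trans v1 (ler_wpM2l _ _).
- exact: le_trans r1 (ler_wpM2l _ _).
Qed.

(** [mCH_form] differentiates in time last, while the Helmholtz identity is applied to the test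
    function [dt phi]. *)
Lemma test_dtdxdx : dt (dx (dx phi)) = dx (dx (dt phi)).
Proof.
rewrite (@smooth2_schwarz (dx phi)); last exact: (@smooth2_partial phi sphi [:: false]).
by rewrite smooth2_schwarz.
Qed.

End spacetime_test_functions.

Section joint_measurability.
Context d (T : measurableType d).
Notation RT := (measurableTypeR R).

(* The Lipschitz bound makes [f] the supremum over rational [s] of the jointly
   measurable functions [f (a, s) - c |t - s|]. *)
Lemma measurable_lipschitz_snd (f : T -> R -> R) (c : R) :
  (forall s, measurable_fun setT (f ^~ s : T -> RT)) ->
  (forall a s t, `|f a t - f a s| <= c * `|t - s|) ->
  measurable_fun setT (fun z : T * RT => f z.1 z.2 : RT).
Proof.
move=> mf fL; move=> _; apply: (measurability _ (RGenOInfty.measurableE R)) => //.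
move=> _ [_ [r ->] <-]; rewrite setTI.
pose h (s : rat) (z : T * RT) : RT := f z.1 (ratr s) - c * `|z.2 - ratr s|.
have mh s : measurable_fun setT (h s).
  apply: measurable_funB; first exact: (measurableT_comp (mf _)).
  apply: measurable_funM => //; apply: measurableT_comp => //.
  by apply: measurable_funB => //; exact: measurable_cst.
have -> : (fun z : T * RT => f z.1 z.2) @^-1` `]r, +oo[ =
    \bigcup_s (h s @^-1` `]r, +oo[).
  apply/seteqP; split => [[a t]|[a t] [s _]] /=; rewrite !in_itv/= !andbT /h/=.
    move=> rf.
    have c0 : 0 <= c.
      by have := le_trans (normr_ge0 _) (fL a 0 1); rewrite subr0 normr1 mulr1.
    have [s /andP[s1 s2]] : exists s : rat,
        t < ratr s < t + (f a t - r) / (2 * (c + 1)).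
      by apply: rat_between; rewrite ltrDl divr_gt0 ?subr_gt0// mulr_gt0//; lra.
    exists s => //=; rewrite in_itv/= andbT.
    have : ratr s - t < (f a t - r) / (2 * (c + 1)) by lra.
    rewrite ltr_pdivlMr; last by lra.
    have := fL a t (ratr s); rewrite distrC => /(le_trans (ler_norm _)).
    rewrite distrC [`|t - _|]distrC ger0_norm; last by rewrite subr_ge0 ltW.
    have : 0 < ratr s - t by lra.
    move: (ratr s - t) (f a (ratr s)) (f a t) rf => u v w rw u0 h1 h2; nra.
  move=> h1; have := fL a t (ratr s) => /ler_normlP[h2 h3].
  rewrite [`|t - _|]distrC in h1; lra.
by apply: bigcupT_measurable_rat => s; rewrite -[X in measurable X]setTI; exact: mh.
Qed.

End joint_measurability.
End calculus.

(** * The limit flow *)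

Section limits.
Context {R : realType}.

Lemma cvg_maxr (u v : nat -> R) (a b : R) : u n @[n --> \oo] --> a ->
  v n @[n --> \oo] --> b -> Num.max (u n) (v n) @[n --> \oo] --> Num.max a b.
Proof.
move=> ua vb; rewrite maxr_absE; under eq_fun do rewrite maxr_absE.
apply: cvgM; last exact: cvg_cst.
by apply: cvgD; [exact: cvgD|apply: cvg_norm; exact: cvgB].
Qed.

Lemma cvg_minr (u v : nat -> R) (a b : R) : u n @[n --> \oo] --> a ->
  v n @[n --> \oo] --> b -> Num.min (u n) (v n) @[n --> \oo] --> Num.min a b.
Proof.
move=> ua vb; rewrite minr_absE; under eq_fun do rewrite minr_absE.
apply: cvgM; last exact: cvg_cst.
by apply: cvgB; [exact: cvgD|apply: cvg_norm; exact: cvgB].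
Qed.

Lemma cvg_med (u v w : nat -> R) (a b c : R) : u n @[n --> \oo] --> a ->
  v n @[n --> \oo] --> b -> w n @[n --> \oo] --> c ->
  med (u n) (v n) (w n) @[n --> \oo] --> med a b c.
Proof.
move=> ua vb wc; apply: cvg_maxr; first exact: cvg_minr.
by apply: cvg_minr => //; exact: cvg_maxr.
Qed.

Lemma cvg_expRN_spread (u v w : nat -> R) (a b c : R) : u n @[n --> \oo] --> a ->
  v n @[n --> \oo] --> b -> w n @[n --> \oo] --> c ->
  expR (- spread (u n) (v n) (w n)) @[n --> \oo] --> expR (- spread a b c).
Proof.
move=> ua vb wc.
apply: (@cvg_comp _ _ _ (fun n => - spread (u n) (v n) (w n)) expR _ _ _ _ (@continuous_expR R _)).
apply: cvgN; apply: cvgB.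
  by apply: cvg_maxr => //; exact: cvg_maxr.
by apply: cvg_minr => //; exact: cvg_minr.
Qed.

Lemma cvg_continuous2 (f : R * R -> R) (u v : nat -> R) (a b : R) : continuous f ->
  u n @[n --> \oo] --> a -> v n @[n --> \oo] --> b ->
  f (u n, v n) @[n --> \oo] --> f (a, b).
Proof.
move=> cf ua vb; apply: (@cvg_comp _ _ _ (fun n => (u n, v n)) f _ _ _ _ (cf (a, b))).
exact: (@cvg_pair _ _ _ _ (nbhs a) (nbhs b) _ _ _ u v ua vb).
Qed.

End limits.

(** * Riemann sums as integrals of step functions *)

Section step_functions.
Context {R : realType}.
Notation leb := (@lebesgue_measure R).

(** The sum over Euler steps becomes a time integral, to which dominated convergence applies
    although the grid changes with [n]. *)
Definition step_fun (g : nat -> R) (h : R) (m : nat) (t : R) : R :=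
  \sum_(k < m) g k * \1_(`[k%:R * h, k.+1%:R * h[%classic : set R) t.

Lemma step_funE g h m t : 0 < h -> 0 <= t < m%:R * h ->
  step_fun g h m t = g (Num.truncn (t / h)).
Proof.
move=> h0 /andP[t0 tm]; rewrite /step_fun.
have th0 : 0 <= t / h by rewrite divr_ge0// ltW.
have km : (Num.truncn (t / h) < m)%N by rewrite truncn_lt_nat// ltr_pdivrMr.
rewrite (bigD1 (Ordinal km))//= big1 ?addr0.
  rewrite indicE mem_set ?mulr1//= in_itv/=.
  by have := truncn_itv th0; rewrite ler_pdivlMr// ltr_pdivrMr.
move=> k /negP kE; rewrite indicE memNset ?mulr0//= in_itv/= => /andP[k1 k2].
apply: kE; apply/eqP/val_inj => /=; apply/esym/truncn_def.
by rewrite ler_pdivlMr// ltr_pdivrMr// k1.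
Qed.

Lemma bmeas_step_term (c a b : R) : @bmeas R _ (measurableTypeR R)
  (fun t => c * \1_(`[a, b[%classic : set R) t).
Proof. by apply: bmeasM; [exact: bmeas_cst|exact: bmeas_indic]. Qed.

Lemma bmeas_step_fun g h m : @bmeas R _ (measurableTypeR R) (step_fun g h m).
Proof.
rewrite /step_fun; elim: m => [|m IH].
  by under eq_fun do rewrite big_ord0; exact: bmeas_cst.
under eq_fun do rewrite big_ord_recr/=.
by apply: bmeasD => //; exact: bmeas_step_term.
Qed.

Lemma integral_step_fun g h m : 0 < h ->
  \int[leb]_(t in `[0, (m%:R * h)[) step_fun g h m t = \sum_(k < m) h * g k.
Proof.
move=> h0; have fin : (leb [set` `[0%R, (m%:R * h)%R[] < +oo)%E.
  by rewrite lebesgue_measure_itv/=; case: ifP; rewrite -?EFinB ltry.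
transitivity (\sum_(k < m) \int[leb]_(t in `[0, (m%:R * h)[)
    (g k * \1_(`[k%:R * h, k.+1%:R * h[%classic : set R) t)).
  pose f (k : nat) (t : measurableTypeR R) : R :=
    g k * \1_(`[k%:R * h, k.+1%:R * h[%classic : set R) t.
  have bf k : bmeas (f k) by exact: bmeas_step_term.
  exact: (bmeas_integral_sum (mu := leb) _ fin m bf).
apply: eq_bigr => k _; rewrite bmeas_integralZ//; last exact: bmeas_indic.
rewrite mulrC; congr (_ * _); rewrite /Rintegral integral_indic//.
rewrite setIidl; last first.
  move=> t /=; rewrite !in_itv/= => /andP[t1 t2]; apply/andP; split.
    by apply: le_trans t1; rewrite mulr_ge0// ltW.
  by apply: lt_le_trans t2 _; rewrite ler_pM2r// ler_nat.
rewrite /= lebesgue_measure_itv/= lte_fin ltr_pM2r// ltr_nat ltnSn -EFinB/=.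
by rewrite -mulrBl -natr1 addrAC subrr add0r mul1r.
Qed.

End step_functions.

(** * Rate of change of test integrals along a flow *)

Section flow_rate.
Context {R : realType} d (T : measurableType d).
Notation RT := (measurableTypeR R).
Variables (mu : {finite_measure set T -> \bar R}) (sg : T -> R).
Hypothesis bsg : bmeas sg.
Notation I1 := (I1 mu sg).
Notation I3 := (I3 mu sg).

(** The time derivative that the limit dynamics prescribe for [I1 (fun a => phi (Y a t, t))]. No
    velocity occurs in it, because the limiting one would be discontinuous at collisions. *)
Definition flow_rate (Y : T -> R -> R) (phi : R * R -> R) (t : R) : R :=
  I1 (fun a => dt phi (Y a t, t)) +
  6^-1 * I3 (fun a b c => expR (- spread (Y a t) (Y b t) (Y c t)) *
                          dx phi (med (Y a t) (Y b t) (Y c t), t)).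

Lemma flow_rate0 Y phi t : (forall x, dt phi (x, t) = 0) ->
  (forall x, dx phi (x, t) = 0) -> flow_rate Y phi t = 0.
Proof.
move=> dt0 dx0; rewrite /flow_rate.
rewrite (@eq_I1 _ _ _ _ _ _ (fun a => 0 * 0)); last by move=> a; rewrite mul0r.
rewrite (@eq_I3 _ _ _ _ _ _ (fun a b c => 0 * 0)); last first.
  by move=> a b b'; rewrite dx0 mulr0 mul0r.
rewrite I1Z// ?I3Z//; [by rewrite !mul0r mulr0 addr0|exact: bmeas_cst|exact: bmeas_cst].
Qed.

(** Measurability for the product sigma-algebra is deduced from measurability in [x] and a Lipschitz
    bound in [t]. *)
Lemma bmeas_test2 T' phi w : spacetime_test_function T' phi ->
  @bmeas R _ (RT * RT)%type (partial w phi).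
Proof.
move=> tphi; have [L hL] := test_lipschitz_t tphi w.
have [B hB] := test_bounded tphi w; split; last by exists B.
have := measurable_lipschitz_snd (f := fun x t => partial w phi (x, t) : R)
  (fun t => (test_bmeas tphi w t).1) (fun x s t => hL x t s).
by congr measurable_fun; apply/funext => -[].
Qed.

Lemma bmeas_flow_rate T0 (Y : T -> R -> R) phi : spacetime_test_function T0 phi ->
  measurable_fun setT (fun z : T * RT => Y z.1 z.2 : RT) ->
  @bmeas R _ RT (flow_rate Y phi).
Proof.
move=> tphi mY.
have bt := bmeas_test2 [:: true] tphi; have bx := bmeas_test2 [:: false] tphi.
have mYi d' (T' : measurableType d') (f : T' -> T) (g : T' -> RT) : measurable_fun setT f ->
    measurable_fun setT g -> measurable_fun setT (fun z => Y (f z) (g z) : RT).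
  move=> mf mg; apply: (measurableT_comp mY (g := fun z => (f z, g z))).
  exact: measurable_fun_pair.
apply: bmeasD.
  apply: (bmeas_int2 measurableT (finite_measureT mu)
    (f := fun z : RT * T => sg z.2 * dt phi (Y z.2 z.1, z.1))).
  apply: bmeasM; first exact: (bmeas_comp bsg).
  apply: (bmeas_comp bt); apply: measurable_fun_pair => //; exact: mYi.
apply: bmeasM; first exact: bmeas_cst.
pose F (z : RT * (T * T * T)) : R := sg z.2.1.1 * sg z.2.1.2 * sg z.2.2 *
  (expR (- spread (Y z.2.1.1 z.1) (Y z.2.1.2 z.1) (Y z.2.2 z.1)) *
   dx phi (med (Y z.2.1.1 z.1) (Y z.2.1.2 z.1) (Y z.2.2 z.1), z.1)).
apply: (bmeas_int2 measurableT (finite_measureT (fprod (fprod mu mu) mu)) (f := F)).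
have p1 : measurable_fun setT (fun z : RT * (T * T * T) => z.2.1.1).
  by apply: measurableT_comp => //; exact: measurableT_comp.
have p2 : measurable_fun setT (fun z : RT * (T * T * T) => z.2.1.2).
  by apply: measurableT_comp => //; exact: measurableT_comp.
have p3 : measurable_fun setT (fun z : RT * (T * T * T) => z.2.2).
  exact: measurableT_comp.
have y1 := mYi _ _ _ _ p1 measurable_fst; have y2 := mYi _ _ _ _ p2 measurable_fst.
have y3 := mYi _ _ _ _ p3 measurable_fst.
apply: bmeasM.
  by apply: bmeasM; [apply: bmeasM|]; apply: (bmeas_comp bsg).
apply: bmeasM.
  split.
    apply: (measurableT_comp (f := expR)) => //; apply: measurableT_comp => //.
    apply: measurable_funB.
      by apply: measurable_maxr => //; exact: measurable_maxr.
    by apply: measurable_minr => //; exact: measurable_minr.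
  exists 1 => z; rewrite ger0_norm ?expR_ge0// expR_le1 oppr_le0; exact: spread_ge0.
apply: (bmeas_comp bx); apply: measurable_fun_pair => //.
apply: measurable_maxr; first exact: measurable_minr.
by apply: measurable_minr => //; exact: measurable_maxr.
Qed.

End flow_rate.

(** * Passage to the limit in the Euler scheme *)

Section flow.
Context {R : realType}.
Notation RT := (measurableTypeR R).
Notation leb := (@lebesgue_measure R).
Variables (mu : {finite_measure set RT -> \bar R}) (sg : RT -> R).
Hypothesis bsg : bmeas sg.
Hypothesis sg1 : forall a, `|sg a| <= 1.
Notation M := (fine (mu setT)).
Notation I1 := (I1 mu sg).
Notation I3 := (I3 mu sg).
Notation c := (2^-1 * M ^+ 2).

Let M0 : 0 <= M. Proof. by rewrite fine_ge0. Qed.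
Let c0 : 0 <= c. Proof. by rewrite mulr_ge0 ?exprn_ge0. Qed.

(** Rounding both times down to the grid increases their distance by at most one step; negative
    times are all rounded to 0. *)
Let trunc_dist (h s t : R) : 0 < h ->
  `|(Num.truncn (t / h))%:R - (Num.truncn (s / h))%:R| * h <= `|t - s| + h.
Proof.
move=> h0; wlog st : s t / s <= t.
  move=> hw; have [st|/ltW ts] := leP s t; first exact: hw.
  by rewrite distrC [`|t - s|]distrC; exact: hw.
have sth : s / h <= t / h by rewrite ler_pM2r ?invr_gt0.
have := le_truncn sth; set k := Num.truncn (t / h); set l := Num.truncn (s / h) => lk.
rewrite !ger0_norm ?subr_ge0 ?ler_nat// mulrBl.
have [t0|t0] := leP 0 t; last first.
  have -> : k = 0%N.
    rewrite /k truncn_floor; case: ifP => //.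
    by rewrite pmulr_lge0 ?invr_gt0// leNgt t0.
  have lh : 0 <= l%:R * h by rewrite mulr_ge0// ltW.
  by rewrite mul0r sub0r; lra.
have : k%:R <= t / h by rewrite truncn_le divr_ge0// ltW.
rewrite ler_pdivlMr// => kt.
have lh : 0 <= l%:R * h by rewrite mulr_ge0// ltW.
have [s0|s0] := leP 0 s; last by lra.
have /andP[_] : (l%:R <= s / h < l.+1%:R) by apply: truncn_itv; rewrite divr_ge0// ltW.
by rewrite ltr_pdivrMr// -natr1 mulrDl mul1r => ?; lra.
Qed.

Let e (n : nat) : R := n.+1%:R^-1.
(** The first summand exceeds the Lipschitz constant of the velocity, so that [euler_mono] applies;
    [.+1 + n] gives [h n <= e n]. An integer number of steps per unit of time makes every integer
    time a grid point. *)
Let N (n : nat) : nat := ((Num.truncn (c * (2 + 6 / e n))).+1 + n)%N.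
Let h (n : nat) : R := (N n)%:R^-1.
Let X (n : nat) (a t : R) : R := euler mu sg (e n) (h n) id (Num.truncn (t / h n)) a.

Let e0 n : 0 < e n. Proof. by rewrite invr_gt0. Qed.
Let h0 n : 0 < h n. Proof. by rewrite invr_gt0 ltr0n /N addSn. Qed.
Let hE n : (N n)%:R * h n = 1.
Proof. by rewrite divff// pnatr_eq0 /N addSn. Qed.

Let hlip n : h n * (c * (2 + 6 / e n)) <= 1.
Proof.
rewrite mulrC ler_pdivrMr ?mul1r; last by rewrite ltr0n /N addSn.
rewrite /N natrD; apply: le_trans (_ : _ <= (Num.truncn (c * (2 + 6 / e n))).+1%:R) _.
  by apply/ltW/truncnS_gt.
by rewrite lerDl.
Qed.

Let ch1 n : c * h n <= 1.
Proof.
apply: le_trans (hlip n); rewrite mulrC ler_wpM2l ?(ltW (h0 n))// ler_peMr//.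
have : 0 <= 6 / e n by rewrite divr_ge0// ltW.
lra.
Qed.

Let hn n : h n <= e n.
Proof. by rewrite lef_pV2 ?posrE ?ltr0n ?addSn// ler_nat /N addSn ltnS leq_addl. Qed.

Let e_cvg : e n @[n --> \oo] --> 0.
Proof. exact: cvg_harmonic. Qed.

Let h_cvg : h n @[n --> \oo] --> 0.
Proof.
apply: (squeeze_cvgr _ (cvg_cst 0) e_cvg).
by apply: nearW => n; rewrite hn ltW.
Qed.

Let mid : measurable_fun setT (id : RT -> RT). Proof. by []. Qed.

Let X0 n a : X n a 0 = a.
Proof. by rewrite /X mul0r truncn0. Qed.

Let ndX n t a b : a <= b -> X n a t <= X n b t.
Proof. by move=> ab; apply: euler_mono => //; exact: ltW. Qed.

(** Sampling on the grid costs an additive [c * h n], which serves as [eta n] in [helly_selection];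
    [ch1] gives the uniform bound it asks for. *)
Let lipX n a s t : `|X n a t - X n a s| <= c * `|t - s| + c * h n.
Proof.
rewrite -mulrDr; apply: le_trans (ler_wpM2l c0 (trunc_dist s t (h0 n))).
have D k m : `|euler mu sg (e n) (h n) id (k + m) a - euler mu sg (e n) (h n) id k a|
    <= c * (m%:R * h n).
  apply: le_trans (euler_dist mu bsg sg1 (e0 n) (ltW (h0 n)) mid k m a) _.
  by rewrite [leLHS](_ : _ = c * (m%:R * h n))//; ring.
rewrite /X; set k := Num.truncn (t / h n); set l := Num.truncn (s / h n).
have [lk|/ltnW kl] := leqP l k.
  rewrite [`|k%:R - l%:R|]ger0_norm ?subr_ge0 ?ler_nat// -natrB//.
  by have := D l (k - l)%N; rewrite subnKC.
rewrite distrC [`|k%:R - l%:R|]distrC.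
rewrite [`|l%:R - k%:R|]ger0_norm ?subr_ge0 ?ler_nat// -natrB//.
by have := D k (l - k)%N; rewrite subnKC.
Qed.

(** [Num.truncn] is 0 on negative numbers, hence the [max] in the limit. *)
Let grid_cvg (t : R) : (Num.truncn (t / h n))%:R * h n @[n --> \oo] --> Num.max 0 t.
Proof.
apply/cvgrPdist_le => r r0; near=> n.
have hr : h n <= r.
  near: n; have /cvgrPdist_le/(_ _ r0) := h_cvg.
  by apply: filterS => n; rewrite sub0r normrN gtr0_norm.
apply: (le_trans _ hr); have [t0|/ltW t0] := leP 0 t; last first.
  have -> : Num.truncn (t / h n) = 0%N.
    have := @le_truncn R (t / h n) 0; rewrite truncn0 leqn0 => /(_ _)/eqP-> //.
    by rewrite pmulr_lle0 ?invr_gt0.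
  by rewrite mul0r subrr normr0 ltW.
have /andP[] := truncn_itv (divr_ge0 t0 (ltW (h0 n))).
rewrite ler_pdivlMr// ltr_pdivrMr// -natr1 mulrDl mul1r => k1 k2.
by rewrite ger0_norm ?subr_ge0//; lra.
Unshelve. all: by end_near. Qed.

Theorem flow_exists : exists Y : R -> R -> R,
  [/\ (forall t a b, a <= b -> Y a t <= Y b t),
      (forall a s t, `|Y a t - Y a s| <= c * `|t - s|),
      (forall a, Y a 0 = a) &
      forall phi, spacetime_test_function +oo%E phi ->
        \int[leb]_(t in time_domain +oo%E) flow_rate mu sg Y phi t =
        - I1 (fun a => phi (a, 0))].
Proof.
have eta0 : c * h n @[n --> \oo] --> 0.
  by rewrite -[X in _ --> X](mulr0 c); apply: cvgM => //; exact: cvg_cst.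
have [nn [Y [nnj ndY lipY Y0 cvY]]] := helly_selection mu ndX lipX X0 ch1 eta0.
exists Y; split => // phi tphi.
have nn_oo : nn j @[j --> \oo] --> \oo.
  move=> A [m _ mA]; exists m => // j /= mj; apply: mA => /=.
  exact: leq_trans mj (nnj j).
pose phit x t := dt phi (x, t); pose phix x t := dx phi (x, t).
have [Bt hBt] := test_bounded tphi [:: true].
have [Bx hBx] := test_bounded tphi [:: false].
have [C taylor] := test_taylor tphi.
have [L phixL] := test_lipschitz_x tphi [:: false].
have [K K0 Ksupp] := test_support tphi.
have bphi t : @bmeas R _ RT (fun x => phi (x, t)) by exact: (test_bmeas tphi [::]).
have bphix t : @bmeas R _ RT (phix ^~ t) by exact: (test_bmeas tphi [:: false]).
have bphit t : @bmeas R _ RT (phit ^~ t) by exact: (test_bmeas tphi [:: true]).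
have cphit : continuous (dt phi) by case: tphi => /(_ [:: true])[].
have cphix : continuous (dx phi) by case: tphi => /(_ [:: false])[].
(* An integer final time lies on every grid, and being larger than [K] it makes the terminal term of
   the telescoped weak form vanish. *)
pose T0 := (Num.truncn K).+1.
have KT : K < T0%:R by exact: truncnS_gt.
have T0p : 0 < T0%:R :> R by rewrite ltr0n.
have mY t : measurable_fun setT (Y ^~ t : RT -> RT).
  by apply: nondecreasing_measurable => // a b; exact: ndY.
pose g n k := euler_rate mu sg (e n) (h n) id phix phit k.
pose m n := (T0 * N n)%N.
have mh n : (m n)%:R * h n = T0%:R by rewrite /m natrM -mulrA hE mulr1.
pose A n := step_fun (g n) (h n) (m n).
pose time : set RT := [set` `[0, T0%:R[].
have mtime : measurable time by exact: measurable_itv.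
have ftime : (leb time < +oo)%E.
  by rewrite /time lebesgue_measure_itv/=; case: ifP; rewrite -?EFinB ltry.
have bmed (Z : RT -> RT) s : measurable_fun setT Z ->
    bmeas3 (fun a b c => expR (- spread (Z a) (Z b) (Z c)) * phix (med (Z a) (Z b) (Z c)) s).
  by move=> mZ; exact: (bmeas3_kernel mZ (bphix s)).
have rate_le (Z : RT -> RT) s : measurable_fun setT Z ->
    `|I1 (fun a => phit (Z a) s) + 6^-1 * I3 (fun a b c =>
      expR (- spread (Z a) (Z b) (Z c)) * phix (med (Z a) (Z b) (Z c)) s)| <=
    Bt * M + 6^-1 * (Bx * M ^+ 3).
  move=> mZ; rewrite (le_trans (ler_normD _ _))// lerD//.
    have bZ := bmeas_comp (bphit s) mZ.
    by apply: I1_le => //; [exact: bZ.1|move=> a; exact: hBt].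
  rewrite normrM ger0_norm// ler_wpM2l//; apply: I3_le => //; first exact: bmed.
  move=> a b b'; rewrite normrM -[leRHS]mul1r ler_pM//.
    by rewrite ger0_norm ?expR_ge0// expR_le1 oppr_le0 spread_ge0.
  exact: hBx.
have mE n k : measurable_fun setT (euler mu sg (e n) (h n) id k : RT -> RT).
  exact: measurable_euler.
have A_sum n : \int[leb]_(t in time) A n t = \sum_(k < m n) h n * g n k.
  by rewrite /time -(mh n) integral_step_fun.
(* At a fixed time the positions converge off a null set of labels, and [I1] and [I3] depend
   continuously on positions and time under uniform bounds. *)
have A_cvg t : time t -> A (nn j) t @[j --> \oo] --> flow_rate mu sg Y phi t.
  rewrite /time/= in_itv/= => /andP[t0 tT].
  have [Nt Nt0 cvt] := cvY t.
  pose tau j := (Num.truncn (t / h (nn j)))%:R * h (nn j).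
  have taut : tau j @[j --> \oo] --> t.
    by have := cvg_comp _ _ nn_oo (@grid_cvg t); rewrite (max_idPr t0).
  have AE j : A (nn j) t = I1 (fun a => phit (X (nn j) a t) (tau j)) +
      6^-1 * I3 (fun a b c => expR (- spread (X (nn j) a t) (X (nn j) b t) (X (nn j) c t)) *
                          phix (med (X (nn j) a t) (X (nn j) b t) (X (nn j) c t)) (tau j)).
    by rewrite /A step_funE// t0 mh.
  under eq_fun do rewrite AE.
  have mX j : measurable_fun setT (fun a => X (nn j) a t : RT) by exact: mE.
  apply: cvgD; last (apply: cvgM; first exact: cvg_cst).
    apply: (I1_cvg bsg sg1 (N := Nt) (C := Bt)) => //.
    - by move=> j; exact: (bmeas_comp (bphit _) (mX j)).1.
    - exact: (bmeas_comp (bphit t) (mY t)).1.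
    - by move=> j a; exact: hBt.
    - by move=> a Na; apply: cvg_continuous2 => //; exact: cvt.
  apply: (I3_cvg bsg sg1 (N := Nt) (C := Bx)) => //.
  - by move=> j; exact: (bmed _ (tau j) (mX j)).
  - exact: (bmed _ t (mY t)).
  - move=> j a b b'; rewrite normrM -[leRHS]mul1r ler_pM//.
      by rewrite ger0_norm ?expR_ge0// expR_le1 oppr_le0 spread_ge0.
    exact: hBx.
  - move=> a b b' Na Nb Nb'; apply: cvgM.
      by apply: cvg_expRN_spread; exact: cvt.
    by apply: cvg_continuous2 => //; apply: cvg_med; exact: cvt.
have A_le n t : `|A n t| <= Bt * M + 6^-1 * (Bx * M ^+ 3).
  have [tt|nt] := boolP (0 <= t < (m n)%:R * h n).
    by rewrite /A step_funE//; exact: rate_le.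
  rewrite /A /step_fun big1 ?normr0; first exact: le_trans (rate_le id 0 mid).
  move=> k _; rewrite indicE memNset ?mulr0//= in_itv/= => /andP[k1 k2].
  move/negP : nt; apply; apply/andP; split.
    by apply: le_trans k1; rewrite mulr_ge0// ltW.
  by apply: lt_le_trans k2 _; rewrite ler_pM2r// ler_nat.
pose err n := euler_error mu (e n) (h n) C L.
have err0 : T0%:R * err (nn j) @[j --> \oo] --> 0.
  suff H : T0%:R * err n @[n --> \oo] --> 0 by exact: cvg_comp nn_oo H.
  have -> : (fun n => T0%:R * err n) = (fun n => h n * (T0%:R * (C * (c + 1) ^+ 2 * M)) +
      e n * (T0%:R * 6^-1 * L * M ^+ 3)).
    by apply/funext => n; rewrite /err /euler_error; ring.
  rewrite -[X in _ --> X]addr0; apply: cvgD.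
    rewrite -[X in _ --> X](mul0r (T0%:R * (C * (c + 1) ^+ 2 * M))).
    by apply: cvgM => //; exact: cvg_cst.
  rewrite -[X in _ --> X](mul0r (T0%:R * 6^-1 * L * M ^+ 3)).
  by apply: cvgM => //; exact: cvg_cst.
(* The discrete weak form telescopes: up to a vanishing error, the sum of the rates is the terminal
   term, which is 0, minus the initial term. *)
have sum_cvg : \int[leb]_(t in time) A (nn j) t @[j --> \oo] --> - I1 (fun a => phi (a, 0)).
  apply/cvgrPdist_le => r r0; have /cvgrPdist_le/(_ _ r0) := err0.
  apply: filterS => j; rewrite sub0r normrN => /(le_trans (ler_norm _)).
  apply: le_trans; rewrite A_sum.
  have W := euler_weak_sum mu bsg sg1 (e0 (nn j)) (ltW (h0 (nn j))) mid
    bphi bphix bphit taylor phixL (m (nn j)).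
  have Z : I1 (fun a => phi (euler mu sg (e (nn j)) (h (nn j)) id (m (nn j)) a, T0%:R)) = 0.
    rewrite (@eq_I1 _ _ _ _ _ _ (fun a => 0 * 0)); last first.
      move=> a; rewrite mul0r; apply: (Ksupp [::]); right.
      by rewrite ger0_norm.
    by rewrite I1Z// ?mul0r//; exact: bmeas_cst.
  by rewrite mh Z sub0r in W; exact: W.
have mrate : measurable_fun setT (flow_rate mu sg Y phi : RT -> R).
  apply: (bmeas_flow_rate mu bsg tphi _).1.
  exact: (measurable_lipschitz_snd mY lipY).
have int_cvg : \int[leb]_(t in time) A (nn j) t @[j --> \oo] -->
    \int[leb]_(t in time) flow_rate mu sg Y phi t.
  apply: (@bmeas_cvg_integral _ _ RT leb time mtime ftime _ _ set0
    (Bt * M + 6^-1 * (Bx * M ^+ 3))) => //.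
  - by move=> j; exact: (bmeas_step_fun _ _ _).1.
  - exact: negligible_set0.
  - by move=> t tt _; exact: A_cvg.
(* The same integrals have two limits, which therefore agree; then the window [[0, T0[] is enlarged
   to all nonnegative times, the rate being 0 beyond [K]. *)
rewrite -(cvg_unique _ int_cvg sum_cvg)//.
rewrite Rintegral_mkcond [RHS]Rintegral_mkcond; apply: eq_Rintegral => t _.
have rate0 : K < `|t| -> flow_rate mu sg Y phi t = 0.
  by move=> Kt; apply: (flow_rate0 mu bsg) => x;
    [apply: (Ksupp [:: true])|apply: (Ksupp [:: false])]; right.
rewrite !patchE; case: ifPn => tt.
  case: ifPn => // tt'; apply: rate0.
  move: tt tt'; rewrite !inE /time_domain/= => -[t0 _].
  rewrite notin_setE /time/= in_itv/= t0/= => /negP; rewrite -leNgt => tT.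
  by rewrite ger0_norm// (lt_le_trans KT).
rewrite ifF//; apply/negbTE; move: tt; apply: contra; rewrite !inE /time/= in_itv/=.
by move=> /andP[t0 _]; split => //; rewrite ltry.
Qed.

End flow.

(** * The weak formulation along a flow *)

Section time_integrals.
Context {R : realType}.
Notation RT := (measurableTypeR R).
Notation leb := (@lebesgue_measure R).

Lemma measurable_time_domain (T : \bar R) : measurable (time_domain T : set RT).
Proof.
case: T => [T| |].
- have -> : time_domain T%:E = [set` `[0, T[].
    by apply/seteqP; split => t /=; rewrite /time_domain/= in_itv/= lte_fin;
      [move=> [-> ->]|move=> /andP[]].
  exact: measurable_itv.
- have -> : time_domain +oo%E = [set` `[(0 : R), +oo[].
    by apply/seteqP; split => t /=; rewrite /time_domain/= in_itv/= andbT ?ltry;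
      [move=> []|].
  exact: measurable_itv.
- have -> : time_domain -oo%E = set0 :> set R.
    by apply/seteqP; split => t //= [_]; rewrite ltNge leNye.
  exact: measurable0.
Qed.

(** Cutting at the support bound gives a set of finite measure even for [T = +oo], as the Fubini
    lemmas require. *)
Definition time_window (T : \bar R) (K : R) : set RT :=
  time_domain T `&` [set` `[- K, K]].

Lemma measurable_time_window T K : measurable (time_window T K).
Proof. by apply: measurableI => //; exact: measurable_time_domain. Qed.

Lemma time_window_fin T K : (leb (time_window T K) < +oo)%E.
Proof.
apply: le_lt_trans (lebesgue_itv_fin (- K) K); apply: le_measure; rewrite ?inE//.
- exact: measurable_time_window.
- by move=> t [].
Qed.

Lemma Rintegral_time_window (f : R -> R) T K : (forall t, K < `|t| -> f t = 0) ->
  \int[leb]_(t in time_domain T) f t = \int[leb]_(t in time_window T K) f t.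
Proof.
move=> f0; rewrite Rintegral_mkcond [RHS]Rintegral_mkcond; apply: eq_Rintegral => t _.
rewrite !patchE; case: ifPn => tT; case: ifPn => // tw.
- apply: f0; rewrite ltNge ler_norml; apply: contra tw => tK; rewrite inE.
  by split; [rewrite inE in tT|rewrite /= in_itv].
- by move: tw; rewrite inE => -[h _]; move: tT; rewrite notin_setE.
Qed.

Lemma Rintegral_spacetime (b : RT * RT -> R) T K :
  (forall t x, K < `|x| \/ K < `|t| -> b (t, x) = 0) ->
  \int[leb]_(t in time_domain T) \int[leb]_x b (t, x) =
  \int[leb]_(t in time_window T K) \int[leb]_(x in `[- K, K]) b (t, x).
Proof.
move=> b0; rewrite (@Rintegral_time_window _ T K); last first.
  move=> t tK; transitivity (\int[leb]_(x in [set: R]) (0 : R)).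
    by apply: eq_Rintegral => x _; apply: b0; right.
  by rewrite Rintegral_cst// mul0r.
apply: eq_Rintegral => t _; apply: Rintegral_supp => x xK; apply: b0; by left.
Qed.

Lemma bmeas_integral_lin4 d (X : measurableType d) (m : {measure set X -> \bar R})
  (D : set X) (r : R) (g1 g2 g3 g4 : X -> R) : measurable D -> (m D < +oo)%E ->
  bmeas g1 -> bmeas g2 -> bmeas g3 -> bmeas g4 ->
  \int[m]_(x in D) g1 x - r * \int[m]_(x in D) g2 x - r * \int[m]_(x in D) g3 x
    + \int[m]_(x in D) g4 x =
  \int[m]_(x in D) (g1 x - r * g2 x - r * g3 x + g4 x).
Proof.
move=> mD fD b1 b2 b3 b4.
have bZ f : bmeas f -> @bmeas R _ X (fun t => r * f t).
  by move=> bf; apply: bmeasM => //; exact: bmeas_cst.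
have b12 := bmeasB b1 (bZ _ b2); have b123 := bmeasB b12 (bZ _ b3).
rewrite (bmeas_integralD mD fD b123 b4) (bmeas_integralB mD fD b12 (bZ _ b3)).
by rewrite (bmeas_integralB mD fD b1 (bZ _ b2)) !bmeas_integralZ.
Qed.

End time_integrals.

Section potentials.
Context {R : realType} d (L : measurableType d).
Notation RT := (measurableTypeR R).
Notation leb := (@lebesgue_measure R).
Variables (mu : {finite_measure set L -> \bar R}) (sg : L -> R).
Hypothesis bsg : bmeas sg.
Hypothesis sg1 : forall a, `|sg a| <= 1.
Notation M := (fine (mu setT)).
Variable Y : L -> R -> R.
Hypothesis mY2 : measurable_fun setT (fun z : L * RT => Y z.1 z.2 : RT).

Definition ufun (t x : R) : R := upot mu sg (Y ^~ t) x.
Definition uxfun (t x : R) : R := uxpot mu sg (Y ^~ t) x.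

Let mY t : measurable_fun setT (Y ^~ t : L -> RT).
Proof.
apply: (measurableT_comp mY2 (g := fun a => (a, t))).
exact: pair2_measurable.
Qed.

Let bmeas_conv2 (k : R -> R) : @bmeas R _ RT k ->
  @bmeas R _ (RT * RT)%type (fun p => I1 mu sg (fun a => k (p.2 - Y a p.1))).
Proof.
move=> bk; apply: (bmeas_int2 measurableT (finite_measureT mu)
  (f := fun z : (RT * RT) * L => sg z.2 * k (z.1.2 - Y z.2 z.1.1))).
apply: bmeasM; first exact: (bmeas_comp bsg).
apply: (bmeas_comp bk); apply: measurable_funB; first exact: measurableT_comp.
apply: (measurableT_comp mY2 (g := fun z : (RT * RT) * L => (z.2, z.1.1))).
by apply: measurable_fun_pair => //; exact: measurableT_comp.
Qed.

Lemma bmeas_ufun : @bmeas R _ (RT * RT)%type (fun p => ufun p.1 p.2).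
Proof. exact: bmeas_conv2 bmeas_peakon. Qed.

Lemma bmeas_uxfun : @bmeas R _ (RT * RT)%type (fun p => uxfun p.1 p.2).
Proof. exact: bmeas_conv2 bmeas_dpeakon. Qed.

(** At each time, the Helmholtz identity for [dt phi] turns the linear part into the first summand
    of [flow_rate], and [integral_mch_pot] with [g = dx phi] turns the three cubic parts into the
    second. *)
Lemma mCH_form_flow_rate T phi : spacetime_test_function T phi ->
  mCH_form T ufun uxfun phi =
  \int[leb]_(t in time_domain T) flow_rate mu sg Y phi t.
Proof.
move=> tphi; have [K K0 Ksupp] := test_support tphi.
have sphi : smooth2 phi by case: tphi.
have b2 w : @bmeas R _ (RT * RT)%type (fun p => partial w phi (p.2, p.1)).
  apply: (bmeas_comp (bmeas_test2 w tphi)); exact: measurable_fun_pair.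
have z2 w t x : K < `|x| \/ K < `|t| -> partial w phi (x, t) = 0 by exact: Ksupp.
have bu := bmeas_ufun; have bux := bmeas_uxfun.
pose dtf := [:: true]; pose dx1 := [:: false]; pose dx2 := [:: false; false].
pose dx3 := [:: false; false; false]; pose dtxx := [:: true; false; false].
pose f1 (p : RT * RT) : R := ufun p.1 p.2 * (partial dtf phi (p.2, p.1) - partial dtxx phi (p.2, p.1)).
pose f2 (p : RT * RT) : R := uxfun p.1 p.2 ^+ 3 * partial dx2 phi (p.2, p.1).
pose f3 (p : RT * RT) : R := ufun p.1 p.2 ^+ 3 * partial dx3 phi (p.2, p.1).
pose f4 (p : RT * RT) : R := (ufun p.1 p.2 ^+ 3 + ufun p.1 p.2 * uxfun p.1 p.2 ^+ 2) *
  partial dx1 phi (p.2, p.1).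
have bf1 : bmeas f1 by apply: bmeasM => //; exact: bmeasB.
have bf2 : bmeas f2 by apply: bmeasM => //; exact: bmeasX.
have bf3 : bmeas f3 by apply: bmeasM => //; exact: bmeasX.
have bf4 : bmeas f4.
  apply: bmeasM => //; apply: bmeasD; first exact: bmeasX.
  by apply: bmeasM => //; exact: bmeasX.
have z1 t x : K < `|x| \/ K < `|t| -> f1 (t, x) = 0.
  by move=> h; rewrite /f1 !(z2 _ t x h) subrr mulr0.
have z3 t x : K < `|x| \/ K < `|t| -> f2 (t, x) = 0.
  by move=> h; rewrite /f2 !(z2 _ t x h) mulr0.
have z4 t x : K < `|x| \/ K < `|t| -> f3 (t, x) = 0.
  by move=> h; rewrite /f3 !(z2 _ t x h) mulr0.
have z5 t x : K < `|x| \/ K < `|t| -> f4 (t, x) = 0.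
  by move=> h; rewrite /f4 !(z2 _ t x h) mulr0.
pose D := time_window T K.
have mD : measurable D := measurable_time_window T K.
have fD : (leb D < +oo)%E := time_window_fin T K.
pose G (f : RT * RT -> R) (t : RT) : R := \int[leb]_(x in `[- K, K]) f (t, x).
have bG f : bmeas f -> bmeas (G f).
  by move=> bf; apply: (bmeas_int2 _ (lebesgue_itv_fin _ _) bf).
have -> : mCH_form T ufun uxfun phi =
    \int[leb]_(t in D) G f1 t - 3^-1 * \int[leb]_(t in D) G f2 t
    - 3^-1 * \int[leb]_(t in D) G f3 t + \int[leb]_(t in D) G f4 t.
  have e1 := Rintegral_spacetime T z1; have e2 := Rintegral_spacetime T z3.
  have e3 := Rintegral_spacetime T z4; have e4 := Rintegral_spacetime T z5.
  have cmb (x1 x2 x3 x4 y1 y2 y3 y4 : R) : x1 = y1 -> x2 = y2 -> x3 = y3 -> x4 = y4 ->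
    x1 - 3^-1 * x2 - 3^-1 * x3 + x4 = y1 - 3^-1 * y2 - 3^-1 * y3 + y4.
    by move=> -> -> -> ->.
  exact: cmb e1 e2 e3 e4.
rewrite (bmeas_integral_lin4 _ mD fD (bG _ bf1) (bG _ bf2) (bG _ bf3) (bG _ bf4)).
have flow0 t : K < `|t| -> flow_rate mu sg Y phi t = 0.
  by move=> tK; apply: (flow_rate0 mu bsg) => x; [apply: (z2 dtf)|apply: (z2 dx1)]; right.
rewrite (Rintegral_time_window T flow0); apply: eq_Rintegral => t _.
have sec (f : RT * RT -> R) : bmeas f -> @bmeas R _ RT (fun x => f (t, x)).
  by move=> bf; apply: (bmeas_comp bf); exact: pair1_measurable.
have cw w : continuous (fun x => partial w phi (x, t)).
  exact: (is_derive_continuous (fun x => test_dx tphi w x t)).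
have supp w x : K < `|x| -> [/\ partial w phi (x, t) = 0,
    partial (false :: w) phi (x, t) = 0 & partial (false :: false :: w) phi (x, t) = 0].
  by move=> xK; split; apply: z2; left.
rewrite -addrA -addrA; congr (_ + _).
  rewrite /G -(Rintegral_supp (L := K)); last by move=> x h; apply: z1; left.
  have E := integral_upot_helmholtz mu bsg (mY t)
    (fun x => test_dx tphi [:: true] x t) (fun x => test_dx tphi [:: false; true] x t)
    (cw [:: false; false; true]) (supp [:: true]).
  refine (etrans _ E).
  have e : partial dtxx phi = partial [:: false; false; true] phi by exact: (test_dtdxdx tphi).
  have e' x : f1 (t, x) = upot mu sg (Y ^~ t) x *
      (partial [:: true] phi (x, t) - partial [:: false; false; true] phi (x, t)).
    by rewrite /f1 e.
  apply: eq_Rintegral => x _.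
  exact: e'.
have E := integral_mch_pot mu bsg (mY t)
  (fun x => test_dx tphi [:: false] x t) (fun x => test_dx tphi [:: false; false] x t)
  (cw [:: false; false; false]) (supp [:: false]).
refine (etrans _ E).
rewrite (@Rintegral_supp _ _ K); last first.
  by move=> x /(supp [:: false])[-> -> ->]; rewrite !mulr0 oppr0 !addr0.
(* The linear term has been split off; 0 takes its slot so that the same linearity lemma merges the
   three cubic integrals. *)
have lin := bmeas_integral_lin4 (m := leb) 3^-1 (measurable_itv `[- K, K])
  (lebesgue_itv_fin (- K) K) (bmeas_cst _ 0) (sec _ bf2) (sec _ bf3) (sec _ bf4).
have e0 : \int[leb]_(x in `[- K, K]) (0 : R) = 0.
  by rewrite Rintegral_cst// mul0r.
move: lin; rewrite e0 sub0r -!addrA => ->.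
apply: eq_Rintegral => x _.
have E2 : f2 (t, x) = uxpot mu sg (Y ^~ t) x ^+ 3 * partial [:: false; false] phi (x, t).
  exact: erefl.
have E3 : f3 (t, x) = upot mu sg (Y ^~ t) x ^+ 3 * partial [:: false; false; false] phi (x, t).
  exact: erefl.
have E4 : f4 (t, x) = (upot mu sg (Y ^~ t) x ^+ 3 +
    upot mu sg (Y ^~ t) x * uxpot mu sg (Y ^~ t) x ^+ 2) * partial [:: false] phi (x, t).
  exact: erefl.
rewrite add0r; move: E2 E3 E4.
move: (f2 (t, x)) (f3 (t, x)) (f4 (t, x)) => v2 v3 v4 -> -> ->.
by move: (partial _ phi _) (partial _ phi _) (partial _ phi _) => w2 w3 w4; ring.
Qed.

End potentials.

(** * Sobolev regularity *)

Section kernel_estimates.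
Context {R : realType}.
Notation RT := (measurableTypeR R).
Notation leb := (@lebesgue_measure R).

Lemma integral_peakon (a : R) : (\int[leb]_x (peakon (x - a))%:E = 1)%E.
Proof.
pose F (x : R) := x - a.
have dF (x : R) : is_derive x (1 : R) F 1.
  by apply: is_derive_eq; rewrite subr0.
have dF1 : derive1 F = cst 1.
  by apply/funext => x; rewrite derive1E derive_val.
transitivity (\int[leb]_x (((peakon \o F) * derive1 F) x)%:E)%E.
  by apply: eq_integral => x _; rewrite dF1 /= fctE mulr1.
rewrite -(@increasing_ge0_integration_by_substitutionT _ F peakon); last 9 first.
- by move=> x y xy; rewrite ltrD2r.
- by rewrite dF1 => x; exact: cvg_cst.
- by rewrite dF1; exact: is_cvg_cst.
- by rewrite dF1; exact: is_cvg_cst.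
- by move=> x; apply: ex_derive.
- exact: cvg_addrr_Ny.
- exact: cvg_addrr.
- exact: continuous_peakon.
- exact: peakon_ge0.
rewrite ge0_symfun_integralT; last 3 first.
- exact: peakon_ge0.
- exact: continuous_peakon.
- by move=> x; rewrite /= /peakon normrN.
have -> : [set x : R | 0 <= x] = `[0, +oo[%classic.
  by apply/seteqP; split => x/=; rewrite in_itv/= andbT.
pose G (x : R) := - (2^-1 * expR (- x)).
have dG (x : R) : is_derive x (1 : R) G (2^-1 * expR (- x)).
  apply: is_derive_eq; rewrite /GRing.scale/=; ring.
rewrite (@ge0_continuous_FTC2y _ _ G _ 0).
- by rewrite /G oppr0 expR0 mulr1 -EFinB sub0r opprK -EFinM divff.
- by move=> x _; exact: peakon_ge0.
- by apply: continuous_subspaceT; exact: continuous_peakon.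
- rewrite -oppr0; apply: cvgN; rewrite -[0 in X in _ --> X](mulr0 2^-1); apply: cvgM; first exact: cvg_cst.
  exact: cvgr_expR.
- by move=> x _; apply: ex_derive.
- apply: cvg_at_right_filter; apply: differentiable_continuous.
  by apply/derivable1_diffP; apply: ex_derive.
- move=> x; rewrite in_itv/= andbT => x0; rewrite derive1E derive_val /peakon ger0_norm//.
  exact: ltW.
Qed.

(** An L1 modulus of continuity under translation by [d]: [expR d - 1] measures the relative
    variation of a kernel of integral 1, and [2 * d] is the length of the segment where the kernel
    may jump. *)
Definition kernel_modulus (d : R) : R := expR d - 1 + 2 * d.

Lemma peakon_dist (d x y : R) : `|x - y| <= d ->
  `|peakon x - peakon y| <= (expR d - 1) * peakon x.
Proof.
move=> xyd; have d0 : 0 <= d := le_trans (normr_ge0 _) xyd.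
have -> : peakon y = peakon x * expR (`|x| - `|y|).
  by rewrite /peakon -mulrA -expRD; congr (_ * expR _); ring.
rewrite -[X in X - _]mulr1 -mulrBr normrM (ger0_norm (peakon_ge0 x)) mulrC.
apply: ler_wpM2r; first exact: peakon_ge0.
have : `| `|x| - `|y| | <= d by exact: le_trans (ler_dist_dist _ _) xyd.
move: (`|x| - `|y|) => z; rewrite ler_norml => /andP[dz zd].
have e1 : expR z <= expR d by rewrite ler_expR.
have e2 : expR (- d) <= expR z by rewrite ler_expR.
have e3 : 1 - expR (- d) <= expR d - 1.
  have p := expR_gt0 d; rewrite expRN.
  have q : expR d * (expR d)^-1 = 1 by rewrite divff// gt_eqF.
  have r : 1 <= expR d by rewrite -expR0 ler_expR.
  have s : 0 < (expR d)^-1 by rewrite invr_gt0.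
  move: q r s; move: (expR d) ((expR d)^-1) => E E'; nra.
rewrite ler_norml; apply/andP; split; lra.
Qed.

(** Two points within [d] of each other have the same sign when one of them is farther than [d] from
    0, so the jump is avoided and the estimate reduces to that of [peakon]. *)
Lemma dpeakon_dist (d x y : R) : `|x - y| <= d -> d < `|x| ->
  `|dpeakon x - dpeakon y| <= (expR d - 1) * peakon x.
Proof.
move=> xyd dx; suff -> : `|dpeakon x - dpeakon y| = `|peakon x - peakon y|.
  exact: peakon_dist.
have -> : dpeakon y = - Num.sg x * peakon y.
  rewrite /dpeakon; congr (- _ * _).
  move: xyd dx; rewrite ler_norml => /andP[h1 h2].
  have [x0|x0|->] := ltrgt0P x => h.
  - by rewrite !gtr0_sg//; lra.
  - by rewrite !ltr0_sg//; lra.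
  - lra.
rewrite /dpeakon -mulrBr normrM normrN normr_sg.
have : x != 0 by apply: contraTneq dx => ->; rewrite normr0 -leNgt (le_trans _ xyd).
by move=> ->; rewrite mul1r.
Qed.

(* Either kernel jumps by at most 1 near the origin and varies slowly elsewhere. *)
Lemma kernel_dist (k : R -> R) (d x y : R) : k = peakon \/ k = dpeakon ->
  `|x - y| <= d ->
  `|k x - k y| <= (expR d - 1) * peakon x + \1_(`[- d, d]) x.
Proof.
move=> kE xyd; have d0 : 0 <= d := le_trans (normr_ge0 _) xyd.
have e0 : 0 <= (expR d - 1) * peakon x.
  by rewrite mulr_ge0 ?peakon_ge0// subr_ge0 -expR0 ler_expR.
have [xd|dx] := leP `|x| d.
  have -> : \1_(`[- d, d]) x = 1 :> R.
    by rewrite indicE mem_set//= in_itv/= -ler_norml.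
  have k2 z : `|k z| <= 2^-1.
    case: kE => ->; first by rewrite ger0_norm ?peakon_ge0// peakon_le.
    exact: le_trans (normr_dpeakon_le _) (peakon_le _).
  have := le_trans (ler_normB (k x) (k y)) (lerD (k2 x) (k2 y)).
  lra.
have -> : \1_(`[- d, d]) x = 0 :> R.
  by rewrite indicE memNset//= in_itv/= -ler_norml leNgt dx.
by rewrite addr0; case: kE => ->; [exact: peakon_dist|exact: dpeakon_dist].
Qed.

Lemma integral_kernel_dist (k : R -> R) (d a b : R) : k = peakon \/ k = dpeakon ->
  `|a - b| <= d ->
  (\int[leb]_x (`|k (x - a) - k (x - b)|)%:E <= (kernel_modulus d)%:E)%E.
Proof.
move=> kE abd; have d0 : 0 <= d := le_trans (normr_ge0 _) abd.
have bk : @bmeas R _ RT k.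
  by case: kE => ->; [exact: bmeas_peakon|exact: bmeas_dpeakon].
have mB (c : R) : measurable_fun setT ((fun x => x - c) : RT -> RT).
  by apply: measurable_funB => //; exact: measurable_cst.
have mkc c (h : R -> R) : @bmeas R _ RT h -> measurable_fun setT (fun x : RT => h (x - c)).
  by move=> bh; exact: (bmeas_comp bh (mB c)).1.
have mp : measurable_fun setT (fun x : RT => (expR d - 1) * peakon (x - a)).
  by apply: measurable_funM; [exact: measurable_cst|exact: mkc bmeas_peakon].
have md : measurable_fun setT (fun x : RT => \1_(`[- d, d]) (x - a) : R).
  by apply: mkc; apply: bmeas_indic.
have e0 : 0 <= expR d - 1 by rewrite subr_ge0 -expR0 ler_expR.
apply: (@le_trans _ _ (\int[leb]_x (((expR d - 1) * peakon (x - a))%:E +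
   (\1_(`[- d, d]) (x - a))%:E))%E).
  apply: ge0_le_integral => //.
  - by apply/measurable_EFinP; apply: measurableT_comp => //; apply: measurable_funB; exact: mkc.
  - by apply: emeasurable_funD; apply/measurable_EFinP.
  - move=> x _; rewrite -EFinD lee_fin; apply: kernel_dist => //.
    by rewrite (_ : x - a - (x - b) = b - a) 1?distrC//; ring.
rewrite ge0_integralD//; last 3 first.
- by move=> x _; rewrite lee_fin mulr_ge0// peakon_ge0.
- exact/measurable_EFinP.
- exact/measurable_EFinP.
rewrite /kernel_modulus EFinD; apply: leeD.
  under eq_integral do rewrite EFinM.
  rewrite ge0_integralZl//; last 2 first.
  - by apply/measurable_EFinP; exact: mkc bmeas_peakon.
  - by move=> x _; rewrite lee_fin peakon_ge0.
  by rewrite integral_peakon mule1.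
rewrite (_ : (fun x => (\1_(`[- d, d]) (x - a))%:E) =
  (fun x => (\1_(`[a - d, a + d]) x : R)%:E)); last first.
  apply/funext => x; congr EFin; rewrite !indicE; congr (_%:R); congr nat_of_bool.
  by apply/idP/idP; rewrite !inE/= !in_itv/= => /andP[h1 h2]; apply/andP; split; lra.
rewrite integral_indic// setIT.
have := lebesgue_measure_itv `[a - d, a + d]; rewrite /= lte_fin => ->; case: ifPn => _.
  by rewrite -EFinB lee_fin; lra.
by rewrite lee_fin mulr_ge0.
Qed.

Lemma kernel_modulus_ge0 (d : R) : 0 <= d -> 0 <= kernel_modulus d.
Proof. by move=> d0; rewrite addr_ge0 ?mulr_ge0// subr_ge0 -expR0 ler_expR. Qed.

Lemma kernel_modulus_cvg0 : kernel_modulus d @[d --> (0:R)] --> (0:R).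
Proof.
rewrite -[X in _ --> X](_ : expR 0 - 1 + 2 * 0 = 0); last by rewrite expR0 subrr mulr0 addr0.
apply: cvgD; last by apply: cvgM; [exact: cvg_cst|exact: cvg_id].
by apply: cvgB; [exact: continuous_expR|exact: cvg_cst].
Qed.

End kernel_estimates.

(** * Bounds on the L2, H1 and sup norms *)

Section norms.
Context {R : realType}.
Notation RT := (measurableTypeR R).
Notation leb := (@lebesgue_measure R).
Implicit Types f g : R -> R.

Lemma Lnorm2_sqr f : ('N[leb]_2%:E[EFin \o f] ^+ 2 = \int[leb]_x (f x ^+ 2)%:E)%E.
Proof.
have -> : (\int[leb]_x (f x ^+ 2)%:E = \int[leb]_x `|(EFin \o f) x| `^ 2)%E.
  apply: eq_integral => x _; rewrite /= powR_mulrn//.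
  by rewrite real_normK// num_real.
rewrite unlock poweR12_sqrt ?sqr_sqrte ?integral_ge0// => x _; exact: poweR_ge0.
Qed.

Lemma Lfun2P f (B : R) : measurable_fun setT (f : RT -> RT) ->
  (\int[leb]_x (f x ^+ 2)%:E <= B%:E)%E -> f \in Lfun leb 2%:E.
Proof.
move=> mf fB; apply/andP; split; first by rewrite inE.
rewrite inE /= /finite_norm; have h := le_lt_trans fB (ltry B).
apply: contraLR h; rewrite -leNgt leye_eq => /eqP N.
by rewrite -Lnorm2_sqr N expe2 mulyy ltxx.
Qed.

Lemma H1_norm_le f g (B : R) : 0 <= B ->
  (\int[leb]_x (f x ^+ 2)%:E <= B%:E)%E -> (\int[leb]_x (g x ^+ 2)%:E <= B%:E)%E ->
  (H1_norm f g <= (Num.sqrt (2 * B))%:E)%E.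
Proof.
move=> B0 fB gB; rewrite /H1_norm !Lnorm2_sqr poweR12_sqrt; last first.
  by rewrite adde_ge0// integral_ge0// => x _; rewrite lee_fin sqr_ge0.
rewrite -[leRHS]/(sqrte (2 * B)%:E) lee_sqrt ?lee_fin ?mulr_ge0//.
by rewrite mulr_natl mulr2n EFinD leeD.
Qed.

Lemma Lnorm_oo_le f (B : R) : (forall x, `|f x| <= B) ->
  ('N[leb]_+oo[EFin \o f] <= B%:E)%E.
Proof.
move=> fB; rewrite unlock; case: ifPn => _.
  by apply/ess_supP; apply/nearW => x; rewrite /= lee_fin.
(* On a space of measure zero the norm is 0 by convention, and [B] is nonnegative by the bound at
   one point. *)
by rewrite lee_fin (le_trans _ (fB 0)).
Qed.

End norms.

Section sobolev.
Context {R : realType} d (L : measurableType d).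
Notation RT := (measurableTypeR R).
Notation leb := (@lebesgue_measure R).
Variables (mu : {finite_measure set L -> \bar R}) (sg : L -> R).
Hypothesis bsg : bmeas sg.
Hypothesis sg1 : forall a, `|sg a| <= 1.
Notation M := (fine (mu setT)).

(** The square is the sup bound [M] times the bound by the integral of [|k|] over labels; Tonelli
    then needs only L1 control of [k] in [x]. So L1 kernel estimates yield L2 estimates of
    potentials. *)
Lemma I1_sqr_le (k : L * RT -> R) (B : R) : bmeas k -> (forall z, `|k z| <= 1) ->
  (forall a, (\int[leb]_x (`|k (a, x)|)%:E <= B%:E)%E) ->
  (\int[leb]_x (I1 mu sg (fun a => k (a, x)) ^+ 2)%:E <= (M ^+ 2 * B)%:E)%E.
Proof.
move=> bk k1 kB; have M0 : 0 <= M by exact: fine_ge0.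
have bI : @bmeas R _ RT (fun x => I1 mu sg (fun a => k (a, x))).
  apply: (bmeas_int2 measurableT (finite_measureT mu)
    (f := fun z : RT * L => sg z.2 * k (z.2, z.1))).
  apply: bmeasM; first exact: (bmeas_comp bsg).
  by apply: (bmeas_comp bk); exact: measurable_fun_pair.
have bkx x : @bmeas R _ L (fun a => k (a, x)).
  by apply: (bmeas_comp bk); exact: pair2_measurable.
have mk : measurable_fun setT (fun z : RT * L => (`|k (z.2, z.1)|)%:E).
  apply/measurable_EFinP; apply: measurableT_comp => //.
  by apply: (measurableT_comp bk.1); exact: measurable_fun_pair.
have mF : measurable_fun setT (fun x : RT => \int[mu]_a (`|k (a, x)|)%:E)%E.
  exact: (measurable_fun_fubini_tonelli_F (m2 := mu) _ mk).
have mG : measurable_fun setT (fun a => \int[leb]_x (`|k (a, x)|)%:E)%E.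
  exact: (measurable_fun_fubini_tonelli_G (m1 := leb) _ mk).
have pw x : ((I1 mu sg (fun a => k (a, x)) ^+ 2)%:E <=
    M%:E * \int[mu]_a (`|k (a, x)|)%:E)%E.
  have i1 : `|I1 mu sg (fun a => k (a, x))| <= M.
    by rewrite -[leRHS]mul1r; apply: I1_le => //; exact: (bkx x).1.
  have i2 : ((`|I1 mu sg (fun a => k (a, x))|)%:E <= \int[mu]_a (`|k (a, x)|)%:E)%E.
    have bs : bmeas (fun a => sg a * k (a, x)) by exact: bmeasM.
    have ints := bmeas_integrable measurableT (finite_measureT mu) bs.
    rewrite /I1 /Rintegral -abse_EFin fineK; last exact: integrable_fin_num.
    apply: (le_trans (le_abse_integral _ measurableT (measurable_int _ ints))).
    apply: ge0_le_integral => //.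
    - by apply: measurableT_comp => //; exact: (measurable_int _ ints).
    - by apply/measurable_EFinP; apply: measurableT_comp => //; exact: (bkx x).1.
    - by move=> a _; rewrite /= lee_fin normrM ler_piMl.
  rewrite -(real_normK (num_real _)) expr2 EFinM.
  by apply: lee_pmul; rewrite ?lee_fin.
apply: (@le_trans _ _ (\int[leb]_x (M%:E * \int[mu]_a (`|k (a, x)|)%:E))%E).
  apply: ge0_le_integral => //.
  - by move=> x _; rewrite lee_fin sqr_ge0.
  - by apply/measurable_EFinP; exact: (bmeasX 2 bI).1.
  - by apply: measurable_funeM; exact: mF.
rewrite ge0_integralZl//; last by move=> x _; exact: integral_ge0.
rewrite expr2 -mulrA EFinM; apply: lee_wpmul2l; rewrite ?lee_fin//.
rewrite (fubini_tonelli _ mk)//=.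
apply: (@le_trans _ _ (\int[mu]_a (B%:E))%E).
  apply: ge0_le_integral => //.
  - by move=> a _; exact: integral_ge0.
rewrite integral_cst// muleC EFinM fineK// fin_num_measure//.
Qed.

Lemma bmeas_locally_integrable (f : RT -> R) : bmeas f -> locally_integrable setT f.
Proof.
move=> bf; split; [exact: bf.1|exact: openT|] => K _ cK.
have mK : measurable (K : set RT) by exact: compact_measurable.
have fK : (leb K < +oo)%E by exact: compact_finite_measure.
by have /integrableP[_] := bmeas_integrable mK fK bf.
Qed.

Section snapshot.
Variable Y : L -> RT.
Hypothesis mY : measurable_fun setT Y.

Lemma weak_derivative_upot : weak_derivative (upot mu sg Y) (uxpot mu sg Y).
Proof.
have bu := bmeas_upot mu bsg mY; have bux := bmeas_uxpot mu bsg mY.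
split; [exact: bmeas_locally_integrable|exact: bmeas_locally_integrable|].
move=> phi [dphi cphi].
have dn n (x : R) : is_derive x (1 : R) (derive1n n phi) (derive1n n.+1 phi x).
  by rewrite derive1nS derive1E; apply: derivableP.
have [K supp] : exists K, forall x, K < `|x| ->
    [/\ phi x = 0, derive1n 1 phi x = 0 & derive1n 2 phi x = 0].
  have [K [_ Kb]] := compact_bounded cphi.
  pose Q := closure [set x | phi x != 0].
  have out x : ~ Q x -> phi x = 0.
    by move=> Qx; apply: contrapT => /eqP p; apply: Qx; exact: subset_closure.
  have dout n x : ~ Q x -> derive1n n phi x = 0.
    elim: n x => [//|n IH] x Qx.
    rewrite derive1nS derive1E; apply: derive_outside_support => c; apply: Qx.
    apply: (@closed_closure _ [set x | phi x != 0]); apply: closureS c => y /= ny.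
    by apply: contrapT => /IH h; rewrite h eqxx in ny.
  exists (K + 1) => x xK; have Qx : ~ Q x.
    move=> Qx; have := Kb (K + 1) _ x Qx; rewrite ltrDl ltr01 => /(_ isT).
    by rewrite /= leNgt xK.
  by split; [exact: out|exact: dout|exact: dout].
rewrite (integral_uxpot mu bsg mY (dn 0%N) (dn 1%N) _ supp)//.
exact: (is_derive_continuous (dn 2%N)).
Qed.

Lemma upot_bounds x : `|upot mu sg Y x| <= M /\ `|uxpot mu sg Y x| <= M.
Proof.
have mx : measurable_fun setT (fun a => x - Y a).
  by apply: measurable_funB => //; exact: measurable_cst.
have le1 : (2^-1 : R) <= 1 by rewrite invf_le1// ler1n.
split; rewrite -[leRHS]mul1r; apply: I1_le => //.
- exact: (bmeas_comp bmeas_peakon mx).1.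
- by move=> a; rewrite ger0_norm ?peakon_ge0// (le_trans (peakon_le _)).
- exact: (bmeas_comp bmeas_dpeakon mx).1.
- by move=> a; rewrite (le_trans (normr_dpeakon_le _))// (le_trans (peakon_le _)).
Qed.

Lemma sobolev1_2_upot : sobolev1 2%:E (upot mu sg Y) (uxpot mu sg Y).
Proof.
have bk (k : RT -> R) : bmeas k -> @bmeas R _ (L * RT)%type (fun z => k (z.2 - Y z.1)).
  move=> bk; apply: (bmeas_comp bk); apply: measurable_funB => //.
  exact: measurableT_comp.
have le1 : (2^-1 : R) <= 1 by rewrite invf_le1// ler1n.
have kp (k : RT -> R) : bmeas k -> (forall x, `|k x| <= peakon x) ->
    (\int[leb]_x (I1 mu sg (fun a => k (x - Y a)) ^+ 2)%:E <= (M ^+ 2 * 1)%:E)%E.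
  move=> bk' kp; have mB a : measurable_fun setT ((fun x => x - Y a) : RT -> RT).
    by apply: measurable_funB => //; exact: measurable_cst.
  apply: (I1_sqr_le (bk _ bk')) => [z|a].
    by rewrite (le_trans (kp _))// (le_trans (peakon_le _)).
  rewrite -(integral_peakon (Y a)); apply: ge0_le_integral => //.
  - apply/measurable_EFinP; apply: measurableT_comp => //.
    exact: (bmeas_comp bk' (mB a)).1.
  - by apply/measurable_EFinP; exact: (bmeas_comp bmeas_peakon (mB a)).1.
  - by move=> x _; rewrite lee_fin.
split; last exact: weak_derivative_upot.
- apply: (Lfun2P (bmeas_upot mu bsg mY).1 (kp _ bmeas_peakon _)) => x.
  by rewrite ger0_norm ?peakon_ge0.
- apply: (Lfun2P (bmeas_uxpot mu bsg mY).1 (kp _ bmeas_dpeakon _)) => x.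
  exact: normr_dpeakon_le.
Qed.

Lemma sobolev1_oo_upot : sobolev1 +oo%E (upot mu sg Y) (uxpot mu sg Y).
Proof.
split; last exact: weak_derivative_upot.
- apply/andP; split; first by rewrite inE; exact: (bmeas_upot mu bsg mY).1.
  rewrite inE; apply: le_lt_trans (ltry M); apply: Lnorm_oo_le => x.
  exact: (upot_bounds x).1.
- apply/andP; split; first by rewrite inE; exact: (bmeas_uxpot mu bsg mY).1.
  rewrite inE; apply: le_lt_trans (ltry M); apply: Lnorm_oo_le => x.
  exact: (upot_bounds x).2.
Qed.

Lemma W1oo_norm_upot : (W1oo_norm (upot mu sg Y) (uxpot mu sg Y) <= (M + M)%:E)%E.
Proof.
by rewrite EFinD; apply: leeD; apply: Lnorm_oo_le => x; have [] := upot_bounds x.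
Qed.

End snapshot.

Section flow.
Variables (Y : L -> R -> R) (c : R).
Hypothesis c0 : 0 <= c.
Hypothesis lipY : forall a s t, `|Y a t - Y a s| <= c * `|t - s|.
Hypothesis mY : forall t, measurable_fun setT (Y ^~ t : L -> RT).

(** [I1_sqr_le] is applied to the difference of the kernels at the two times; its sup bound 1 holds
    because each kernel is at most 1/2, and its L1 bound is [kernel_modulus] of the displacement. *)
Lemma H1_norm_increment s t :
  (H1_norm (ufun mu sg Y t \- ufun mu sg Y s)%R
     (uxfun mu sg Y t \- uxfun mu sg Y s)%R <=
   (Num.sqrt (2 * (M ^+ 2 * kernel_modulus (c * `|t - s|))))%:E)%E.
Proof.
set w := kernel_modulus _.
have mx (r : R) x : measurable_fun setT (fun a => x - Y a r).
  by apply: measurable_funB; [exact: measurable_cst|exact: mY].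
have kE (k : RT -> R) : bmeas k -> k = peakon \/ k = dpeakon ->
    (\int[leb]_x ((I1 mu sg (fun a => k (x - Y a t)) -
       I1 mu sg (fun a => k (x - Y a s))) ^+ 2)%:E <= (M ^+ 2 * w)%:E)%E.
  move=> bk kE.
  have bkx r x : bmeas (fun a => k (x - Y a r)).
    exact: (bmeas_comp bk (mx r x)).
  have k2 z : `|k z| <= 2^-1.
    case: kE => ->; first by rewrite ger0_norm ?peakon_ge0// peakon_le.
    exact: le_trans (normr_dpeakon_le _) (peakon_le _).
  have h := @I1_sqr_le (fun z => k (z.2 - Y z.1 t) - k (z.2 - Y z.1 s)) w.
  have E x : I1 mu sg (fun a => k (x - Y a t)) - I1 mu sg (fun a => k (x - Y a s)) =
      I1 mu sg (fun a => k (x - Y a t) - k (x - Y a s)).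
    rewrite /I1 -(bmeas_integralB measurableT (finite_measureT mu));
      [|exact: bmeasM|exact: bmeasM].
    by apply: eq_Rintegral => a _; rewrite mulrBr.
  under eq_integral do rewrite E.
  apply: h.
  - have bk2 r : @bmeas R _ (L * RT)%type (fun z => k (z.2 - Y z.1 r)).
      apply: (bmeas_comp bk); apply: measurable_funB => //.
      exact: (measurableT_comp (mY r)).
    exact: bmeasB.
  - move=> z; have := le_trans (ler_normB (k (z.2 - Y z.1 t)) (k (z.2 - Y z.1 s))) (lerD (k2 _) (k2 _)).
    lra.
  - move=> a; exact: (integral_kernel_dist kE (lipY a s t)).
apply: H1_norm_le.
- by rewrite mulr_ge0 ?sqr_ge0// kernel_modulus_ge0// mulr_ge0.
- exact: (kE _ bmeas_peakon (or_introl erefl)).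
- exact: (kE _ bmeas_dpeakon (or_intror erefl)).
Qed.

Lemma C_H1_ufun T : C_H1 T (ufun mu sg Y) (uxfun mu sg Y).
Proof.
split=> [t _|s _]; first exact: sobolev1_2_upot.
apply: (@squeeze_cvge _ _ _ _ (cst 0%E) _ (fun t =>
  (Num.sqrt (2 * (M ^+ 2 * kernel_modulus (c * `|t - s|))))%:E)).
- apply: nearW => t; rewrite poweR_ge0; exact: H1_norm_increment.
- exact: cvg_cst.
apply: cvg_within_filter; apply: cvg_EFin; first exact: nearW.
have -> : 0 = Num.sqrt (2 * (M ^+ 2 * 0)) :> R by rewrite !mulr0 sqrtr0.
apply: continuous_cvg; first exact: sqrt_continuous.
apply: cvgM; first exact: cvg_cst.
apply: cvgM; first exact: cvg_cst.
apply: (@cvg_comp _ _ _ (fun t => c * `|t - s|) kernel_modulus _ (nbhs (0 : R)));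
  last exact: kernel_modulus_cvg0.
have : c * `|t - s| @[t --> s] --> c * `|s - s|.
  apply: cvgM; first exact: cvg_cst.
  by apply: cvg_norm; apply: cvgB; [exact: cvg_id|exact: cvg_cst].
by rewrite subrr normr0 mulr0.
Qed.

Lemma Loo_W1oo_ufun T : Loo_W1oo T (ufun mu sg Y) (uxfun mu sg Y).
Proof.
exists (M + M); apply: nearW => t _; split.
- exact: sobolev1_oo_upot.
- exact: W1oo_norm_upot.
Qed.

End flow.

End sobolev.

(** * Charges and the momentum measure *)

Section pushforward.
Context {R : realType} d1 d2 (T1 : measurableType d1) (T2 : measurableType d2).
Variables (m : {finite_measure set T1 -> \bar R}) (f : T1 -> T2).
Hypothesis mf : measurable_fun setT f.

(** The measurability proof is an argument of the term, so that measure and finiteness instances can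
    be attached to [fpush mf]. *)
Definition fpush of measurable_fun setT f : set T2 -> \bar R := pushforward m f.

HB.instance Definition _ := Measure.copy (fpush mf)
  (measure_function_pushforward__canonical__measure_function_Measure m mf).

Let fpush_fin : fin_num_fun (fpush mf).
Proof.
move=> A mA; apply: fin_num_measure; rewrite -[X in measurable X]setTI; exact: mf.
Qed.

HB.instance Definition _ := Measure_isFinite.Build _ _ _ (fpush mf) fpush_fin.

Lemma bmeas_integral_fpush (g : T2 -> R) : bmeas g ->
  \int[fpush mf]_y g y = \int[m]_x g (f x).
Proof.
move=> bg; rewrite /Rintegral; congr fine.
apply: (integral_pushforward mf) => //.
- by apply/measurable_EFinP; exact: bg.1.
- rewrite preimage_setT.
  exact: (bmeas_integrable measurableT (finite_measureT m) (bmeas_comp bg mf)).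
Qed.

End pushforward.

Section charge_integral.
Context {R : realType} d (X : measurableType d).

Lemma bmeas_integral_null (m : {finite_measure set X -> \bar R}) (Q : set X)
    (g1 g2 : X -> R) : measurable Q -> m Q = 0%E -> bmeas g1 -> bmeas g2 ->
  (forall x, ~ Q x -> g1 x = g2 x) -> \int[m]_x g1 x = \int[m]_x g2 x.
Proof.
move=> mQ Q0 b1 b2 g12; rewrite /Rintegral; congr fine.
apply: ae_eq_integral => //.
- by apply/measurable_EFinP; exact: b1.1.
- by apply/measurable_EFinP; exact: b2.1.
- exists Q; split=> // x /= gx; apply: contrapT => Qx; apply: gx => _.
  by rewrite g12.
Qed.

Lemma bmeas_integral_mfrestr (m : {measure set X -> \bar R}) (D : set X)
    (mD : measurable D) (fD : (m D < +oo)%E) (f : X -> R) : bmeas f ->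
  \int[mfrestr mD fD]_x f x = \int[m]_(x in D) f x.
Proof.
move=> bf; transitivity (\int[mfrestr mD fD]_x (f \_ D) x).
  apply: (@bmeas_integral_null _ (~` D)) => //.
  - exact: measurableC.
  - by rewrite /= /mfrestr /mrestr setICl measure0.
  - exact: bmeas_patch.
  - by move=> x /contrapT Dx; rewrite patchE mem_set.
rewrite -Rintegral_mkcond /Rintegral; congr fine; apply: eq_measure_integral => A mA AD.
by rewrite /= /mfrestr /mrestr setIidl.
Qed.

Lemma bmeas_integral_measure_add (m1 m2 : {finite_measure set X -> \bar R}) (f : X -> R) :
  bmeas f -> \int[measure_add m1 m2]_x f x = \int[m1]_x f x + \int[m2]_x f x.
Proof.
move=> bf.
have i1 := bmeas_integrable measurableT (finite_measureT m1) bf.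
have i2 := bmeas_integrable measurableT (finite_measureT m2) bf.
rewrite /Rintegral integral_measure_add//.
by rewrite fineD// integrable_fin_num.
Qed.

(** Two differences of measures that agree give, after rearrangement, an equality of sums of
    positive measures, against which [f] is integrated. No decomposition of the space is
    compared. *)
Lemma charge_integral_measure_diff (nu : {charge set X -> \bar R})
    (m1 m2 : {finite_measure set X -> \bar R}) (f : X -> R) :
  (forall A, measurable A -> nu A = m1 A - m2 A)%E -> bmeas f ->
  charge_integral nu setT f = \int[m1]_x f x - \int[m2]_x f x.
Proof.
move=> nuE bf; rewrite /charge_integral.
set h := svalP _; set p := jordan_pos h; set n := jordan_neg h.
suff : \int[p]_x f x + \int[m2]_x f x = \int[m1]_x f x + \int[n]_x f x by lra.
rewrite -!bmeas_integral_measure_add//.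
rewrite /Rintegral; congr fine; apply: eq_measure_integral => A mA _.
have fp : p A \is a fin_num by exact: fin_num_measure.
have fn : n A \is a fin_num by exact: fin_num_measure.
have f1 : m1 A \is a fin_num by exact: fin_num_measure.
have f2 : m2 A \is a fin_num by exact: fin_num_measure.
have E : (p A - n A = m1 A - m2 A)%E.
  transitivity (p A + (-1)%:E * n A)%E; first by rewrite EFinN mulN1e.
  by rewrite -nuE//; exact/esym/(jordan_decomp h mA).
transitivity (p A + m2 A)%E; first exact: measure_addE.
transitivity (m1 A + n A)%E; last by apply/esym; exact: measure_addE.
move: E; rewrite -(fineK fp) -(fineK fn) -(fineK f1) -(fineK f2).
by rewrite -!EFinB -!EFinD => -[e]; congr EFin; lra.
Qed.

Variable nu : {charge set X -> \bar R}.
Notation h := (svalP (hahn_sets nu)).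

Definition tvar : set X -> \bar R := measure_add (jordan_pos h) (jordan_neg h).

HB.instance Definition _ := Measure.on tvar.

Let tvar_fin : fin_num_fun tvar.
Proof.
move=> A mA; rewrite /tvar [_ A]measure_addE fin_numD.
by rewrite !(fin_num_measure (jordan_pos h), fin_num_measure (jordan_neg h)).
Qed.

HB.instance Definition _ := Measure_isFinite.Build _ _ _ tvar tvar_fin.

Definition charge_sign : X -> R :=
  fun x => \1_((sval (hahn_sets nu)).1) x - \1_((sval (hahn_sets nu)).2) x.

Lemma bmeas_charge_sign : bmeas charge_sign.
Proof.
have [[mP _] [mN _] _ _] := h.
by apply: bmeasB; exact: bmeas_indic.
Qed.

Lemma charge_sign_le1 x : `|charge_sign x| <= 1.
Proof.
rewrite /charge_sign !indicE.
by case: (_ \in _); case: (_ \in _); rewrite ?subrr ?subr0 ?sub0r ?normrN ?normr0 ?normr1.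
Qed.

(** The positive part does not charge the negative Hahn set and conversely, so under each part the
    sign is almost everywhere constant. *)
Lemma charge_integral_tvar (f : X -> R) : bmeas f ->
  charge_integral nu setT f = I1 tvar charge_sign f.
Proof.
move=> bf; have bsf := bmeasM bmeas_charge_sign bf.
have [[mP posP] [mN negN] PNT PN0] := h.
set P := (sval _).1 in mP posP PNT PN0; set N := (sval _).2 in mN negN PNT PN0.
rewrite /I1 [RHS](_ : _ = \int[jordan_pos h]_x (charge_sign x * f x) +
  \int[jordan_neg h]_x (charge_sign x * f x)); last exact: bmeas_integral_measure_add.
have cover x : P x \/ N x by have : (P `|` N) x by rewrite PNT.
have disj x : P x -> N x -> False by move=> Px Nx; have : (P `&` N) x by []; rewrite PN0.
have signP x : ~ N x -> f x = charge_sign x * f x.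
  move=> Nx; have [Px|//] := cover x.
  by rewrite /charge_sign -/P -/N !indicE mem_set// memNset// subr0 mul1r.
have signN x : ~ P x -> - f x = charge_sign x * f x.
  move=> Px; have [//|Nx] := cover x.
  by rewrite /charge_sign -/P -/N !indicE memNset// mem_set// sub0r mulN1r.
have posN : jordan_pos h N = 0%E.
  by rewrite jordan_posE cjordan_posE /crestr0 mem_set// /crestr setIC PN0 charge0.
have negP : jordan_neg h P = 0%E.
  by rewrite jordan_negE cjordan_negE /crestr0 mem_set// /crestr PN0 charge0 oppe0.
rewrite -(bmeas_integral_null mN posN bf bsf signP).
rewrite -(bmeas_integral_null mP negP (bmeasN bf) bsf signN).
rewrite /charge_integral; congr (_ + _).
under [RHS]eq_Rintegral do rewrite -mulN1r.
by rewrite (bmeas_integralZ measurableT (finite_measureT (jordan_neg h)) _ bf) mulN1r.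
Qed.

End charge_integral.

(** * The measure carried by the trajectories *)

Section momentum.
Context {R : realType} d (L : measurableType d).
Notation RT := (measurableTypeR R).
Notation leb := (@lebesgue_measure R).
Variables (m0 : {charge set L -> \bar R}) (Y : L -> R -> R).
Hypothesis mY2 : measurable_fun setT (fun z : L * RT => Y z.1 z.2 : RT).
Notation mu := (tvar m0).
Notation sg := (charge_sign m0).
Notation h := (svalP (hahn_sets m0)).

Let traj (z : L * RT) : RT * RT := (Y z.1 z.2, z.2).

Let mtraj : measurable_fun setT traj.
Proof. exact: measurable_fun_pair. Qed.

Lemma momentum_measure_ufun (T : R) : exists m : {charge set (RT * RT)%type -> \bar R},
  momentum_measure T%:E (ufun mu sg Y) m.
Proof.
pose D := time_domain T%:E : set RT.
have mD : measurable D := measurable_time_domain T%:E.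
have fD : (leb D < +oo)%E.
  apply: le_lt_trans (lebesgue_itv_fin 0 T); apply: le_measure; rewrite ?inE//.
  by move=> t [t0]; rewrite lte_fin /= in_itv/= t0 => /ltW.
pose push (p : {finite_measure set L -> \bar R}) : {finite_measure set (RT * RT)%type -> \bar R} :=
  fpush (fprod p (mfrestr mD fD)) mtraj.
(* The two parts of [m0] are transported separately. Trajectories of opposite signs may overlap, so
   the images need not be a Jordan decomposition; [charge_integral_measure_diff] accepts any
   difference of finite measures. *)
exists (cadd (charge_of_finite_measure (push (jordan_pos h)))
  (copp (charge_of_finite_measure (push (jordan_neg h))))).
move=> phi tphi; set m := cadd _ _.
have [K K0 Ksupp] := test_support tphi.
pose D2 : set (RT * RT) := [set p | time_domain T%:E p.2].
have mD2 : measurable D2.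
  by rewrite -[D2]setTI; apply: measurable_snd => //; exact: mD.
pose g : RT * RT -> R := phi \_ D2.
have bphi : @bmeas R _ (RT * RT)%type phi := bmeas_test2 [::] tphi.
have bg : bmeas g := bmeas_patch mD2 bphi.
(* Restricting the function instead of the domain allows the lemmas on integrals over the whole
   space to be used. *)
have -> : charge_integral m D2 phi = charge_integral m setT g.
  by rewrite /charge_integral !(Rintegral_mkcond _ D2).
rewrite (@charge_integral_measure_diff _ _ _ m (push (jordan_pos h)) (push (jordan_neg h)))//.
have mswap : measurable_fun setT (fun z : RT * L => traj (z.2, z.1)).
  by apply: (measurableT_comp mtraj); exact: measurable_fun_pair.
have bint (p : {finite_measure set L -> \bar R}) (f : RT * RT -> R) : bmeas f ->
    @bmeas R _ RT (fun t => \int[p]_a f (Y a t, t)).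
  move=> bf; exact: (bmeas_int2 measurableT (finite_measureT p) (bmeas_comp bf mswap)).
have E (p : {finite_measure set L -> \bar R}) : \int[push p]_y g y =
    \int[leb]_(t in D) \int[p]_a phi (Y a t, t).
  rewrite (bmeas_integral_fpush _ mtraj bg) (bmeas_fprod_swap _ _ (bmeas_comp bg mtraj)).
  rewrite bmeas_integral_mfrestr; last exact: bint.
  apply: eq_Rintegral => t tD; apply: eq_Rintegral => a _.
  by rewrite /g patchE /traj/= mem_set//; rewrite inE in tD.
rewrite !E -bmeas_integralB//; [|exact: bint|exact: bint].
apply: eq_Rintegral => t _.
have mYt : measurable_fun setT (Y ^~ t : L -> RT).
  apply: (measurableT_comp mY2 (g := fun a => (a, t))); exact: pair2_measurable.
have E1 := integral_upot_helmholtz mu (bmeas_charge_sign m0) mYt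
  (fun x => test_dx tphi [::] x t) (fun x => test_dx tphi [:: false] x t)
  (is_derive_continuous (fun x => test_dx tphi [:: false; false] x t))
  (fun x xK => And3 (Ksupp [::] x t (or_introl xK)) (Ksupp [:: false] x t (or_introl xK))
    (Ksupp [:: false; false] x t (or_introl xK))).
refine (etrans E1 _); apply/esym.
refine (etrans _ (charge_integral_tvar _ _)); first by [].
apply: (bmeas_comp bphi (g := fun a => (Y a t, t))); exact: measurable_fun_pair.
Qed.

End momentum.

Theorem theorem1p4 (R : realType)
    (m0 : {charge set (measurableTypeR R) -> \bar R})
    (hm0 : compact (charge_support m0)) :
  exists u ux : R -> R -> R,
    [/\ mCH_weak_solution +oo%E m0 u ux,
        C_H1 +oo%E u ux,
        Loo_W1oo +oo%E u ux &
        forall T : R, 0 < T ->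
          exists m : {charge set (measurableTypeR R * measurableTypeR R)%type -> \bar R},
            momentum_measure T%:E u m].
Proof.
pose mu : {finite_measure set (measurableTypeR R) -> \bar R} := tvar m0.
pose sg := charge_sign m0.
have bsg : bmeas sg := bmeas_charge_sign m0.
have sg1 : forall a, `|sg a| <= 1 := charge_sign_le1 m0.
have [Y [ndY lipY Y0 weakY]] := flow_exists mu bsg sg1.
have mY t : measurable_fun setT (Y ^~ t : measurableTypeR R -> measurableTypeR R).
  by apply: nondecreasing_measurable => // a b; exact: ndY.
have mY2 := measurable_lipschitz_snd mY lipY.
have c0 : 0 <= 2^-1 * fine (mu setT) ^+ 2 by rewrite mulr_ge0 ?exprn_ge0 ?fine_ge0.
have C := C_H1_ufun mu bsg sg1 c0 lipY mY +oo%E.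
have W := Loo_W1oo_ufun mu bsg sg1 mY +oo%E.
exists (ufun mu sg Y), (uxfun mu sg Y); split => //; last first.
  by move=> T _; exact: momentum_measure_ufun.
(* The form equals the time integral of the rate, which the flow evaluates at the initial positions;
   as [Y a 0 = a], these are the labels, distributed by [m0] itself. *)
split => // phi tphi; rewrite (mCH_form_flow_rate mu bsg mY2 tphi) weakY//; congr (- _).
apply/esym/charge_integral_tvar.
have b := test_bmeas tphi [::] 0.
exact: b.
Qed.
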